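(* Let $N\ge1$, let $0\le h_1<\dots<h_N$ be integers of the same parity, let $l_0,l_1\ge1$, put $d=(l_0+l_1-1)+\frac{h_N-h_1}2$, and let $V_1,V_2$ be $d$-dimensional $\mathbb F_{q^2}$-vector spaces with a perfect bilinear pairing $B:V_1\times V_2^{(q)}\to\mathbb F_{q^2}$. Let $k_1+1<\dots<k_r+1$ be the elements of $\{1,\dots,d-1\}$ of the form $l_1+\frac{h_i-h_1}2$, and $k_1'+1<\dots<k'_{r'}+1$ the elements of $\{1,\dots,d-1\}$ of the form $l_0+\frac{h_N-h_i}2$ ($1\le i\le N$). Let $J=J_1\sqcup J_2$ with $J_1=\{s_1,\dots,s_{d-1}\}\setminus\{s_{k_1+1},\dots,s_{k_r+1}\}$, $J_2=\{s_1,\dots,s_{d-1}\}\setminus\{s_{k'_1+1},\dots,s_{k'_{r'}+1}\}$, and let $X_{\mathbf\Lambda_j}^{\mathbf h_j}=\overline{X_J\{(s_{l_1}s_{l_1+1}\cdots s_{d-1},\,s_{l_0}s_{l_0+1}\cdots s_{d-1})\}}$, the closure being taken in the flag variety of type $J$. Then $$X_{\mathbf\Lambda_j}^{\mathbf h_j}=\bigsqcup_{\substack{w_1,\dots,w_r\\ w_1',\dots,w'_{r'}}}X_J\{(w_1w_2\cdots w_r,\,w_1'w_2'\cdots w'_{r'})\},$$ where the $w_i,w'_i$ run over all permutations of the form $w_i=s_{k_i+1}\cdots s_{k_i+t_i}$ with $0\le t_i\le k_{i+1}-k_i$ for $1\le i\le r-1$, $w'_i=s_{k_i'+1}\cdots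 s_{k_i'+t_i'}$ with $0\le t'_i\le k'_{i+1}-k'_i$ for $1\le i\le r'-1$, $w_r=s_{k_r+1}\cdots s_{k_r+t_r}$ with $0\le t_r\le d-1-k_r$, and $w'_{r'}=s_{k'_{r'}+1}\cdots s_{k'_{r'}+t'_{r'}}$ with $0\le t'_{r'}\le d-1-k'_{r'}$.
   Context: $q$ is a power of an odd prime; for a vector space $V$ over a field $k\supset\mathbb F_q$, $V^{(q)}=V\otimes_{k,x\mapsto x^q}k$, and $f^{(q)}$ is the induced map. $\mathbf G=\mathrm{GL}(V_{1,\overline{\mathbb F}_q})\times\mathrm{GL}(V_{2,\overline{\mathbb F}_q})$ has the Frobenius $\Phi(u,v)=((v^{-1})^{(q),*},(u^{-1})^{*,(q)})$, $*$ being the adjoint for $B$; $\mathbf G^\Phi\simeq\mathrm{GL}(V_1)$. A complete flag $\mathcal F^1$ of $V_1$ and its orthogonal flag $(\mathcal F^1)^{\perp,(q)}$ of $V_2$ define a $\Phi$-stable Borel $\mathbf B$ containing a $\Phi$-stable maximal torus. The Weyl group is $\mathbf W=S_d\times S_d$ with simple reflections $(s_i,\mathrm{id}),(\mathrm{id},s_i)$, $s_i=(i\ \ i+1)$, $1\le i\le d-1$, and $\Phi(w_1,w_2)=(w_0w_2w_0,w_0w_1w_0)$, $w_0(i)=d+1-i$. $J=J_1\sqcup J_2$ denotes a set of simple reflections in the two factors; $\mathbf G/\mathbf P_J$ parametrizes pairs of flags of $V_1$, $V_2$ with members of dimensions $\{x:s_x\notin J_1\}$, $\{x:s_x\notin J_2\}$.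 ${}^J\mathbf W$ is the set of $w$ with $\ell(vw)=\ell(v)+\ell(w)$ for all $v\in\mathbf W_J$. For $w\in{}^J\mathbf W$, the fine Deligne–Lusztig variety is $X_J\{w\}=\{g\mathbf P_J:g^{-1}\Phi(g)\in\mathbf P_J\cdot_\Phi\mathbf Bw\mathbf B\}$, $x\cdot_\Phi y=xy\Phi(x)^{-1}$; equivalently the image of $X(w)=\{g\mathbf B:g^{-1}\Phi(g)\in\mathbf Bw\mathbf B\}$. Empty products are the identity. In the paper, $V_1=\pi\Lambda_0^{i_{j+1}}/\pi^2\Lambda_1^{i_j\vee}$ and $V_2=\Lambda_1^{i_j}/\pi\Lambda_0^{i_{j+1}\vee}$ for vertex lattices of a Bruhat–Tits index, and $(h_1,\dots,h_N)$ above is the sub-tuple $(h_{i_j+1},\dots,h_{i_{j+1}})$. *)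

(* Defs.v *)
From HB Require Import structures.
From mathcomp Require Import all_boot all_order all_fingroup all_algebra.
From mathcomp Require Import all_field.
From mathcomp Require Import boolp classical_sets topology_structure.
From mathcomp Require mpoly.
(* The notations of mpoly clash with those of classical_sets. *)
Import (canonicals) mpoly.

Set Implicit Arguments.
Unset Strict Implicit.
Unset Printing Implicit Defensive.

Import GRing.Theory.

Local Open Scope ring_scope.
Local Open Scope classical_set_scope.

(* A map B : V1 -> V2 -> F that is q-semilinear in its second argument is the
   same as a bilinear map V1 x V2^(q) -> F, through y |-> y (x) 1, since
   (c y) (x) 1 = c^q (y (x) 1) in V2^(q). The last two fields say that the
   induced maps V1 -> (V2^(q))^* and V2^(q) -> V1^* are bijective. *)
Record perfect_pairing (q : nat) (F : fieldType) (V1 V2 : lmodType F)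
    (B : V1 -> V2 -> F) : Prop := PerfectPairing {
  pairing_linear_l : forall y, scalar (B^~ y);
  pairing_semilinear_r : forall x c y y',
    B x (c *: y + y') = c ^+ q * B x y + B x y';
  pairing_perfect_l : forall f : V2 -> F,
    (forall c y y', f (c *: y + y') = c ^+ q * f y + f y') ->
    exists! x, forall y, f y = B x y;
  pairing_perfect_r : forall f : V1 -> F, scalar f ->
    exists! y, forall x, f x = B x y
}.

(* The flag spanned by e2 is the orthogonal flag, twisted by (q), of the flag
   spanned by e1: {y (x) 1 | y in U}^(q) is U itself in V2^(q^2) = V2. *)
Definition orthogonal_flags (F : fieldType) (V1 V2 : vectType F)
    (B : V1 -> V2 -> F) (d : nat) (e1 : d.-tuple V1) (e2 : d.-tuple V2) : Prop :=
  forall i, (i <= d)%N -> forall y : V2,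
    (y \in <<take i e2>>%VS) <->
    (forall x : V1, x \in <<take (d - i) e1>>%VS -> B x y = 0).

Section WeylGroup.
Variable d : nat.

Definition weyl := ('S_d * 'S_d)%type.

(* s_x = (x  x+1) for 1 <= x <= d - 1, acting on ordinals shifted by one.
   Permutations are multiplied in the order of mathcomp, for which perm_mx is
   multiplicative: a word in the s_x and the product of the corresponding
   permutation matrices agree. *)
Definition simple_tperm (x : nat) : 'S_d :=
  match insub x.-1, insub x with
  | Some i, Some j => tperm i j
  | _, _ => 1%g
  end.

Definition simple1 (x : nat) : weyl := (simple_tperm x, 1%g).
Definition simple2 (x : nat) : weyl := (1%g, simple_tperm x).

Definition simples : {set weyl} :=
  [set w in [seq simple1 x | x <- iota 1 d.-1]
            ++ [seq simple2 x | x <- iota 1 d.-1]].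

(* Least n such that w is a product of n simple reflections; #|weyl| is a
   crude bound for it. *)
Definition weyl_length (w : weyl) : nat :=
  find (fun n => w \in (simples ^+ n)%g) (iota 0 #|{: weyl}|).

(* The set written ^J W. *)
Definition min_coset_rep (J : {set weyl}) (w : weyl) : Prop :=
  forall v, v \in <<J>>%g -> weyl_length (v * w)%g = (weyl_length v + weyl_length w)%N.

(* s_a s_(a+1) ... s_(b-1) *)
Definition simple_word (a b : nat) : 'S_d :=
  (\prod_(a <= x < b) simple_tperm x)%g.

End WeylGroup.

Section Group.
Variables (k : closedFieldType) (d : nat).

(* Matrices act on column vectors, in the bases (e1, e2). *)
Definition mxpair := ('M[k]_d * 'M[k]_d)%type.

Definition GG : set mxpair := [set g | g.1 \in unitmx /\ g.2 \in unitmx].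

Definition mulG (g h : mxpair) : mxpair := (g.1 *m h.1, g.2 *m h.2).
Definition invG (g : mxpair) : mxpair := (invmx g.1, invmx g.2).

Definition torus : set mxpair :=
  [set g | GG g /\ is_diag_mx g.1 /\ is_diag_mx g.2].

(* u maps the span of the first x basis vectors into itself. *)
Definition stabilizes (x : nat) (u : 'M[k]_d) : Prop :=
  forall i j : 'I_d, (j < x <= i)%N -> u i j = 0.

Definition parabolic (J : {set weyl d}) : set mxpair :=
  [set g | GG g /\
     forall x, (0 < x < d)%N ->
       (simple1 d x \notin J -> stabilizes x g.1) /\
       (simple2 d x \notin J -> stabilizes x g.2)].

Definition borel : set mxpair := parabolic finset.set0.

Definition weyl_lift (w : weyl d) : mxpair := (perm_mx w.1, perm_mx w.2).

Definition bruhat_cell (w : weyl d) : set mxpair :=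
  [set g | exists b b', borel b /\ borel b' /\
     g = mulG (mulG b (weyl_lift w)) b'].

Definition coset (J : {set weyl d}) (g : mxpair) : set mxpair :=
  [set mulG g p | p in parabolic J].

Definition coordinates (g : mxpair) : 'I_(d * d + d * d) -> k :=
  fun i => row_mx (mxvec g.1) (mxvec g.2) 0 i.

(* The principal open sets {f <> 0} form a base of the Zariski topology. *)
Definition zariski_open (U : set mxpair) : Prop :=
  U `<=` GG /\
  forall g, U g -> exists f : mpoly.mpoly (d * d + d * d) k,
    mpoly.meval (coordinates g) f != 0 /\
    forall h, GG h -> mpoly.meval (coordinates h) f != 0 -> U h.

(* The k-points of G / P_J. *)
Definition flag_variety (J : {set weyl d}) : Type :=
  set_type [set coset J g | g in GG].

Definition flag_coset (J : {set weyl d}) (c : flag_variety J) : set mxpair :=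
  sval c.

HB.instance Definition _ J := Choice.on (flag_variety J).

Section Topology.
Variable J : {set weyl d}.

(* The Zariski topology of G / P_J is the quotient topology. *)
Definition flag_open (U : set (flag_variety J)) : Prop :=
  zariski_open [set g | GG g /\ exists2 c, U c & flag_coset c = coset J g].

Lemma flag_openT : flag_open setT.
Proof.
split=> [g []//|g [gG _]]; exists (mpoly.mpolyC _ 1).
split; first by rewrite mpoly.mevalC oner_neq0.
move=> h hG _; split=> //.
by exists (exist _ (coset J h) (mem_set (imageP (coset J) hG))).
Qed.

Lemma flag_openI : setI_closed flag_open.
Proof.
move=> U V [_ UP] [_ VP]; split=> [g []//|g [gG [c [Uc Vc] cE]]].
have [|f [f0 fP]] := UP g; first by split=> //; exists c.
have [|f' [f'0 f'P]] := VP g; first by split=> //; exists c.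
exists (f * f'); rewrite mpoly.mevalM mulf_neq0//; split=> // h hG.
rewrite mpoly.mevalM mulf_eq0 negb_or => /andP[fh f'h].
have [_ [c1 Uc1 c1E]] := fP h hG fh; have [_ [c2 Vc2 c2E]] := f'P h hG f'h.
split=> //; exists c1 => //; split=> //.
by have -> : c1 = c2 by apply: val_inj; rewrite -[LHS]/(flag_coset c1) -[RHS]/(flag_coset c2) c1E c2E.
Qed.

Lemma flag_open_bigcup (I : Type) (f : I -> set (flag_variety J)) :
  (forall i, flag_open (f i)) -> flag_open (\bigcup_i f i).
Proof.
move=> fO; split=> [g []//|g [gG [c [i _ ic] cE]]].
have [|p [p0 pP]] := (fO i).2 g; first by split=> //; exists c.
exists p; split=> // h hG ph; have [_ [c' ic' c'E]] := pP h hG ph.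
by split=> //; exists c' => //; exists i.
Qed.

HB.instance Definition _ := isOpenTopological.Build (flag_variety J)
  flag_openT flag_openI flag_open_bigcup.

End Topology.
End Group.

Section Frobenius.
Variables (F : fieldType) (k : closedFieldType) (iota : {rmorphism F -> k}).
Variables (q d : nat) (V1 V2 : vectType F) (B : V1 -> V2 -> F).
Variables (e1 : d.-tuple V1) (e2 : d.-tuple V2).

(* The matrix of f^(q) in the base-changed basis. *)
Definition frob_mx (m n : nat) (A : 'M[k]_(m, n)) : 'M[k]_(m, n) :=
  map_mx (fun x => x ^+ q) A.

Definition gram : 'M[k]_d := \matrix_(i, j) iota (B (tnth e1 i) (tnth e2 j)).

(* The base change of B to V1_k x V2_k^(q). *)
Definition pairing_k (x y : 'cV[k]_d) : k := (x^T *m gram *m y) 0 0.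

(* Adjoint of an endomorphism of V1_k, resp. of V2_k^(q). *)
Definition adjoint1 (u : 'M[k]_d) : 'M[k]_d := invmx gram *m u^T *m gram.
Definition adjoint2 (v : 'M[k]_d) : 'M[k]_d := (gram *m v *m invmx gram)^T.

Lemma adjoint1P (u : 'M[k]_d) (x y : 'cV[k]_d) : gram \in unitmx ->
  pairing_k (u *m x) y = pairing_k x (adjoint1 u *m y).
Proof.
move=> gU; rewrite /pairing_k /adjoint1 trmx_mul !mulmxA.
by rewrite -(mulmxA x^T) mulmxV// mulmx1.
Qed.

Lemma adjoint2P (v : 'M[k]_d) (x y : 'cV[k]_d) : gram \in unitmx ->
  pairing_k x (v *m y) = pairing_k (adjoint2 v *m x) y.
Proof.
move=> gU; rewrite /pairing_k /adjoint2 trmx_mul trmxK !mulmxA.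
by rewrite -(mulmxA (x^T *m gram *m v)) mulVmx// mulmx1.
Qed.

Definition Phi (g : mxpair k d) : mxpair k d :=
  (adjoint2 (frob_mx (invmx g.2)), frob_mx (adjoint1 (invmx g.1))).

Definition torus_stable : Prop := forall g, torus g -> torus (Phi g).

(* X_J{w}, with x ._Phi y = x y Phi(x)^-1. *)
Definition fine_DL (J : {set weyl d}) (w : weyl d) : set (flag_variety k J) :=
  [set c | exists2 g, GG g & flag_coset c = coset J g /\
     exists p y, parabolic J p /\ bruhat_cell w y /\
       mulG (invG g) (Phi g) = mulG (mulG p y) (invG (Phi p))].

End Frobenius.

Arguments fine_DL {F k} iota q {d V1 V2} B e1 e2 J w.

Section Index.
Variables (N : nat) (h : nat -> nat) (l0 l1 d : nat).

(* The increasing sequences k_1 < ... < k_r and k'_1 < ... < k'_r'. *)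
Definition k_seq : seq nat :=
  [seq x <- iota 0 d.-1 | x.+1 \in [seq (l1 + (h i - h 1%N)./2)%N | i <- iota 1 N]].
Definition k'_seq : seq nat :=
  [seq x <- iota 0 d.-1 | x.+1 \in [seq (l0 + (h N - h i)./2)%N | i <- iota 1 N]].

Definition J1 : {set weyl d} :=
  [set w in [seq simple1 d x | x <- iota 1 d.-1]]
  :\: [set w in [seq simple1 d x.+1 | x <- k_seq]].
Definition J2 : {set weyl d} :=
  [set w in [seq simple2 d x | x <- iota 1 d.-1]]
  :\: [set w in [seq simple2 d x.+1 | x <- k'_seq]].
Definition Jh : {set weyl d} := J1 :|: J2.

(* The tuples (w_1, ..., w_r) with w_i = s_(k_i + 1) ... s_(k_i + t_i) and
   t_i <= k_(i+1) - k_i, where k_(r+1) := d - 1 is the default value of nth. *)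
Definition admissible (ks : seq nat) (ws : seq 'S_d) : Prop :=
  size ws = size ks /\
  forall i, (i < size ks)%N -> exists2 t,
    (t <= nth d.-1 ks i.+1 - nth d.-1 ks i)%N &
    nth 1%g ws i = simple_word d (nth d.-1 ks i).+1 (nth d.-1 ks i + t).+1.

Definition index_set : set (seq 'S_d * seq 'S_d) :=
  [set ww | admissible k_seq ww.1 /\ admissible k'_seq ww.2].

Definition index_prod (ww : seq 'S_d * seq 'S_d) : weyl d :=
  ((\prod_(w <- ww.1) w)%g, (\prod_(w <- ww.2) w)%g).

(* The variety denoted X_Lambda_j^h_j. *)
Definition X_Lambda (F : fieldType) (k : closedFieldType)
    (iota : {rmorphism F -> k}) (q : nat) (V1 V2 : vectType F)
    (B : V1 -> V2 -> F) (e1 : d.-tuple V1) (e2 : d.-tuple V2) :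
    set (flag_variety k Jh) :=
  closure (fine_DL iota q B e1 e2 Jh (simple_word d l1 d, simple_word d l0 d)).

End Index.

Arguments index_set : clear implicits.
Arguments X_Lambda N h l0 l1 {d F k} iota q {V1 V2} B e1 e2.

(* Main.v *)
(* Turning the second flag into its orthogonal, a point of G/B is a pair of full
   flags A, C of one space, and g^-1 Phi(g) records the positions of C relative
   to A and to s(A), where s is the q^2-Frobenius. For words w, w' in distinct
   letters s_x, taken in increasing order, B w B is a set of Hessenberg matrices,
   so X(w, w') is defined by C_x <= A_(x+1), C_x <= s(A_(x+1)), and by the set of
   those x for which C_x <= A_x, resp. C_x <= s(A_x), which are read off the
   letters. The flags of type J retain A_x and C_(x-1) for the points
   x = l_1 + (h_i - h_1)/2.
   - The conditions C_(x-1) <= A_x and C_(x-1) <= s(A_x) at these points are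
     closed, so they hold on the closure. Conversely, they allow the partial
     flags to be refined, gap by gap, to full flags whose positions are given by
     exactly one of the indices (w, w').
   - Every stratum is in the closure of the large one: g^-1 Phi(g) = m deforms
     to m + t U, which lies in the large cell for t <> 0, and a polynomial f with
     f(g) <> 0 is nonzero somewhere on the Lang fiber over m + t U for all but
     finitely many t: modulo the equations of the fiber, f is a combination of
     monomials with exponents < q, which are linearly independent on it. *)

Require Import Defs.
From HB Require Import structures.
From mathcomp Require Import all_boot all_order all_fingroup all_algebra.
From mathcomp Require Import all_field.
From mathcomp Require Import boolp classical_sets topology_structure.
From mathcomp Require mpoly.
From mathcomp Require Import zify.

Set Implicit Arguments.
Unset Strict Implicit.
Unset Printing Implicit Defensive.

Import GRing.Theory.
Import (canonicals, coercions) mpoly.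

(** * Lang's theorem for semilinear systems *)

(** Torus stability, together with the orthogonality of the two base flags, forces the Gram matrix
    of [B] to be antidiagonal. Passing to the orthogonal flag therefore only reflects matrices in
    the antidiagonal, and the letter x of the second word turns into d - x: this is why the letters
    of the first word form initial segments of the gaps, and those of the second word final
    segments. The obstacle is that A and s(A) constrain C simultaneously, so a gap cannot be refined
    one flag at a time. Some steps are forced, replacing A by A + s(A) or C by C ∩ s(C); where none
    is forced, a line fixed by a semilinear map has to be chosen. Uniqueness of the index reuses the
    forced steps: the two ends A_x and C_e of a gap already decide the last condition relative to A
    and the first one relative to s(A), and an induction on the length follows. For density, Lang's
    theorem provides q^n solutions of an invertible semilinear system in n unknowns, as many as
    there are monomials with exponents < q; interpolation at these solutions gives the
    independence. *)

Section Lang.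
Local Open Scope ring_scope.
Variables (k : closedFieldType) (sg : {rmorphism k -> k}) (q : nat).
Hypotheses (q_gt1 : (1 < q)%N) (sgE : forall x, sg x = x ^+ q).

Section FixedVector.
Variables (n : nat) (L : 'M[k]_n).
Hypothesis L_unit : L \in unitmx.

Let tau (x : 'rV[k]_n) := map_mx sg x *m invmx L.

Let tau_sum m (c : 'I_m -> k) (V : 'I_m -> 'rV[k]_n) :
  tau (\sum_i c i *: V i) = \sum_i (c i ^+ q) *: tau (V i).
Proof.
rewrite /tau raddf_sum mulmx_suml; apply: eq_bigr => i _.
by rewrite /= map_mxZ -scalemxAl sgE.
Qed.

Let tau_eq0 x : tau x = 0 -> x = 0.
Proof.
move=> /(congr1 (mulmxr L)); rewrite /= mul0mx mulmxKV // => /eqP.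
by rewrite map_mx_eq0 => /eqP.
Qed.

(** With b the unknown last coefficient, a_i = b^q t_i(b) turns the recursion a_(i+1) = a_i^q +
    c_(i+1) b^q into t_(i+1) = X^(q^2 - q) t_i^q + c_(i+1). *)
Let top_coef (c : nat -> k) := fix t i : {poly k} :=
  if i is i'.+1 then 'X^(q * q - q) * t i' ^+ q + (c i)%:P else (c 0%N)%:P.

Let top_coef_eq0 c i : top_coef c i = 0 -> forall j, (j <= i)%N -> c j = 0.
Proof.
elim: i => [|i IH] /=.
  move=> /eqP; rewrite polyC_eq0 => /eqP c0 j.
  by rewrite leqn0 => /eqP ->.
move=> t0; have qq : (0 < q * q - q)%N by nia.
have ci : c i.+1 = 0.
  have := congr1 (horner^~ 0) t0.
  by rewrite /= !hornerE expr0n eqn0Ngt qq mul0r add0r.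
move=> j; rewrite leq_eqVlt => /predU1P[->//|]; rewrite ltnS; apply: IH.
move/eqP: t0; rewrite ci polyC0 addr0 mulf_eq0 expf_eq0 polyX_eq0 andbF /=.
by rewrite expf_eq0 => /andP[_ /eqP].
Qed.

(** The left side is what [tau] makes of the sum of the a_i V_i. Its last term b^q V_m is expanded
    by the linear relation, after which the recursion identifies the coefficients. *)
Let shift_sum m (a c : nat -> k) b (V : nat -> 'rV[k]_n) : (0 < m)%N ->
  a m.-1 = b -> (forall i, a i.+1 = a i ^+ q + c i.+1 * b ^+ q) ->
  a 0%N = c 0%N * b ^+ q -> V m = \sum_(i < m) c i *: V i ->
  \sum_(i < m) a i ^+ q *: V i.+1 = \sum_(i < m) a i *: V i.
Proof.
case: m => // m _ am aS a0 Vm.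
rewrite big_ord_recr /= am Vm scaler_sumr big_ord_recl [RHS]big_ord_recl /= a0.
rewrite addrCA scalerA mulrC; congr (_ + _); rewrite -big_split /=.
apply: eq_bigr => i _; rewrite /bump /= !add1n aS scalerDl scalerA.
by rewrite [b ^+ _ * _]mulrC.
Qed.

(* Krylov: with V_i = tau^i v and V_m = \sum_(i < m) c_i V_i the first linear
   relation, x = \sum_i a_i V_i is fixed by tau as soon as
   a_i = a_(i-1)^q + c_i b^q with b = a_(m-1), a polynomial equation for b. *)
Lemma semilinear_fixed_vector : (0 < n)%N ->
  exists2 x : 'rV[k]_n, x != 0 & map_mx sg x = x *m L.
Proof.
move=> n0; pose v : 'rV[k]_n := delta_mx 0 (Ordinal n0).
have v0 : v != 0.
  apply/eqP => /matrixP/(_ 0 (Ordinal n0))/eqP; rewrite !mxE !eqxx /=; exact/negP/oner_neq0.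
pose V i := iter i tau v; pose W m : 'M_(m, n) := \matrix_(i < m) V i.
have exm : exists m, ~~ row_free (W m.+1).
  exists n; rewrite /row_free neq_ltn; apply/orP; left.
  exact: leq_ltn_trans (rank_leq_col _) _.
have [m nfree min_m] := ex_minnP exm.
have free_m : row_free (W m).
  case: m min_m {nfree} => [|m] min_m; first by rewrite /row_free -leqn0 rank_leq_row.
  by apply: contraT => /min_m; rewrite ltnn.
have WE r (u : 'rV[k]_r) : u *m W r = \sum_(i < r) u 0 i *: V i.
  by rewrite mulmx_sum_row; apply: eq_bigr => i _; rewrite rowK.
have indep (a : nat -> k) : \sum_(i < m) a i *: V i = 0 -> forall i, (i < m)%N -> a i = 0.
  move=> E i im; have := WE _ (\row_(i < m) a i).
  rewrite (eq_bigr (fun i : 'I_m => a i *: V i)) ?E => [|j _]; last by rewrite mxE.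
  move/eqP; rewrite (mulmx_free_eq0 _ free_m) => /eqP/rowP/(_ (Ordinal im)).
  by rewrite !mxE.
have [u u0 uW] : exists2 u : 'rV_m.+1, u != 0 & u *m W m.+1 = 0.
  have : kermx (W m.+1) != 0 by rewrite kermx_eq0.
  move=> /rowV0Pn[u /sub_kermxP uW u0]; by exists u.
have um : u 0 ord_max != 0.
  apply: contraNneq u0 => um.
  have a0 := indep (fun i => u 0 (inord i)).
  apply/eqP/rowP => i; rewrite [RHS]mxE.
  have [im|] := ltnP i m; last first.
    by move=> mi; rewrite -[RHS]um; congr (u _ _); apply/val_inj/eqP;
      rewrite /= eqn_leq mi andbT -ltnS.
  rewrite -[i]inord_val; apply: a0 => //.
  move: uW; rewrite WE big_ord_recr /= um scale0r addr0 => uW.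
  rewrite -[RHS]uW; apply: eq_bigr => j _; congr (u _ _ *: _).
  by apply/val_inj; rewrite /= inordK // ltnS ltnW.
pose c i := - u 0 (inord i) / u 0 ord_max.
have Vm : V m = \sum_(i < m) c i *: V i.
  move: uW; rewrite WE big_ord_recr /= => /eqP; rewrite addrC addr_eq0 => /eqP E.
  apply: (scalerI um); rewrite E -sumrN scaler_sumr; apply: eq_bigr => i _.
  rewrite scalerA /c mulrC divfK // scaleNr; congr (- (u _ _ *: _)).
  by apply/val_inj; rewrite /= inordK // ltnS ltnW.
have tauV r : V r = 0 -> v = 0 by elim: r => // r IH /tau_eq0.
have m0 : (0 < m)%N.
  rewrite lt0n; apply: contraNneq v0 => m0; apply/eqP/(tauV m).
  by rewrite Vm big1 // => -[i im]; exfalso; rewrite m0 in im.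
(* If this polynomial vanished, so would all c_i, hence V_m and, [tau] being injective, v itself. *)
have t0 : top_coef c m.-1 != 0.
  apply: contraNneq v0 => /top_coef_eq0 c0; apply/eqP/(tauV m); rewrite Vm.
  by rewrite big1 // => i _; rewrite c0 ?scale0r // -ltnS prednK.
(* The condition a_(m-1) = b reads b^q t(b) = b. Dividing by b discards the trivial solution b = 0
   and leaves the exponent [q.-1]. *)
have /closed_rootP[b] : size ('X^(q.-1) * top_coef c m.-1 - 1)%R != 1%N.
  have s2 : (1 < size (top_coef c m.-1 * 'X^(q.-1))%R)%N.
    rewrite size_mulXn //; have := size_poly_eq0 (top_coef c m.-1).
    rewrite (negPf t0); lia.
  by rewrite mulrC size_polyDl ?size_polyN ?size_poly1 // neq_ltn s2 orbT.
rewrite rootE !hornerE subr_eq0 => /eqP Eb.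
have b0 : b != 0.
  apply: contraNneq (oner_neq0 k) => b0; rewrite -Eb b0 expr0n.
  have -> : (q.-1 == 0)%N = false by lia.
  by rewrite mul0r.
pose a i := b ^+ q * (top_coef c i).[b].
have am : a m.-1 = b by rewrite /a -(prednK (ltnW q_gt1)) exprS -mulrA Eb mulr1.
have aS i : a i.+1 = a i ^+ q + c i.+1 * b ^+ q.
  rewrite /a /= !hornerE mulrDr [c _ * _]mulrC exprMn; congr (_ + _).
  by rewrite mulrA -exprD -exprM subnKC //; nia.
have a0 : a 0%N = c 0%N * b ^+ q by rewrite /a /= hornerE mulrC.
have tauE (x y : 'rV_n) : tau x = y -> map_mx sg x = y *m L.
  by move=> <-; rewrite mulmxKV.
exists (\sum_(i < m) a i *: V i).
  apply: contraNneq b0 => /indep a_eq0; rewrite -am a_eq0 //.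
  by rewrite prednK.
apply: tauE; rewrite tau_sum.
transitivity (\sum_(i < m) a i ^+ q *: V i.+1); first by [].
exact: shift_sum am aS a0 Vm.
Qed.

End FixedVector.

Lemma artin_schreier (c : k) : exists y, sg y = y + c.
Proof.
have /closed_rootP[y] : size ('X^q - 'X - c%:P)%R != 1%N.
  rewrite size_polyDl ?size_polyN ?size_polyDl ?size_polyN ?size_polyX ?size_polyXn //.
    by rewrite eqSS -lt0n ltnW.
  by rewrite (leq_ltn_trans (size_polyC_leq1 _)) // ltnW.
by rewrite rootE !hornerE subr_eq0 subr_eq => /eqP E; exists y; rewrite sgE E addrC.
Qed.

(** Gaussian elimination writes x as a scalar times the first row of the invertible matrix
    [row_ebase x]. *)
Lemma complete_unitmx n (x : 'rV[k]_(1 + n)) : x != 0 ->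
  exists2 h : 'M[k]_(1 + n), h \in unitmx & row 0 h = x.
Proof.
move=> x0; have rx : \rank x = 1%N by rewrite rank_rV x0.
have := mulmx_ebase x; rewrite rx [col_ebase x]mx11_scalar => xE.
have c0 : col_ebase x 0 0 != 0.
  have := col_ebase_unit x; rewrite [col_ebase x]mx11_scalar unitmxE det_scalar1.
  by rewrite unitfE mxE eqxx mulr1n.
exists (col_ebase x 0 0 *: row_ebase x).
  by rewrite unitmxZ ?unitfE // row_ebase_unit.
rewrite -[RHS]xE linearZ /= -mulmxA mul_scalar_mx; congr (_ *: _).
rewrite rowE; congr (_ *m _); apply/rowP => j; rewrite !mxE eqxx /= andbT.
by rewrite eq_sym.
Qed.

(** A solution x of x^(q) = x L is completed to an invertible h. Then h L (h^(q))^-1 is block lower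
    triangular with corner 1: its lower right block is treated by induction, and the column below
    the corner by Artin-Schreier equations. *)
Lemma lang_gl n (L : 'M[k]_n) : L \in unitmx ->
  exists2 g : 'M[k]_n, g \in unitmx & map_mx sg g = g *m L.
Proof.
elim: n L => [|n IH] L L_unit.
  by exists 1%:M; [rewrite unitmx1 | rewrite [RHS]flatmx0 [LHS]flatmx0].
have [x x0 xL] := semilinear_fixed_vector L_unit (ltn0Sn n).
have [h h_unit hx] := complete_unitmx x0.
have sh_unit : map_mx sg h \in unitmx by rewrite map_unitmx.
pose L' : 'M[k]_(1 + n) := h *m L *m invmx (map_mx sg h).
have L'_unit : L' \in unitmx by rewrite !unitmx_mul h_unit L_unit unitmx_inv.
have L'0 : usubmx L' = row_mx 1%:M 0.
  have : row 0 L' = delta_mx 0 0.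
    by rewrite /L' !row_mul hx -xL -hx map_row -row_mul mulmxV // row1.
  move: (L') => M M0; rewrite -[usubmx M]hsubmxK; congr row_mx.
    apply/rowP => j; rewrite !mxE; have /rowP/(_ 0) := M0; rewrite !mxE eqxx /= => E.
    by rewrite [j]ord1 eqxx -[RHS]E; congr (M _ _); apply: ord_inj.
  apply/rowP => j; rewrite !mxE; have /rowP/(_ (rshift 1 j)) := M0.
  rewrite !mxE /= => E; rewrite -[RHS]E.
  by congr (fun_of_matrix M _ _); apply: ord_inj.
have {L'0}L'E : L' = block_mx 1%:M 0 (dlsubmx L') (drsubmx L').
  by rewrite block_mxEv -L'0 hsubmxK vsubmxK.
have [g g_unit gE] : exists2 g, g \in unitmx & map_mx sg g = g *m drsubmx L'.
  by apply: IH; have := L'_unit; rewrite {1}L'E !unitmxE det_lblock det1 mul1r.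
have [y yE] : exists y : 'cV[k]_n, map_mx sg y = y + g *m dlsubmx L'.
  have [y yE] := choice (fun i => artin_schreier ((g *m dlsubmx L') i 0)).
  by exists (\col_i y i); apply/colP => i; rewrite [LHS]mxE mxE yE [RHS]mxE [X in _ = X + _]mxE.
pose g' : 'M[k]_(1 + n) := block_mx 1%:M 0 y g.
exists (g' *m h).
  rewrite unitmx_mul h_unit andbT /g' unitmxE.
  by have -> := det_lblock (1%:M : 'M_1) y g; rewrite det1 mul1r.
have g'E : map_mx sg g' = g' *m L'.
  rewrite L'E map_block_mx mulmx_block map_mx1 map_mx0 gE yE.
  by rewrite !(mul1mx, mul0mx, mulmx0, mulmx1, addr0, add0r).
have hL : h *m L = L' *m map_mx sg h by rewrite mulmxKV.
by rewrite -mulmxA hL mulmxA map_mxM g'E.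
Qed.

End Lang.

(** * Density of the fibers of the Lang map *)

Section PolynomialFunctions.
Local Open Scope ring_scope.
Variables (k : fieldType) (T : Type) (n : nat) (co : T -> 'I_n -> k).

(** The points range over an arbitrary type with coordinates [co], so that the notion serves both
    for the matrices X of a semilinear system and for the pairs g of the group. *)
Definition polyfun (f : T -> k) : Prop :=
  exists p : mpoly.mpoly n k, forall x, f x = mpoly.meval (co x) p.

Lemma polyfun_const c : polyfun (fun=> c).
Proof. by exists (mpoly.mpolyC _ c) => x; rewrite mpoly.mevalC. Qed.

Lemma polyfun_coord i : polyfun (fun x => co x i).
Proof. by exists (mpoly.mpolyX _ (mpoly.mnm1 i)) => x; rewrite mpoly.mevalXU. Qed.

Lemma polyfunD f g : polyfun f -> polyfun g -> polyfun (fun x => f x + g x).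
Proof.
by move=> [p pE] [r rE]; exists (p + r) => x; rewrite mpoly.mevalD -pE -rE.
Qed.

Lemma polyfunM f g : polyfun f -> polyfun g -> polyfun (fun x => f x * g x).
Proof.
by move=> [p pE] [r rE]; exists (p * r) => x; rewrite mpoly.mevalM -pE -rE.
Qed.

Lemma eq_polyfun f g : f =1 g -> polyfun f -> polyfun g.
Proof. by move=> fg [p pE]; exists p => x; rewrite -fg. Qed.

Lemma polyfun_sum (J : Type) (s : seq J) (P : pred J) (f : J -> T -> k) :
  (forall j, P j -> polyfun (f j)) -> polyfun (fun x => \sum_(j <- s | P j) f j x).
Proof.
move=> pf; elim: s => [|j s IH].
  by apply: eq_polyfun (polyfun_const 0) => x; rewrite big_nil.
have [Pj|Pj] := boolP (P j).
  by apply: eq_polyfun (polyfunD (pf j Pj) IH) => x; rewrite big_cons Pj.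
by apply: eq_polyfun IH => x; rewrite big_cons (negPf Pj).
Qed.

Lemma polyfun_prod (J : Type) (s : seq J) (P : pred J) (f : J -> T -> k) :
  (forall j, P j -> polyfun (f j)) -> polyfun (fun x => \prod_(j <- s | P j) f j x).
Proof.
move=> pf; elim: s => [|j s IH].
  by apply: eq_polyfun (polyfun_const 1) => x; rewrite big_nil.
have [Pj|Pj] := boolP (P j).
  by apply: eq_polyfun (polyfunM (pf j Pj) IH) => x; rewrite big_cons Pj.
by apply: eq_polyfun IH => x; rewrite big_cons (negPf Pj).
Qed.

Lemma polyfunX f m : polyfun f -> polyfun (fun x => f x ^+ m).
Proof.
move=> pf; elim: m => [|m IH]; first by apply: eq_polyfun (polyfun_const 1).
by apply: eq_polyfun (polyfunM pf IH) => x; rewrite exprS.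
Qed.

Definition polymx m1 m2 (f : T -> 'M[k]_(m1, m2)) : Prop :=
  forall i j, polyfun (fun x => f x i j).

Lemma polymx_const m1 m2 (c : 'M[k]_(m1, m2)) : polymx (fun=> c).
Proof. by move=> i j; apply: polyfun_const. Qed.

Lemma polymxM m1 m2 m3 (f : T -> 'M[k]_(m1, m2)) (g : T -> 'M_(m2, m3)) :
  polymx f -> polymx g -> polymx (fun x => f x *m g x).
Proof.
move=> pf pg i j; apply: eq_polyfun (fun x => esym (mxE _ _ _ _)) _.
by apply: polyfun_sum => l _; apply: polyfunM.
Qed.

Lemma polymx_tr m1 m2 (f : T -> 'M[k]_(m1, m2)) :
  polymx f -> polymx (fun x => (f x)^T).
Proof. by move=> pf i j; apply: eq_polyfun (pf j i) => x; rewrite mxE. Qed.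

Lemma polyfun_det m (f : T -> 'M[k]_m) : polymx f -> polyfun (fun x => \det (f x)).
Proof.
move=> pf; apply: polyfun_sum => s _; apply: polyfunM; first exact: polyfun_const.
by apply: polyfun_prod => i _.
Qed.

Lemma polymx_adj m (f : T -> 'M[k]_m) : polymx f -> polymx (fun x => \adj (f x)).
Proof.
move=> pf i j; apply: eq_polyfun (fun x => esym (mxE _ _ _ _)) _.
apply: polyfunM; first exact: polyfun_const.
by apply: polyfun_det => a b; apply: eq_polyfun (pf (lift j a) (lift i b)) => x; rewrite !mxE.
Qed.

Lemma polymx_map m1 m2 (f : T -> 'M[k]_(m1, m2)) q :
  polymx f -> polymx (fun x => map_mx (fun c => c ^+ q) (f x)).
Proof. by move=> pf i j; apply: eq_polyfun (polyfunX q (pf i j)) => x; rewrite mxE. Qed.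

(* Closure under the ring operations suffices for composition with a polynomial. *)
Lemma meval_closed (P : (T -> k) -> Prop) p :
    (forall f g, f =1 g -> P f -> P g) -> (forall c, P (fun=> c)) ->
    (forall f g, P f -> P g -> P (fun x => f x + g x)) ->
    (forall f g, P f -> P g -> P (fun x => f x * g x)) ->
    (forall i, P (fun x => co x i)) ->
  P (fun x => mpoly.meval (co x) p).
Proof.
move=> Pext Pc Pa Pm Pco; apply: (Pext _ _ (fun x => esym (mpoly.mevalE _ _))).
elim: (mpoly.msupp p) => [|m s IH].
  by apply: (Pext _ _ _ (Pc 0)) => x; rewrite big_nil.
apply: (Pext _ _ (fun x => esym (big_cons _ _ _ _ _ _))); apply: (Pa _ _ _ IH); apply: (Pm _ _) => //.
elim: (index_enum _) => [|i e IHe]; first by apply: (Pext _ _ _ (Pc 1)) => x; rewrite big_nil.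
apply: (Pext _ _ (fun x => esym (big_cons _ _ _ _ _ _))); apply: (Pm _ _ _ IHe).
elim: (m i) => [|r IHr]; first by apply: (Pext _ _ _ (Pc 1)).
by apply: (Pext _ _ _ (Pm _ _ (Pco i) IHr)) => x; rewrite exprS.
Qed.

End PolynomialFunctions.

Section Density.
Local Open Scope ring_scope.
Variables (k : closedFieldType) (sg : {rmorphism k -> k}) (q : nat).
Hypotheses (q_gt1 : (1 < q)%N) (sgE : forall x, sg x = x ^+ q).
Hypothesis q0 : q%:R = 0 :> k.

(** X^q - X is separable: as q = 0 in [k], its derivative is -1. *)
Lemma fixed_elements : exists2 z : 'I_q -> k, injective z & forall i, sg (z i) = z i.
Proof.
pose P : {poly k} := 'X^q - 'X.
have szP : size P = q.+1 by rewrite size_polyDl ?size_polyN ?size_polyX ?size_polyXn.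
have P0 : P != 0 by rewrite -size_poly_eq0 szP.
have [r rE] := closed_field_poly_normal P.
have lc : lead_coef P != 0 by rewrite lead_coef_eq0.
have Ur : uniq r.
  rewrite -separable_prod_XsubC -(eqp_separable (eqp_scale _ lc)) -rE.
  rewrite unlock /separable_poly derivB derivXn derivX -mulr_natr -polyC_natr q0.
  by rewrite polyC0 mulr0 add0r -scaleN1r coprimepZr ?oppr_eq0 ?oner_eq0 // coprimep1.
have sr : size r = q.
  have := szP; rewrite rE size_scale // size_prod_XsubC => -[].
  by [].
exists (fun i => nth 0 r i).
  move=> i j /eqP; rewrite nth_uniq ?sr // => /eqP; exact: val_inj.
move=> i; apply/eqP; rewrite sgE -subr_eq0.
have : root P (nth 0 r i) by rewrite rE rootZ // root_prod_XsubC mem_nth // sr.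
by rewrite rootE !hornerE.
Qed.

Section Reduction.
Variables (r n : nat).
Implicit Types (X : 'M[k]_(r, n)) (a : 'I_(r * n) -> nat).

Definition mxmon X a := \prod_i mxvec X 0 i ^+ a i.

Lemma mxmonD X a b : mxmon X (fun i => (a i + b i)%N) = mxmon X a * mxmon X b.
Proof. by rewrite -big_split; apply: eq_bigr => i _; rewrite exprD. Qed.

Lemma mxmon_at X i m : mxmon X (fun j => m * (j == i))%N = mxvec X 0 i ^+ m.
Proof.
rewrite /mxmon (bigD1 i) //= eqxx muln1 big1 ?mulr1 // => j /negPf ->.
by rewrite muln0.
Qed.

Lemma eq_mxmon X a b : a =1 b -> mxmon X a = mxmon X b.
Proof. by move=> ab; apply: eq_bigr => i _; rewrite ab. Qed.

(** The system X^(q) = X L_t with L_t = N(t) / delta(t). Denominators are cleared because L_t will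
    contain the inverse of a matrix depending on t. *)
Definition fiber (delta : {poly k}) (N : 'M[{poly k}]_n) (t : k) X : Prop :=
  delta.[t] *: map_mx sg X = X *m map_mx (horner_eval t) N.

Variables (delta : {poly k}) (N : 'M[{poly k}]_n).

Lemma fiber_coord (i : 'I_(r * n)) : exists (l : 'I_n -> 'I_(r * n)) (c : 'I_n -> {poly k}),
  forall t X, fiber delta N t X ->
    delta.[t] * mxvec X 0 i ^+ q = \sum_j (c j).[t] * mxvec X 0 (l j).
Proof.
case/mxvec_indexP: i => a b; exists (mxvec_index a), (fun j => N j b) => t X /matrixP/(_ a b).
rewrite !mxE sgE mxvecE => ->; apply: eq_bigr => j _.
by rewrite mxE mxvecE mulrC.
Qed.

Lemma reduce_small D a : [forall i, a i < q]%N ->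
  exists c : {ffun 'I_(r * n) -> 'I_q} -> {poly k}, forall t X, fiber delta N t X ->
    delta.[t] ^+ D * mxmon X a = \sum_b (c b).[t] * mxmon X (fun i => b i).
Proof.
move=> /forallP small; pose b0 := [ffun i => Ordinal (small i)].
exists (fun b => delta ^+ D * (b == b0)%:R) => t X _.
rewrite (bigD1 b0) //= eqxx big1 => [|b /negPf ->].
  rewrite addr0 mulr1 horner_exp; congr (_ * _).
  by apply: eq_mxmon => i; rewrite ffunE.
by rewrite mulr0 horner0 mul0r.
Qed.

(** Replacing a factor x_i^q by a linear form costs one factor delta and lowers the degree by q - 1
    > 0, so a bound for the degree also bounds the power of delta. *)
Lemma reduce_mon D a : (\sum_i a i <= D)%N ->
  exists c : {ffun 'I_(r * n) -> 'I_q} -> {poly k}, forall t X, fiber delta N t X ->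
    delta.[t] ^+ D * mxmon X a = \sum_b (c b).[t] * mxmon X (fun i => b i).
Proof.
elim: D a => [|D IH] a aD; have [/reduce_small//|] := boolP [forall i, a i < q]%N;
  rewrite negb_forall => /existsP[i]; rewrite -leqNgt => ai.
  by move: aD; rewrite leqn0 (bigD1 i) //= addn_eq0 => /andP[/eqP a0 _]; lia.
have [l [c cE]] := fiber_coord i.
pose a1 j := (a j - q * (j == i))%N.
have aE : a =1 (fun j => a1 j + q * (j == i))%N.
  by move=> j; rewrite /a1; case: eqP => [->|_]; rewrite ?muln1 ?muln0 ?subnK ?subn0 ?addn0.
have IHj j : exists cj : {ffun 'I_(r * n) -> 'I_q} -> {poly k}, forall t X, fiber delta N t X ->
    delta.[t] ^+ D * mxmon X (fun u => a1 u + 1 * (u == l j))%N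
    = \sum_b (cj b).[t] * mxmon X (fun i => b i).
  have sum1 m (u : 'I_(r * n)) : (\sum_v m * (v == u) = m)%N.
    rewrite (bigD1 u) //= eqxx muln1 big1 ?addn0 // => v /negPf ->; exact: muln0.
  have sumD m (u : 'I_(r * n)) : (\sum_v (a1 v + m * (v == u)) = \sum_v a1 v + m)%N.
    by rewrite -[X in (_ + X)%N](sum1 m u) -big_split.
  apply: IH; move: aD q_gt1; rewrite (eq_bigr _ (fun u _ => aE u)) !sumD; lia.
have [C CE] := choice IHj.
exists (fun b => \sum_j c j * C j b) => t X fX.
rewrite (eq_mxmon X aE) mxmonD mxmon_at exprSr mulrACA cE // mulr_sumr.
transitivity (\sum_j \sum_b ((c j).[t] * (C j b).[t]) * mxmon X (fun i => b i)).
  apply: eq_bigr => j _; rewrite (eq_bigr (fun b => (c j).[t] * ((C j b).[t] * mxmon X (fun i => b i)))).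
    rewrite -mulr_sumr -CE // mxmonD mxmon_at expr1.
    by rewrite mulrCA !mulrA.
  by move=> b _; rewrite mulrA.
rewrite exchange_big; apply: eq_bigr => b _ /=; rewrite horner_sum mulr_suml.
by apply: eq_bigr => j _; rewrite hornerM.
Qed.

Definition mxpolyfun (f : 'M[k]_(r, n) -> k) := polyfun (fun X i => mxvec X 0 i) f.

Lemma polymx_id : polymx (fun (X : 'M[k]_(r, n)) i => mxvec X 0 i) id.
Proof.
move=> i j; apply: eq_polyfun (polyfun_coord _ (mxvec_index i j)) => X.
exact: mxvecE.
Qed.

(* On a fiber each x^q is a linear form in the coordinates, with coefficients
   in t; so exponents can be brought below q. *)
Lemma reduce_polyfun f : mxpolyfun f ->
  exists D (c : {ffun 'I_(r * n) -> 'I_q} -> {poly k}), forall t X, fiber delta N t X ->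
    delta.[t] ^+ D * f X = \sum_b (c b).[t] * mxmon X (fun i => b i).
Proof.
move=> [p pE]; pose D := (\sum_(m <- mpoly.msupp p) \sum_i m i)%N; exists D.
have rm m : exists c : {ffun 'I_(r * n) -> 'I_q} -> {poly k}, m \in mpoly.msupp p ->
    forall t X, fiber delta N t X ->
    delta.[t] ^+ D * mxmon X (fun i => m i) = \sum_b (c b).[t] * mxmon X (fun i => b i).
  have [mp|] := boolP (m \in mpoly.msupp p); last by exists (fun=> 0).
  have [|c cE] := @reduce_mon D (fun i => m i); last by exists c.
  by rewrite /D (big_rem m) //= leq_addr.
have [C CE] := choice rm.
exists (fun b => \sum_(m <- mpoly.msupp p) (mpoly.mcoeff m p)%:P * C m b) => t X fX.
rewrite pE mpoly.mevalE mulr_sumr.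
transitivity (\sum_(m <- mpoly.msupp p) \sum_b (mpoly.mcoeff m p * (C m b).[t]) * mxmon X (fun i => b i)).
  rewrite big_seq [RHS]big_seq; apply: eq_bigr => m mp.
  rewrite mulrCA (CE m mp t X fX) mulr_sumr; apply: eq_bigr => b _; by rewrite mulrA.
rewrite exchange_big; apply: eq_bigr => b _ /=; rewrite horner_sum mulr_suml.
by apply: eq_bigr => m _; rewrite hornerM hornerC.
Qed.

End Reduction.

Section Fibers.
Variables (r n : nat).

Lemma fiber_const (L : 'M[k]_n) t (X : 'M[k]_(r, n)) :
  fiber 1 (map_mx polyC L) t X <-> map_mx sg X = X *m L.
Proof.
rewrite /fiber hornerC scale1r -map_mx_comp.
by rewrite (_ : map_mx _ L = L) //; apply/matrixP => i j; rewrite mxE /= /horner_eval hornerC.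
Qed.

(* By Lang's theorem the solutions of X^(q) = X L are the Y g with Y over F_q;
   interpolation at these q^(rn) points shows that the q^(rn) reduced monomials
   are linearly independent on them. *)
Lemma reduced_mon_independent (L : 'M[k]_n) (c : {ffun 'I_(r * n) -> 'I_q} -> k) :
    L \in unitmx ->
    (forall X : 'M[k]_(r, n), map_mx sg X = X *m L -> \sum_b c b * mxmon X (fun i => b i) = 0) ->
  forall b, c b = 0.
Proof.
move=> L_unit c0; pose T := {ffun 'I_(r * n) -> 'I_q}.
have [z z_inj zE] := fixed_elements.
have [g g_unit gL] := lang_gl q_gt1 sgE L_unit.
pose Y (y : T) : 'M[k]_(r, n) := vec_mx (\row_i z (y i)); pose Xp y := Y y *m g.
have XpE y : map_mx sg (Xp y) = Xp y *m L.
  rewrite /Xp map_mxM gL mulmxA; congr (_ *m _ *m _).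
  by apply/matrixP => i j; rewrite !mxE zE.
(* The Lagrange polynomial of the point [Xp y]: it vanishes at all the other points [Xp y'], but not
   at [Xp y]. *)
pose pi_ (y : T) (X : 'M[k]_(r, n)) := \prod_i \prod_(u | u != y i) (mxvec (X *m invmx g) 0 i - z u).
have pi_poly y : mxpolyfun (pi_ y).
  apply: polyfun_prod => i _; apply: polyfun_prod => u _.
  apply: polyfunD (polyfun_const _ _); case/mxvec_indexP: i => a b.
  have pm := polymxM (polymx_id (r := r) (n := n)) (polymx_const _ (invmx g)).
  by apply: eq_polyfun (pm a b) => X; rewrite mxvecE.
have red y : exists C : T -> k, forall X : 'M[k]_(r, n), map_mx sg X = X *m L ->
    pi_ y X = \sum_b C b * mxmon X (fun i => b i).
  have [D [C CE]] := reduce_polyfun 1 (map_mx polyC L) (pi_poly y).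
  exists (fun b => (C b).[0]) => X /(fiber_const L 0 X)/CE.
  by rewrite hornerC expr1n mul1r.
have [C CE] := choice red.
(* The values of the reduced monomials at the points. The matrix is square, since [T] indexes both
   exponents and points; expressing the Lagrange polynomials in reduced monomials gives [Dm *m E]
   diagonal and invertible, hence [E] invertible. *)
pose E : 'M[k]_#|{: T}| := \matrix_(b, y) mxmon (Xp (enum_val y)) (fun i => (enum_val b : T) i).
pose Dm : 'M[k]_#|{: T}| := \matrix_(y, b) C (enum_val y) (enum_val b).
have sumT (F : T -> k) : \sum_(i < #|{: T}|) F (enum_val i) = \sum_b F b.
  by rewrite -(big_enum_val F); apply: eq_bigl.
have DE : Dm *m E = diag_mx (\row_y pi_ (enum_val y) (Xp (enum_val y))).
  apply/matrixP => y y'; rewrite !mxE.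
  transitivity (pi_ (enum_val y) (Xp (enum_val y'))).
    rewrite CE // -sumT; apply: eq_bigr => b _; by rewrite !mxE.
  have [->|ne] := eqVneq y y'; first by rewrite mulr1n.
  rewrite mulr0n; have [i yi] : exists i, (enum_val y : T) i != (enum_val y' : T) i.
    apply/existsP; apply: contraNT ne; rewrite negb_exists => /forallP eq_y.
    apply/eqP/enum_val_inj/ffunP => i; apply/eqP; by have := eq_y i; rewrite negbK.
  rewrite /pi_ (bigD1 i) //= (bigD1 ((enum_val y' : T) i)) /=; last by rewrite eq_sym.
  by rewrite mulmxK // vec_mxK mxE subrr !mul0r.
have E_unit : E \in unitmx.
  suff : Dm *m E \in unitmx by rewrite unitmx_mul => /andP[].
  rewrite DE unitmxE det_diag unitfE prodf_seq_neq0; apply/allP => y _ /=; rewrite mxE.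
  rewrite /pi_ mulmxK // vec_mxK prodf_seq_neq0; apply/allP => i _ /=.
  rewrite prodf_seq_neq0; apply/allP => u _; apply/implyP => uy; rewrite mxE subr_eq0.
  by apply: contra uy => /eqP/z_inj ->.
pose cv : 'rV[k]_#|{: T}| := \row_b c (enum_val b).
have cE : cv *m E = 0.
  apply/rowP => y; rewrite !mxE -[RHS](c0 _ (XpE (enum_val y))) -sumT.
  by apply: eq_bigr => b _; rewrite !mxE.
have cv0 : cv = 0 by rewrite -[LHS](mulmxK E_unit) cE mul0mx.
move=> b; have := congr1 (fun M : 'rV_#|{: T}| => M 0 (enum_rank b)) cv0.
by rewrite !mxE enum_rankK.
Qed.

Lemma fiber_density (delta : {poly k}) (N : 'M[{poly k}]_n) (X0 : 'M[k]_(r, n)) f :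
    delta.[0] != 0 -> map_mx (horner_eval 0) N \in unitmx ->
    fiber delta N 0 X0 -> mxpolyfun f -> f X0 != 0 ->
  exists2 e : {poly k}, e != 0 & forall t, e.[t] != 0 ->
    exists2 X : 'M[k]_(r, n), fiber delta N t X & f X != 0.
Proof.
move=> d0 N0 fX0 /(reduce_polyfun delta N)[D [c cE]] f0.
have [b cb] : exists b, (c b).[0] != 0.
  apply: contrapT => nex; have := cE 0 X0 fX0; rewrite big1 => [/eqP|b _].
    by rewrite mulf_eq0 (negPf f0) expf_eq0 (negPf d0) andbF.
  by have [->|cb] := eqVneq (c b).[0] 0; [rewrite mul0r | case: nex; exists b].
(* Off the zeros of delta and det N the system is an invertible one; if f vanished on all its
   solutions, independence would force [c b] to vanish at t as well. *)
exists (c b * (delta * \det N)).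
  apply/eqP => /(congr1 (horner_eval 0)); rewrite !rmorphM rmorph0 /= /horner_eval.
  move/eqP; rewrite !mulf_eq0 (negPf cb) (negPf d0) /=.
  by apply/negP; move: N0; rewrite unitmxE unitfE det_map_mx.
move=> t; rewrite !hornerM !mulf_eq0 !negb_or => /and3P[cbt dt Nt].
apply: contrapT => nex.
have L_unit : delta.[t]^-1 *: map_mx (horner_eval t) N \in unitmx.
  rewrite unitmxZ ?unitfE ?invr_eq0 // unitmxE unitfE det_map_mx.
  exact: Nt.
move/negP: cbt; apply; apply/eqP.
apply: (reduced_mon_independent (c := fun b => (c b).[t]) L_unit) => X XL.
have fX : fiber delta N t X by rewrite /fiber XL -scalemxAr scalerA divff // scale1r.
rewrite -cE //; have [->|fX0'] := eqVneq (f X) 0; first by rewrite mulr0.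
by case: nex; exists X.
Qed.

End Fibers.
End Density.

(** * Refinement of a pair of flags relative to a Frobenius *)

Section Flags.
Local Open Scope ring_scope.
Variables (k : closedFieldType) (sg : {rmorphism k -> k}) (d : nat).

Local Notation Fr A := (map_mx sg A).

Lemma submx_rank m1 m2 (A : 'M[k]_(m1, d)) (B : 'M_(m2, d)) :
  (A <= B)%MS -> (\rank B <= \rank A)%N -> (B <= A)%MS.
Proof.
by move=> AB rBA; rewrite -(mxrank_leqif_sup AB).2 eqn_leq rBA mxrankS.
Qed.

Lemma rank_add_line m (A : 'M[k]_(m, d)) (v : 'rV_d) :
  ~~ (v <= A)%MS -> \rank (A + v)%MS = (\rank A).+1.
Proof.
move=> vA; have v0 : v != 0 by apply: contraNneq vA => ->; exact: sub0mx.
have := mxrank_sum_cap A v; rewrite rank_rV v0.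
suff -> : \rank (A :&: v)%MS = 0%N by rewrite addn0 addn1.
apply/eqP; rewrite -leqn0 -ltnS -[X in (_ < X)%N]/(true : nat) -v0 -(rank_rV v).
rewrite ltnNge; apply: contra vA => le_v.
apply: submx_trans (capmxSl A v).
exact: submx_rank (capmxSr A v) le_v.
Qed.

Lemma eqmx_map m1 m2 (A : 'M[k]_(m1, d)) (B : 'M_(m2, d)) :
  (A :=: B)%MS -> (Fr A :=: Fr B)%MS.
Proof. by move=> AB; apply/map_eqmx. Qed.

(* Between two consecutive members P <= A and C <= A' of the flags of type J
   (gap), a chain is a refinement whose positions, Cs i in As i and in Fr (As i),
   follow the patterns indexing the strata. *)
Record chain (x e : nat) (As Cs : nat -> 'M[k]_d) : Prop := Chain {
  chain_rank : forall i, (x <= i <= e)%N ->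
    \rank (As i) = i /\ \rank (Cs i) = i;
  chain_sub : forall i, (x <= i < e)%N ->
    [/\ As i <= As i.+1, Cs i <= Cs i.+1, Cs i <= As i.+1 & Cs i <= Fr (As i.+1)]%MS;
  chain_low : forall i, (x <= i < e)%N -> (Cs i <= As i)%MS -> (Cs i.+1 <= As i.+1)%MS;
  chain_high : forall i, (x <= i < e)%N ->
    (Cs i.+1 <= Fr (As i.+1))%MS -> (Cs i <= Fr (As i))%MS }.

(** The rank of A' is only bounded because in the last gap e = d and A' is the whole space, of rank
    d instead of e + 1. Dually, in the first gap x = 0 and [x.-1] gives P = 0. *)
Record gap (x e : nat) (P A C A' : 'M[k]_d) : Prop := Gap {
  gap_rank : [/\ \rank P = x.-1, \rank A = x, \rank C = e & (\rank A' <= e.+1)%N];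
  gap_P : [/\ P <= A, P <= C & P <= Fr A]%MS;
  gap_A' : [/\ A <= A', C <= A' & C <= Fr A']%MS }.

Lemma chainW x e x' e' As Cs :
  (x <= x')%N -> (e' <= e)%N -> chain x e As Cs -> chain x' e' As Cs.
Proof.
by move=> xx' ee' [cr cs cl ch]; split=> i xie; [apply: cr|apply: cs|apply: cl|apply: ch]; lia.
Qed.

Lemma chain_mono x e As Cs i j : chain x e As Cs -> (x <= i)%N -> (i <= j)%N -> (j <= e)%N ->
  (As i <= As j)%MS /\ (Cs i <= Cs j)%MS.
Proof.
move=> ch xi; elim: j => [|j IH]; first by rewrite leqn0 => /eqP -> _; rewrite !submx_refl.
rewrite leq_eqVlt => /predU1P[->|ij] je; first by rewrite !submx_refl.
have [|Aij Cij] := IH ij _; first exact: ltnW.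
have [|AS CS _ _] := chain_sub ch (i := j); first by rewrite je andbT (leq_trans xi).
by split; [exact: submx_trans AS | exact: submx_trans CS].
Qed.

Lemma chain_cons x e A X As Cs :
    chain x.+1 e As Cs -> \rank A = x -> \rank X = x ->
    (A <= As x.+1)%MS -> (X <= Cs x.+1)%MS -> (X <= As x.+1)%MS ->
    (X <= Fr (As x.+1))%MS -> ~~ (X <= A)%MS \/ (Cs x.+1 <= As x.+1)%MS ->
    (X <= Fr A)%MS \/ ~~ (Cs x.+1 <= Fr (As x.+1))%MS ->
  chain x e (fun i => if i == x then A else As i) (fun i => if i == x then X else Cs i).
Proof.
move=> [cr cs cl ch] rA rX A1 X1 XA XFA lo hi; split=> i.
- by case: eqP => [->//|ix] xie; apply: cr; lia.
- move=> xie; have -> : (i.+1 == x) = false by lia.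
  by case: eqP => [->//|ix]; apply: cs; lia.
- move=> xie; have -> : (i.+1 == x) = false by lia.
  case: eqP => [->|ix]; last by apply: cl; lia.
  by case: lo => // /negPf ->.
- move=> xie; have -> : (i.+1 == x) = false by lia.
  case: eqP => [->|ix]; last by apply: ch; lia.
  by case: hi => // /negPf ->.
Qed.

Lemma chain_rcons x e C As Cs :
    chain x e As Cs -> (x <= e)%N -> \rank C = e.+1 ->
    (As e <= C)%MS -> (Cs e <= C)%MS -> (Cs e <= Fr C)%MS -> ~~ (C <= Fr C)%MS ->
  chain x e.+1 (fun i => if i == e.+1 then C else As i) (fun i => if i == e.+1 then C else Cs i).
Proof.
move=> [cr cs cl ch] xe rC A1 C1 C2 hi; split=> i.
- by case: eqP => [->//|ix] xie; apply: cr; lia.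
- move=> xie; have -> : (i == e.+1) = false by lia.
  rewrite eqSS; case: eqP => [->//|ix]; apply: cs; lia.
- move=> xie; have -> : (i == e.+1) = false by lia.
  rewrite eqSS; case: eqP => [->//|ix]; apply: cl; lia.
- move=> xie; have -> : (i == e.+1) = false by lia.
  rewrite eqSS; case: eqP => [->|ix]; first by rewrite (negPf hi).
  apply: ch; lia.
Qed.

Lemma eqmx_rank_sub m1 m2 (A : 'M[k]_(m1, d)) (B : 'M_(m2, d)) :
  (A <= B)%MS -> \rank A = \rank B -> (A :=: B)%MS.
Proof.
by move=> AB rAB; apply/eqmxP; rewrite AB (submx_rank AB) // rAB.
Qed.

Lemma rank_cap_hyperplanes (A B A' : 'M[k]_d) (r : nat) :
  \rank A = r -> \rank B = r -> (A <= A')%MS -> (B <= A')%MS -> (\rank A' <= r.+1)%N ->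
  ~~ (A <= B)%MS -> \rank (A :&: B) = r.-1 /\ \rank (A + B)%MS = r.+1.
Proof.
move=> rA rB AA' BA' rA' AB; have := mxrank_sum_cap A B; rewrite rA rB.
have le1 : (\rank (A + B) <= \rank A')%N by rewrite mxrankS // addsmx_sub AA'.
have lt2 : (\rank (A :&: B) < r)%N.
  rewrite ltnNge; apply: contra AB => le; apply: submx_trans (capmxSr A B).
  by apply: submx_rank (capmxSl _ _) _; rewrite rA.
move: le1 lt2; set s := \rank (A + B); set c := \rank (A :&: B); lia.
Qed.

Lemma rank_sum_lines (A B P : 'M[k]_d) (r : nat) :
  \rank A = r -> \rank B = r -> (P <= A)%MS -> (P <= B)%MS -> \rank P = r.-1 ->
  ~~ (A <= B)%MS -> \rank (A :&: B) = r.-1 /\ \rank (A + B)%MS = r.+1.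
Proof.
move=> rA rB PA PB rP AB; have := mxrank_sum_cap A B; rewrite rA rB.
have le1 : (\rank P <= \rank (A :&: B))%N by rewrite mxrankS // sub_capmx PA.
have lt2 : (\rank (A :&: B) < r)%N.
  rewrite ltnNge; apply: contra AB => le; apply: submx_trans (capmxSr A B).
  by apply: submx_rank (capmxSl _ _) _; rewrite rA.
move: le1 lt2; rewrite rP; set s := \rank (A + B); set c := \rank (A :&: B); lia.
Qed.

Lemma chain_low_le x e As Cs i j : chain x e As Cs -> (x <= i)%N -> (i <= j)%N -> (j <= e)%N ->
  (Cs i <= As i)%MS -> (Cs j <= As j)%MS.
Proof.
move=> ch xi; elim: j => [|j IH]; first by rewrite leqn0 => /eqP ->.
rewrite leq_eqVlt => /predU1P[->//|ij] je iP; apply: (chain_low ch); first by lia.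
by apply: IH => //; lia.
Qed.

Lemma chain_high_le x e As Cs i j : chain x e As Cs -> (x <= i)%N -> (i <= j)%N -> (j <= e)%N ->
  (Cs j <= Fr (As j))%MS -> (Cs i <= Fr (As i))%MS.
Proof.
move=> ch xi; elim: j => [|j IH]; first by rewrite leqn0 => /eqP ->.
rewrite leq_eqVlt => /predU1P[->//|ij] je iP; apply: IH => //; first by lia.
by apply: (chain_high ch) => //; lia.
Qed.

(* As long as C_i is not contained in T_i one has T_(i+1) = T_i + C_i. *)
Lemma chain_swallow x e (T Cs : nat -> 'M[k]_d) (C : 'M[k]_d) :
    (forall i, (x <= i <= e)%N -> \rank (T i) = i) ->
    (forall i, (x <= i < e)%N ->
      [/\ T i <= T i.+1, Cs i <= T i.+1, Cs i <= C & ~~ (Cs i <= T i)]%MS) ->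
    (T x <= C)%MS -> (x <= e)%N -> (T e <= C)%MS.
Proof.
move=> rT sT TC xe; rewrite -(subnKC xe); have := leqnn (e - x)%N.
elim: {-2}(e - x)%N => [|m IH] me; first by rewrite addn0.
have [Ti CiT CiC nCi] := sT (x + m)%N ltac:(lia).
rewrite addnS; have TT : (T (x + m).+1 <= T (x + m)%N + Cs (x + m)%N)%MS.
  apply: submx_rank; first by rewrite addsmx_sub Ti.
  rewrite rT; last by lia.
  rewrite ltnNge; apply: contra nCi => le; apply: submx_trans (addsmxSr (T (x + m)%N) _) _.
  apply: submx_rank (addsmxSl _ _) _; rewrite [X in (_ <= X)%N]rT //; lia.
by apply: submx_trans TT _; rewrite addsmx_sub CiC andbT; apply: IH; lia.
Qed.

(** The last low condition depends on the ends As x and Cs e only. If it fails, [chain_low] makes it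
    fail at every index, so A_(i+1) = A_i + C_i throughout; were As x inside Cs e, then As e would
    be too, and the ranks would give equality. *)
Lemma chain_last x e As Cs : chain x e As Cs -> (x <= e)%N ->
  (Cs e <= As e)%MS = (As x <= Cs e)%MS.
Proof.
move=> ch xe; have [rA rC] : \rank (As e) = e /\ \rank (Cs e) = e.
  by apply: (chain_rank ch); rewrite xe leqnn.
apply/idP/idP => [Pe|AxC].
  apply: submx_trans (chain_mono ch (leqnn x) xe (leqnn e)).1 _.
  by apply: submx_rank Pe _; rewrite rA rC.
apply: contraT => nPe; rewrite -(negPf nPe).
suff sAC : (As e <= Cs e)%MS by apply: submx_rank sAC _; rewrite rA rC.
apply: (chain_swallow (x := x) (Cs := Cs)) => // [i xi|i xi].
  by have [] := chain_rank ch xi.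
have [AA _ CA _] := chain_sub ch xi; split=> //.
  by have [] := chain_mono ch (i := i) (j := e) ltac:(lia) ltac:(lia) ltac:(lia).
by apply: contra nPe; apply: (chain_low_le ch); lia.
Qed.

(** The counterpart of [chain_last] for Fr: by [chain_high] a failure at the first index propagates
    up to the last one, and the spaces Fr (As i) grow by the Cs i. *)
Lemma chain_first x e As Cs : chain x e As Cs -> (x <= e)%N ->
  (Cs x <= Fr (As x))%MS = (Fr (As x) <= Cs e)%MS.
Proof.
move=> ch xe; have [rA rC] : \rank (As e) = e /\ \rank (Cs e) = e.
  by apply: (chain_rank ch); rewrite xe leqnn.
have [rAx rCx] : \rank (As x) = x /\ \rank (Cs x) = x.
  by apply: (chain_rank ch); rewrite xe leqnn.
apply/idP/idP => [Qx|AxC].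
  apply: submx_trans _ (chain_mono ch (leqnn x) xe (leqnn e)).2.
  by apply: submx_rank Qx _; rewrite mxrank_map rAx rCx.
apply: contraT => nQx.
suff: (Cs e <= Fr (As e))%MS by move/(chain_high_le ch (leqnn x) xe (leqnn e)); rewrite (negPf nQx).
suff sAC : (Fr (As e) <= Cs e)%MS by apply: submx_rank sAC _; rewrite mxrank_map rA rC.
apply: (chain_swallow (x := x) (Cs := Cs) (T := fun i => Fr (As i))) => // [i xi|i xi].
  by rewrite mxrank_map; have [] := chain_rank ch xi.
have [AA _ _ CA] := chain_sub ch xi; split=> //; first by rewrite map_submx.
  by have [] := chain_mono ch (i := i) (j := e) ltac:(lia) ltac:(lia) ltac:(lia).
by apply: contra nQx; apply: (chain_high_le ch); lia.
Qed.

Lemma chain_next x e As Cs : chain x e As Cs -> (x < e)%N ->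
  ~~ (Cs x <= As x)%MS -> (Cs x <= Fr (As x))%MS -> (As x.+1 :=: As x + Fr (As x))%MS.
Proof.
move=> ch xe nP Q.
have [rAx rCx] := chain_rank ch (i := x) ltac:(lia).
have [rA _] := chain_rank ch (i := x.+1) ltac:(lia).
have [AA _ CA _] := chain_sub ch (i := x) ltac:(lia).
have FC : (Fr (As x) <= Cs x)%MS by apply: submx_rank Q _; rewrite mxrank_map rAx rCx.
have nFA : ~~ (Fr (As x) <= As x)%MS by apply: contra nP; apply: submx_trans.
apply: eqmx_sym; apply: eqmx_rank_sub; first by rewrite addsmx_sub AA (submx_trans FC).
have sub : (As x + Fr (As x) <= As x.+1)%MS by rewrite addsmx_sub AA (submx_trans FC).
apply/eqP; rewrite eqn_leq mxrankS //= rA ltnNge; apply: contra nFA => le.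
apply: submx_trans (addsmxSr (As x) _) _.
by apply: submx_rank (addsmxSl _ _) _; rewrite rAx.
Qed.

Lemma chain_prev x e As Cs : chain x e.+1 As Cs -> (x <= e)%N ->
  (Cs e.+1 <= As e.+1)%MS -> ~~ (Cs e.+1 <= Fr (As e.+1))%MS ->
  (Cs e :=: Cs e.+1 :&: Fr (Cs e.+1))%MS.
Proof.
move=> ch xe P nQ.
have [_ rC] := chain_rank ch (i := e) ltac:(lia).
have [rA1 rC1] := chain_rank ch (i := e.+1) ltac:(lia).
have [_ CC _ CF] := chain_sub ch (i := e) ltac:(lia).
have sAC : (As e.+1 <= Cs e.+1)%MS by apply: submx_rank P _; rewrite rA1 rC1.
have sub : (Cs e <= Cs e.+1 :&: Fr (Cs e.+1))%MS.
  by rewrite sub_capmx CC (submx_trans CF) // map_submx.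
apply: eqmx_rank_sub => //; apply/eqP; rewrite eqn_leq mxrankS //= rC -ltnS -[X in (_ < X)%N]rC1.
rewrite ltnNge; apply: contra nQ => le.
have := submx_rank (capmxSl _ _) le; rewrite sub_capmx submx_refl /= => /submx_trans -> //.
by rewrite map_submx.
Qed.

(** The ends decide the last low and the first high condition. Either these conditions settle all
    the others, or a neighbour of an end is forced, A_(x+1) = A_x + Fr A_x or C_e = C_(e+1) ∩ Fr
    C_(e+1), and the induction applies to the shorter chain. *)
Lemma chain_unique x m As Cs As' Cs' :
    chain x (x + m) As Cs -> chain x (x + m) As' Cs' ->
    (As x :=: As' x)%MS -> (Cs (x + m)%N :=: Cs' (x + m)%N)%MS ->
  forall i, (x <= i <= x + m)%N -> (Cs i <= As i)%MS = (Cs' i <= As' i)%MS /\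
    (Cs i <= Fr (As i))%MS = (Cs' i <= Fr (As' i))%MS.
Proof.
elim: m x => [|m IH] x ch ch' eA eC.
  move=> i xi; have -> : i = x by lia.
  have eF := eqmx_map eA; rewrite addn0 in eC.
  by split; rewrite eC ?eA ?eF.
have xe : (x <= x + m.+1)%N by lia.
have eP : (Cs (x + m.+1)%N <= As (x + m.+1)%N)%MS = (Cs' (x + m.+1)%N <= As' (x + m.+1)%N)%MS.
  by rewrite (chain_last ch) // (chain_last ch') // eA eC.
have eQ : (Cs x <= Fr (As x))%MS = (Cs' x <= Fr (As' x))%MS.
  by rewrite (chain_first ch) // (chain_first ch') // eC (eqmx_map eA).
have step : ~~ (Cs x <= As x)%MS -> ~~ (Cs' x <= As' x)%MS -> (Cs x <= Fr (As x))%MS ->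
    forall i, (x <= i <= x + m.+1)%N -> (Cs i <= As i)%MS = (Cs' i <= As' i)%MS /\
    (Cs i <= Fr (As i))%MS = (Cs' i <= Fr (As' i))%MS.
  move=> nP nP' Q i /andP[]; rewrite leq_eqVlt => /predU1P[<- _|xi ie].
    by rewrite (negPf nP) (negPf nP') eQ.
  have Q' := Q; rewrite eQ in Q'.
  have eA1 : (As x.+1 :=: As' x.+1)%MS.
    apply: eqmx_trans (chain_next ch _ nP Q) _; first by lia.
    apply: eqmx_trans (adds_eqmx eA (eqmx_map eA)) _.
    by apply: eqmx_sym; apply: (chain_next ch'); lia.
  move: ch ch' eC ie; rewrite addnS -addSn => ch ch' eC ie.
  apply: (IH _ (chainW (leqnSn x) (leqnn _) ch) (chainW (leqnSn x) (leqnn _) ch') eA1 eC).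
  by rewrite xi ie.
have [P|nP] := boolP (Cs (x + m.+1)%N <= As (x + m.+1)%N)%MS; last first.
  have nP' := nP; rewrite eP in nP'.
  have low i : (x <= i <= x + m.+1)%N -> ~~ (Cs i <= As i)%MS /\ ~~ (Cs' i <= As' i)%MS.
    move=> xi; split; [apply: contra nP; apply: (chain_low_le ch)
                     | apply: contra nP'; apply: (chain_low_le ch')]; lia.
  have [Q|nQ] := boolP (Cs x <= Fr (As x))%MS.
    by have [] := low x; [lia | move=> *; apply: step].
  move=> i xi; have [/negPf -> /negPf ->] := low i xi; split=> //.
  have nQ' := nQ; rewrite eQ in nQ'.
  transitivity false; [|symmetry]; apply/negbTE.
    by apply: contra nQ; apply: (chain_high_le ch); lia.
  by apply: contra nQ'; apply: (chain_high_le ch'); lia.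
have P' := P; rewrite eP in P'.
have eCA (B D : nat -> 'M[k]_d) : chain x (x + m.+1) B D ->
    (D (x + m.+1)%N <= B (x + m.+1)%N)%MS ->
    (D (x + m.+1)%N <= Fr (B (x + m.+1)%N))%MS = (D (x + m.+1)%N <= Fr (D (x + m.+1)%N))%MS.
  move=> chB PB; have [rB rD] := chain_rank chB (i := (x + m.+1)%N) ltac:(lia).
  have eB : (D (x + m.+1)%N :=: B (x + m.+1)%N)%MS by apply: eqmx_rank_sub => //; rewrite rB rD.
  by rewrite (eqmx_map eB).
have eQe : (Cs (x + m.+1)%N <= Fr (As (x + m.+1)%N))%MS
         = (Cs' (x + m.+1)%N <= Fr (As' (x + m.+1)%N))%MS.
  by rewrite !eCA // eC (eqmx_map eC).
have [Qe|nQe] := boolP (Cs (x + m.+1)%N <= Fr (As (x + m.+1)%N))%MS; last first.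
  have nQe' := nQe; rewrite eQe in nQe'.
  move=> i /andP[xi]; rewrite leq_eqVlt => /predU1P[->|ie]; first by rewrite eP eQe.
  move: ch ch' eC ie P P' nQe nQe'; rewrite addnS => ch ch' eC ie P P' nQe nQe'.
  have sub := leqnSn (x + m).
  apply: (IH _ (chainW (leqnn x) sub ch) (chainW (leqnn x) sub ch') eA); last by rewrite xi.
  apply: eqmx_trans (chain_prev ch (leq_addr _ _) P nQe) _.
  apply: eqmx_trans (cap_eqmx eC (eqmx_map eC)) _.
  by apply: eqmx_sym; apply: (chain_prev ch' (leq_addr _ _)).
have Qe' := Qe; rewrite eQe in Qe'.
have high i : (x <= i <= x + m.+1)%N -> (Cs i <= Fr (As i))%MS /\ (Cs' i <= Fr (As' i))%MS.
  move=> /andP[xi ie]; split; first exact: (chain_high_le ch xi ie (leqnn _) Qe).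
  exact: (chain_high_le ch' xi ie (leqnn _) Qe').
have [Q Q'] := high x ltac:(lia).
have eCF (B D : nat -> 'M[k]_d) : chain x (x + m.+1) B D -> (D x <= Fr (B x))%MS ->
    (D x <= B x)%MS = (Fr (B x) <= B x)%MS.
  move=> chB QB; have [rB rD] := chain_rank chB (i := x) (introT andP (conj (leqnn x) xe)).
  by have -> := eqmx_rank_sub QB; rewrite // mxrank_map rB rD.
have ePx : (Cs x <= As x)%MS = (Cs' x <= As' x)%MS.
  by rewrite (eCF _ _ ch) // (eCF _ _ ch') // (eqmx_map eA) eA.
have [Px|nPx] := boolP (Cs x <= As x)%MS; last by apply: step; rewrite -?ePx.
have Px' := Px; rewrite ePx in Px'.
move=> i xi; have [-> ->] := high i xi; split=> //.
have /andP[x_i i_e] := xi; transitivity true; [|symmetry].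
  exact: (chain_low_le ch (leqnn x) x_i i_e Px).
exact: (chain_low_le ch' (leqnn x) x_i i_e Px').
Qed.

Variable q : nat.
Hypotheses (q_gt1 : (1 < q)%N) (sgE : forall x, sg x = x ^+ q).

Lemma power_map_surj y : exists x, sg x = y.
Proof.
have /closed_rootP[x] : size ('X^q - y%:P)%R != 1%N.
  by rewrite size_XnsubC 1?ltnW // eqSS -lt0n ltnW.
by rewrite rootE !hornerE subr_eq0 => /eqP <-; exists x.
Qed.

Lemma map_power_surj m n (A : 'M[k]_(m, n)) : exists A', Fr A' = A.
Proof.
have [f fE] := choice (fun ij : 'I_m * 'I_n => power_map_surj (A ij.1 ij.2)).
by exists (\matrix_(i, j) f (i, j)); apply/matrixP => i j; rewrite !mxE fE.
Qed.

(* Modulo R the map v |-> v^sg induces a semilinear automorphism of C / P, and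
   such a map has a fixed line. *)
Lemma fixed_line (P C R : 'M[k]_d) :
    (P <= C)%MS -> (P <= R)%MS -> (Fr C <= R + C)%MS ->
    (forall v : 'rV_d, (v <= C)%MS -> (Fr v <= R)%MS -> (v <= P)%MS) ->
    ~~ (C <= P)%MS ->
  exists v : 'rV_d, [/\ (v <= C)%MS, ~~ (v <= P)%MS & (Fr v - v <= R)%MS].
Proof.
move=> PC PR FC inj CP; pose U := row_base (C :\: P)%MS.
have UC : (U <= C)%MS by rewrite eq_row_base diffmxSl.
have UP (v : 'rV_d) : (v <= U)%MS -> (v <= P)%MS -> v = 0.
  move=> vU vP; apply/eqP; rewrite -submx0 -(capmx_diff C P) sub_capmx vP andbT.
  by rewrite -(eq_row_base (C :\: P)%MS).
have CPU : (C <= P + U)%MS.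
  rewrite -(addsmx_diff_cap_eq C P) addsmx_sub; apply/andP; split.
    by apply: submx_trans (addsmxSr P U); rewrite eq_row_base.
  by apply: submx_trans (addsmxSl P U); exact: capmxSr.
have : (Fr U <= R + U)%MS.
  apply: (@submx_trans _ _ _ _ _ _ (Fr C)); first by rewrite map_submx.
  apply: submx_trans FC _.
  rewrite addsmx_sub addsmxSl; apply: submx_trans CPU _.
  by rewrite addsmxS.
move/sub_addsmxP => [[N M] /= FU].
(* [M] is the matrix of the induced semilinear map in the basis [U] of a complement of P in C. A
   vector of its left kernel is the image under sg of some w', as every element of [k] is a q-th
   power, and [inj] puts w' U in P. *)
have M_unit : M \in unitmx.
  rewrite -row_free_unit; apply/inj_row_free => w wM.
  have [w' w'E] := map_power_surj w.
  suff w'0 : w' = 0 by rewrite -w'E w'0 map_mx0.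
  apply/eqP; rewrite -(mulmx_free_eq0 _ (row_base_free (C :\: P)%MS)) -/U; apply/eqP.
  apply: UP; first exact: submxMl.
  apply: inj; first by apply: submx_trans UC; exact: submxMl.
  rewrite map_mxM FU w'E mulmxDr. 
  by rewrite (mulmxA w M) wM mul0mx addr0 mulmxA submxMl.
have r_gt0 : (0 < \rank (C :\: P))%N.
  rewrite lt0n mxrank_eq0; apply: contra CP => /eqP CP0.
  apply: submx_trans CPU _; rewrite addsmx_sub submx_refl.
  by rewrite eq_row_base CP0 sub0mx.
have iM_unit : invmx M \in unitmx by rewrite unitmx_inv.
(* The inverse of [M] appears because Fr (x U) is Fr x *m M *m U modulo R, which has to be x U. *)
have [x x0 xE] := semilinear_fixed_vector q_gt1 sgE iM_unit r_gt0.
exists (x *m U); split; first by apply: submx_trans UC; exact: submxMl.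
  apply: contra x0 => /(UP _ (submxMl _ _)) /eqP.
  by rewrite mulmx_free_eq0 // row_base_free.
by rewrite map_mxM FU xE mulmxDr (mulmxA _ M) mulmxKV // addrK mulmxA submxMl.
Qed.

(** A line of C / A fixed by the induced map spans, together with A, an Fr-stable space one
    dimension larger. *)
Lemma stable_chain x m (A C : 'M[k]_d) :
    \rank A = x -> \rank C = (x + m)%N -> (A <= C)%MS -> (Fr A <= A)%MS -> (Fr C <= C)%MS ->
  exists S : nat -> 'M[k]_d, [/\ (S x :=: A)%MS, (S (x + m)%N :=: C)%MS,
    forall i, (x <= i <= x + m)%N -> \rank (S i) = i /\ (Fr (S i) <= S i)%MS &
    forall i, (x <= i < x + m)%N -> (S i <= S i.+1)%MS].
Proof.
elim: m x A => [|m IH] x A rA rC sAC FA FC.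
  rewrite addn0 in rC *; exists (fun=> C); split=> // [|i xix].
    by apply: eqmx_sym; apply: eqmx_rank_sub => //; rewrite rA.
  by rewrite rC; split=> //; lia.
have [||v vF||v [vC vA vF]] := @fixed_line A C A sAC _ _ _ _.
- exact: submx_refl.
- by apply: submx_trans FC _; exact: addsmxSr.
- move=> FvA; rewrite -(map_submx sg); apply: submx_trans FvA _.
  by apply: submx_rank FA _; rewrite mxrank_map.
- by apply/negP => /mxrankS; rewrite rA rC; lia.
have rX : \rank (A + v)%MS = x.+1 by rewrite rank_add_line // rA.
have XC : (A + v <= C)%MS by rewrite addsmx_sub sAC.
have FX : (Fr (A + v)%MS <= A + v)%MS.
  rewrite map_addsmx addsmx_sub (submx_trans FA) ?addsmxSl //=.
  rewrite -[Fr v](subrK v); exact: addmx_sub_adds vF (submx_refl v).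
have [|S [Sx Se Sr Sm]] := IH x.+1 _ rX _ XC FX FC; first by rewrite rC addnS addSn.
exists (fun i => if i == x then A else S i); split; rewrite ?eqxx //.
- by rewrite (_ : (_ == x) = false) ?addnS -?addSn //; lia.
- move=> i xi; case: eqP => [->//|ix]; apply: Sr; lia.
- move=> i xi; rewrite (_ : (i.+1 == x) = false); last by lia.
  case: eqP => [->|ix]; last by apply: Sm; lia.
  by rewrite Sx addsmxSl.
Qed.

Lemma gap_stable x m P A C A' : gap x (x + m) P A C A' ->
  (A <= C)%MS -> (Fr A <= A)%MS -> (Fr C <= C)%MS ->
  exists As Cs, [/\ chain x (x + m) As Cs, (As x :=: A)%MS, (Cs (x + m)%N :=: C)%MS,
    (P <= Cs x)%MS & (As (x + m)%N <= A')%MS].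
Proof.
move=> [[rP rA rC rA'] [PA PC PFA] [AA' CA' CFA']] sAC FA FC.
have [S [Sx Se Sr Sm]] := stable_chain rA rC sAC FA FC.
have SF i : (x <= i <= x + m)%N -> (S i <= Fr (S i))%MS.
  move=> xi; have [ri Fi] := Sr i xi; apply: submx_rank Fi _.
  by rewrite mxrank_map.
exists S, S; split=> //; rewrite ?Sx ?Se //; split=> i xi //.
- by have [|->] := Sr i.
- have Si := Sm _ xi; split=> //.
  apply: submx_trans (SF i _) _; first by case/andP: xi => -> /ltnW ->.
  by rewrite map_submx.
- by move=> _; apply: SF; case/andP: xi => -> /ltnW ->.
Qed.

(* Induction on m: A is enlarged by Fr A or by a suitable line of C, or C is
   replaced by C :&: Fr C; if none applies, the gap is Fr-stable. *)
Lemma gap_refine x m P A C A' : gap x (x + m) P A C A' ->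
  exists As Cs, [/\ chain x (x + m) As Cs, (As x :=: A)%MS, (Cs (x + m)%N :=: C)%MS,
    (P <= Cs x)%MS & (As (x + m)%N <= A')%MS].
Proof.
elim: m x P A C A' => [|m IH] x P A C A' gapA;
  have [[rP rA rC rA'] [PA PC PFA] [AA' CA' CFA']] := gapA.
  rewrite addn0 in rC *; exists (fun=> A), (fun=> C); split=> //.
  by split=> i; [move=> xix; rewrite rA rC; split; lia | lia | lia | lia].
have rFA : \rank (Fr A) = x by rewrite mxrank_map.
have rFC : \rank (Fr C) = (x + m.+1)%N by rewrite mxrank_map.
have rFA' : \rank (Fr A') = \rank A' by rewrite mxrank_map.
(* Peeling from the top: C becomes the last term of both chains and the upper bound A' of the
   shorter gap, whose new C is C ∩ Fr C. The high condition at the last step is vacuous, C not being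
   inside Fr C. *)
have [/andP[sAC FCC]|] := boolP ((A <= C)%MS && ~~ (Fr C <= C)%MS).
  have FCC' : ~~ (C <= Fr C)%MS.
    by apply: contra FCC => /submx_rank -> //; rewrite rC rFC.
  have FCA' : (Fr C <= Fr A')%MS by rewrite map_submx.
  have [|rC1 _] := rank_cap_hyperplanes rC rFC CFA' FCA' _ FCC'; first by rewrite rFA'.
  rewrite addnS /= in rC1.
  have [|As [Cs [ch Ax Ce Px Ae]]] := IH x P A (C :&: Fr C)%MS C.
    split; rewrite ?capmxSl ?capmxSr //; first by rewrite rC addnS; split.
    rewrite sub_capmx PA PC PFA; split=> //.
    by apply: submx_trans PFA _; rewrite map_submx.
  exists (fun i => if i == (x + m).+1 then C else As i).
  exists (fun i => if i == (x + m).+1 then C else Cs i).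
  have ne : (x == (x + m).+1) = false by rewrite ltn_eqF // ltnS leq_addr.
  rewrite addnS eqxx ne; split; [ | exact: Ax | by [] | exact: Px | exact: CA'].
  apply: chain_rcons ch (leq_addr _ _) _ Ae _ _ FCC'; first by rewrite rC addnS.
    by rewrite Ce capmxSl.
  by rewrite Ce capmxSr.
rewrite negb_and negbK => nIIa.
(* Peeling from the bottom: Fr A is taken as C_x, so the high condition holds at x and the low one
   is vacuous there. The shorter gap starts with A + Fr A and has Fr A as its P. *)
have [/andP[FAC FAA]|] := boolP ((Fr A <= C)%MS && ~~ (Fr A <= A)%MS).
  have x0 : (0 < x)%N.
    rewrite lt0n; apply: contra FAA => /eqP x0; move: rFA; rewrite x0 => /eqP.
    by rewrite mxrank_eq0 => /eqP ->; exact: sub0mx.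
  have [_ rA1] := rank_sum_lines rFA rA PFA PA rP FAA.
  have A1A' : (A + Fr A <= A')%MS by rewrite addsmx_sub AA' (submx_trans FAC).
  have [|As [Cs [ch Ax Ce Px Ae]]] := IH x.+1 (Fr A) (A + Fr A)%MS C A'.
    split; last by split.
      by split; [exact: rFA | rewrite addsmxC | rewrite rC addSn addnS | rewrite addSn -addnS].
    by split; [exact: addsmxSr | exact: FAC | rewrite map_submx addsmxSl].
  rewrite addnS -addSn.
  exists (fun i => if i == x then A else As i), (fun i => if i == x then Fr A else Cs i).
  rewrite eqxx [(x.+1 + m)%N == x]gtn_eqF; last exact: leq_addr.
  split; [ | by [] | exact: Ce | exact: PFA | exact: Ae].
  apply: (chain_cons ch rA rFA _ Px).
  - by rewrite Ax addsmxSl.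
  - by rewrite Ax addsmxSr.
  - by rewrite (eqmx_map Ax) map_submx addsmxSl.
  - by left.
  - by left; rewrite submx_refl.
rewrite negb_and negbK => nlow.
have [FAC|FAC] := boolP (Fr A <= C)%MS; last first.
  have sAC : ~~ (A <= C)%MS.
    apply: contra FAC => sAC; move: nIIa; rewrite sAC /= => FCC.
    by apply: submx_trans FCC; rewrite map_submx.
  have x0 : (0 < x)%N.
    rewrite lt0n; apply: contra sAC => /eqP x0; move: rA; rewrite x0 => /eqP.
    by rewrite mxrank_eq0 => /eqP ->; rewrite sub0mx.
  have FA'sub : (Fr A' <= Fr A + C)%MS.
    apply: submx_rank; first by rewrite addsmx_sub map_submx AA'.
    rewrite rFA'; apply: leq_trans rA' _; rewrite ltnNge; apply: contra FAC => le.
    apply: submx_trans (addsmxSl (Fr A) C) _.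
    by apply: submx_rank (addsmxSr _ _) _; rewrite rC.
  have PcapAC : (A :&: C <= P)%MS.
    apply: submx_rank; first by rewrite sub_capmx PA PC.
    rewrite rP -ltnS prednK // -[X in (_ < X)%N]rA ltnNge; apply: contra sAC => le.
    by apply: submx_trans (capmxSr A C); apply: submx_rank (capmxSl _ _) le.
  (* Neither A nor Fr A lies in C here, whence A ∩ C = P and Fr A' <= Fr A + C: these are the
     hypotheses needed for a line v of C, outside P, with Fr v = v modulo Fr A. Then P + v serves as
     C_x and A + v as A_(x+1); the congruence places v in Fr (A + v). *)
  have [|v vC FvA||v [vC vP vF]] := @fixed_line P C (Fr A) PC PFA _ _ _.
  - by apply: submx_trans FA'sub; rewrite map_submx.
  - by apply: submx_trans PcapAC; rewrite sub_capmx vC andbT -(map_submx sg).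
  - apply/negP => /mxrankS; rewrite rP rC => /leq_trans/(_ (leq_pred x)).
    by rewrite -{2}[x]addn0 leq_add2l.
  have vA : ~~ (v <= A)%MS.
    apply: contra vP => vA; apply: submx_trans PcapAC; by rewrite sub_capmx vA.
  pose X := (P + v)%MS; pose A1 := (A + v)%MS.
  have rX : \rank X = x by rewrite rank_add_line // rP prednK.
  have rA1 : \rank A1 = x.+1 by rewrite rank_add_line // rA.
  have XC : (X <= C)%MS by rewrite addsmx_sub PC.
  have XA1 : (X <= A1)%MS by rewrite addsmxS.
  have XFA1 : (X <= Fr A1)%MS.
    rewrite map_addsmx addsmx_sub (submx_trans PFA) ?addsmxSl //=.
    have vE : v = Fr v - (Fr v - v) by rewrite subKr.
    rewrite {1}vE; apply: addmx_sub; first exact: addsmxSr.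
    by rewrite -[(- _)%R]scaleN1r scalemx_sub // (submx_trans vF) // addsmxSl.
  have XA : ~~ (X <= A)%MS by rewrite addsmx_sub negb_and vA orbT.
  have A1A' : (A1 <= A')%MS by rewrite addsmx_sub AA' (submx_trans vC).
  have [|As [Cs [ch Ax Ce Px Ae]]] := IH x.+1 X A1 C A'.
    split; [split | by split; rewrite ?addsmxSl | by split].
    - exact: rX.
    - exact: rA1.
    - by rewrite rC addSn addnS.
    - by rewrite addSn -addnS.
  rewrite addnS -addSn.
  exists (fun i => if i == x then A else As i), (fun i => if i == x then X else Cs i).
  rewrite eqxx [(x.+1 + m)%N == x]gtn_eqF; last exact: leq_addr.
  split; [ | by [] | exact: Ce | exact: addsmxSl | exact: Ae].
  apply: (chain_cons ch rA rX _ Px).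
  - by rewrite Ax addsmxSl.
  - by rewrite Ax.
  - by rewrite (eqmx_map Ax).
  - by left.
  (* By ranks the inclusion would be an equality, and then Fr A <= Fr (As x.+1) = Cs x.+1 <= C. *)
  - right; apply: contra FAC => le.
    have := chain_rank ch (i := x.+1); rewrite leqnn leq_addr => /(_ isT)[rAx rCx].
    have [_ Cm] := chain_mono ch (leqnn x.+1) (leq_addr m x.+1) (leqnn _).
    have le' : (Fr (As x.+1) <= Cs x.+1)%MS by apply: submx_rank le _; rewrite mxrank_map rAx rCx.
    rewrite -Ce; apply: submx_trans Cm; apply: submx_trans le'.
    by rewrite map_submx Ax addsmxSl.
have FA : (Fr A <= A)%MS by move: nlow; rewrite FAC.
have AFA : (A <= Fr A)%MS by apply: submx_rank FA _; rewrite rFA rA.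
have sAC := submx_trans AFA FAC.
by apply: (gap_stable gapA sAC FA); move: nIIa; rewrite sAC.
Qed.

End Flags.

(** * Products of distinct simple reflections in the Weyl group *)

Section Weyl.
Variable d : nat.
Implicit Types (s t v w : 'S_d) (i j : 'I_d).

Lemma simple_tpermE x i : 0 < x < d ->
  simple_tperm d x i = (if i == x.-1 :> nat then x else if i == x :> nat then x.-1 else i) :> nat.
Proof.
move=> /andP[x0 xd]; have x1d : x.-1 < d by lia.
rewrite /simple_tperm (insubT (fun m => m < d) x1d) (insubT (fun m => m < d) xd) /=.
case: tpermP => [->|->|/eqP + /eqP]; rewrite /= ?eqxx //.
  by case: eqP => //; lia.
by rewrite -!val_eqE /= => /negPf -> /negPf ->.
Qed.

Lemma simple_tpermK x : (simple_tperm d x * simple_tperm d x = 1)%g.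
Proof.
rewrite /simple_tperm; case: insub => [i|]; last by rewrite mulg1.
by case: insub => [j|]; [exact: tperm2 | rewrite mulg1].
Qed.

Definition range_perm (S : pred nat) (a b : nat) : 'S_d :=
  (\prod_(a <= x < b | S x) simple_tperm d x)%g.

Lemma range_perm_bounds S a b i : 0 < a -> b <= d ->
  [/\ i < a.-1 -> range_perm S a b i = i, b <= i -> range_perm S a b i = i
    & a.-1 <= i -> a.-1 <= range_perm S a b i].
Proof.
move=> a0 bd; rewrite /range_perm big_seq_cond; elim/big_rec: _ i => [i|x p /andP[]].
  by rewrite perm1.
rewrite mem_index_iota => /andP[ax xb] _ IH j; rewrite permM.
have [lo hi ge] := IH (simple_tperm d x j).
have xE := simple_tpermE j (x := x) ltac:(lia).
have fixj : j < a.-1 \/ b <= j -> simple_tperm d x j = j.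
  move=> ja; apply: ord_inj; rewrite xE.
  by rewrite ifF ?ifF //; lia.
split=> ja.
- have E := fixj (or_introl ja); by move: lo; rewrite E => ->.
- have E := fixj (or_intror ja); by move: hi; rewrite E => ->.
by apply: ge; rewrite xE; case: eqP => _; last case: eqP => _; lia.
Qed.

Lemma range_perm_cat S a b c : a <= b -> b <= c ->
  range_perm S a c = (range_perm S a b * range_perm S b c)%g.
Proof. by move=> ab bc; rewrite /range_perm (@big_cat_nat _ _ _ b). Qed.

Lemma range_perm_ltn S a b : a < b -> range_perm S a b =
  ((if S a then simple_tperm d a else 1) * range_perm S a.+1 b)%g.
Proof.
by move=> ab; rewrite /range_perm (big_ltn_cond ab); case: (S a); rewrite ?mul1g.
Qed.

Definition pattern_perm (S : pred nat) : 'S_d := range_perm S 1 d.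

Lemma pattern_permE S i : 0 < i ->
  pattern_perm S i = range_perm S i.+1 d ((if S i then simple_tperm d i else 1%g) i).
Proof.
move=> i0; have id := ltn_ord i.
rewrite /pattern_perm (@range_perm_cat S 1 i d) ?(ltnW id) // (range_perm_ltn _ id).
by rewrite !permM; have [_ ->] := range_perm_bounds S i (ltn0Sn 0) (ltnW id).
Qed.

(** Smaller letters fix i, the letter i lowers it by one, and larger letters fix i - 1. With
    [pattern_perm_ge] this says that the permutation matrix is Hessenberg and that its subdiagonal
    records S. *)
Lemma pattern_perm_letter (S : pred nat) i : S i -> 0 < i -> pattern_perm S i = i.-1 :> nat.
Proof.
move=> Si i0; have id := ltn_ord i.
rewrite pattern_permE // Si; set j := simple_tperm d i i.
have jE : j = i.-1 :> nat by rewrite simple_tpermE ?i0 //= ifF ?eqxx //; lia.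
have [-> //] := range_perm_bounds S j (ltn0Sn i) (leqnn d).
by rewrite jE /=; lia.
Qed.

Lemma pattern_perm_ge (S : pred nat) i : ~~ S i -> i <= pattern_perm S i.
Proof.
move=> /negPf Si; have id := ltn_ord i; have [->//|i0] := posnP i.
rewrite pattern_permE // Si perm1.
by have [_ _ ->] := range_perm_bounds S i (ltn0Sn i) (leqnn d).
Qed.

Lemma pattern_perm_fix (S : pred nat) i :
  ~~ S i -> ~~ S i.+1 -> pattern_perm S i = i.
Proof.
move=> /negPf Si /negPf Si1; have id := ltn_ord i.
have fixi : range_perm S i.+1 d i = i.
  have [i1d|i1d] := ltnP i.+1 d; last by rewrite /range_perm big_geq ?perm1.
  rewrite range_perm_ltn // Si1 mul1g.
  by have [->] := range_perm_bounds S i (ltn0Sn i.+1) (leqnn d).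
have [i0|i0] := posnP i; last by rewrite pattern_permE // Si perm1.
by move: fixi; rewrite i0.
Qed.

Definition inversions s := [set p : 'I_d * 'I_d | (p.1 < p.2) && (s p.2 < s p.1)].
Definition inv s := #|inversions s|.

(** Composing with s_x permutes the pairs other than (x - 1, x) and toggles that one; [e] records
    whether it is an ascent of s. *)
Lemma inversions_simple x s : 0 < x < d -> exists e,
  inv (simple_tperm d x * s)%g + ~~ e = inv s + e /\
  forall i j, i = x.-1 :> nat -> j = x :> nat -> e = (s i < s j).
Proof.
move=> xd; have x1d : x.-1 < d by lia.
have xd' : x < d by lia.
pose a := Ordinal x1d; pose b := Ordinal xd'; pose t := simple_tperm d x.
have tE i : t i = (if i == x.-1 :> nat then x else if i == x :> nat then x.-1 else i) :> nat.
  exact: simple_tpermE.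
have ta : t a = b by apply: ord_inj; rewrite tE /= eqxx.
have tb : t b = a by apply: ord_inj; rewrite tE /= eqxx ifF //; lia.
have tK i : t (t i) = i by rewrite -permM simple_tpermK perm1.
exists (s a < s b); split; last first.
  by move=> i j iE jE; congr (s _ < s _); apply: ord_inj.
have eq_card : #|inversions (t * s)%g :\ (a, b)| = #|inversions s :\ (a, b)|.
  pose f (p : 'I_d * 'I_d) := (t p.1, t p.2).
  have f_inj : injective f by move=> [i j] [i' j'] [/perm_inj -> /perm_inj ->].
  rewrite -(card_imset _ f_inj); apply: eq_card => -[i j].
  apply/imsetP/idP => [[[i' j']]|].
    rewrite !inE /= !permM => /and3P[ne lt lts] [-> ->]; rewrite lts andbT.
    move: ne; rewrite !xpair_eqE -!val_eqE /= !tE; do !case: eqP => //=; lia.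
  rewrite !inE /= => /and3P[ne lt lts]; exists (t i, t j); last by rewrite /f /= !tK.
  rewrite !inE /= !permM !tK lts andbT.
  move: ne; rewrite !xpair_eqE -!val_eqE /= !tE; do !case: eqP => //=; lia.
rewrite /inv (cardsD1 (a, b) (inversions s)) (cardsD1 (a, b) (inversions (t * s)%g)) eq_card.
rewrite !inE /= !permM ta tb.
have -> : a < b by rewrite /=; lia.
have ne : s a <> s b :> nat by move=> /ord_inj/perm_inj/(congr1 val) /=; lia.
move: ne => /=; case: (ltngtP (s a) (s b)) => //=; lia.
Qed.

Definition weyl_inv (w : weyl d) := inv w.1 + inv w.2.

Lemma inv1 : inv 1%g = 0.
Proof.
apply: eq_card0 => -[i j]; rewrite !inE /= !perm1; lia.
Qed.

Lemma mem_simples (w : weyl d) : reflect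
  (exists2 x, 0 < x < d & w = simple1 d x \/ w = simple2 d x) (w \in simples d).
Proof.
rewrite inE mem_cat; apply: (iffP orP).
  by case=> /mapP[x]; rewrite mem_iota => xd ->; exists x; [lia | left | lia | right].
by case=> x xd [] ->; [left | right]; apply/mapP; exists x; rewrite // mem_iota; lia.
Qed.

Lemma weyl_inv_simple (g w : weyl d) : g \in simples d -> weyl_inv (g * w)%g <= (weyl_inv w).+1.
Proof.
have le x s : 0 < x < d -> inv (simple_tperm d x * s)%g <= (inv s).+1.
  by move=> xd; have [e [E _]] := inversions_simple s xd; case: e E => /=; lia.
case/mem_simples=> x xd [] ->; rewrite /weyl_inv /= mul1g.
  by rewrite -addSn leq_add2r le.
by rewrite -addnS leq_add2l le.
Qed.

Lemma increasing_perm s : (forall i j, j = i.+1 :> nat -> s i < s j) -> s = 1%g.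
Proof.
move=> s_step.
have s_incr i j : i < j -> s i < s j.
  case: j => j jd /=; elim: j jd => // j IH jd; rewrite ltnS leq_eqVlt => /predU1P[ij|ij].
    by apply: s_step; rewrite /= ij.
  have j'd : j < d by exact: ltnW.
  by apply: ltn_trans (IH j'd ij) _; apply: s_step.
have ge (u : 'S_d) : (forall i j, i < j -> u i < u j) -> forall i, i <= u i.
  move=> u_incr [i id] /=; elim: i id => // i IH id.
  have i'd : i < d by exact: ltnW.
  by apply: leq_ltn_trans (IH i'd) _; apply: u_incr.
apply/permP => i; rewrite perm1; apply: ord_inj; apply/eqP; rewrite eqn_leq ge // andbT.
rewrite -{2}[i](permK s); apply: ge => a b ab; rewrite ltnNge leq_eqVlt.
apply/negP => /predU1P[/ord_inj/perm_inj ba|]; first by rewrite ba ltnn in ab.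
by move/s_incr; rewrite !permKV; lia.
Qed.

Lemma exists_descent s : s != 1%g -> exists2 x, 0 < x < d &
  inv s = (inv (simple_tperm d x * s)%g).+1.
Proof.
move=> s1; have [x xd dx] : exists2 x, 0 < x < d &
    exists i j, [/\ i = x.-1 :> nat, j = x :> nat & ~~ (s i < s j)].
  apply: contrapT => nex; case/eqP: s1; apply: increasing_perm => i j ij.
  apply: contrapT => /negP lt; case: nex; exists j; first by rewrite ltn_ord ij.
  by exists i, j; rewrite ij.
have [i [j [ix jx lt]]] := dx; exists x => //.
have [e [E eE]] := inversions_simple s xd; move: E; rewrite (eE i j) // (negPf lt) /=; lia.
Qed.

Lemma weyl_descent (w : weyl d) : 0 < weyl_inv w -> exists2 g, g \in simples d &
  (weyl_inv (g * w)%g).+1 = weyl_inv w /\ (g * (g * w) = w)%g.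
Proof.
have [w1|w1] := eqVneq w.1 1%g; have [w2|w2] := eqVneq w.2 1%g; first by rewrite /weyl_inv w1 w2 inv1.
- have [x xd xE] := exists_descent w2; exists (simple2 d x).
    by apply/mem_simples; exists x => //; right.
  rewrite /weyl_inv /= mul1g; split; first by rewrite xE addnS.
  by case: (w) => a b; congr pair; rewrite /= ?mulgA ?simple_tpermK !mul1g.
- have [x xd xE] := exists_descent w1; exists (simple1 d x).
    by apply/mem_simples; exists x => //; left.
  rewrite /weyl_inv /= mul1g; split; first by rewrite xE addSn.
  by case: (w) => a b; congr pair; rewrite /= ?mulgA ?simple_tpermK !mul1g.
have [x xd xE] := exists_descent w1; exists (simple1 d x).
  by apply/mem_simples; exists x => //; left.
rewrite /weyl_inv /= mul1g; split; first by rewrite xE addSn.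
by case: (w) => a b; congr pair; rewrite /= ?mulgA ?simple_tpermK !mul1g.
Qed.

Lemma weyl_inv_eq0 (w : weyl d) : weyl_inv w = 0 -> w = 1%g.
Proof.
move/eqP; rewrite addn_eq0 => /andP[/eqP w1 /eqP w2].
have e s : inv s = 0 -> s = 1%g.
  by move=> s0; apply/eqP; apply: contraT => /exists_descent[x _]; rewrite s0.
by case: w w1 w2 => a b /= /e -> /e ->.
Qed.

Lemma mem_simples_expn n (w : weyl d) : w \in (simples d ^+ n)%g -> weyl_inv w <= n.
Proof.
elim: n w => [|n IH] w; first by rewrite expg0 => /set1P ->; rewrite /weyl_inv inv1.
rewrite expgS => /mulsgP[g h gs /IH hn ->].
exact: leq_trans (weyl_inv_simple _ gs) _.
Qed.

Lemma simples_expn_inv n (w : weyl d) : weyl_inv w = n -> w \in (simples d ^+ n)%g.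
Proof.
elim: n w => [|n IH] w wn; first by rewrite (weyl_inv_eq0 wn) expg0 inE.
have [|g gs [gn gE]] := @weyl_descent w; first by rewrite wn.
by rewrite -gE expgS mem_mulg //; apply: IH; lia.
Qed.

(** Descending by simple reflections attains every smaller number of inversions, which takes enough
    group elements. The bound keeps the search in [weyl_length] within its range. *)
Lemma weyl_inv_bound (w : weyl d) : weyl_inv w < #|{: weyl d}|.
Proof.
suff: forall n (u : weyl d), weyl_inv u = n -> n <= #|[set v : weyl d | weyl_inv v < n]|.
  move/(_ _ w erefl) => le; apply: leq_ltn_trans le _; rewrite -cardsT; apply: proper_card.
  apply/properP; split; [by apply/fintype.subsetP => v _; rewrite inE | by exists w; rewrite !inE ?ltnn].
elim=> // n IH u un; have [|g gs [gn _]] := @weyl_descent u; first by rewrite un.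
have gun : weyl_inv (g * u)%g = n by lia.
apply: leq_ltn_trans (IH _ gun) _; apply: proper_card; apply/properP; split.
  by apply/fintype.subsetP => v; rewrite !inE; lia.
by exists (g * u)%g; rewrite !inE gun ?ltnn.
Qed.

Lemma weyl_lengthE (w : weyl d) : weyl_length w = weyl_inv w.
Proof.
rewrite /weyl_length; set P := fun n => _; set M := #|_|.
have wM : weyl_inv w < M := weyl_inv_bound w.
have hasP : has P (iota 0 M).
  by apply/hasP; exists (weyl_inv w); [rewrite mem_iota | exact: simples_expn_inv].
have fM : find P (iota 0 M) < M by move: hasP; rewrite has_find size_iota.
have := nth_find 0 hasP; rewrite nth_iota // => /mem_simples_expn le.
apply/eqP; rewrite eqn_leq andbC {}le /= leqNgt; apply/negP => lt.
by have := before_find 0 lt; rewrite nth_iota // /P simples_expn_inv.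
Qed.

Lemma inv_mul (K : pred nat) v w :
    (forall x i, K x -> (v i < x) = (i < x)) ->
    (forall i j, j = i.+1 :> nat -> ~~ K j -> w i < w j) ->
  inv (v * w)%g = inv v + inv w.
Proof.
move=> vK w_step.
have w_incr i j : i < j -> (forall x, i < x <= j -> ~~ K x) -> w i < w j.
  case: j => j jd /=; elim: j jd => // j IH jd; rewrite ltnS leq_eqVlt => /predU1P[ij|ij] nK.
    by apply: w_step => /=; [rewrite ij | apply: nK; lia].
  have j'd : j < d by exact: ltnW.
  apply: (@ltn_trans (w (Ordinal j'd))); first by apply: IH => // x xj; apply: nK; lia.
  by apply: w_step => //=; apply: nK; lia.
have vVK x i : K x -> (i < x) = ((v^-1)%g i < x) by move=> Kx; have := vK x ((v^-1)%g i) Kx; rewrite permKV.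
have sub : inversions v \subset inversions (v * w)%g.
  apply/fintype.subsetP => -[i j]; rewrite !inE /= !permM => /andP[ij vij]; rewrite ij.
  apply: w_incr => // x /andP[xj xi]; apply/negP => Kx.
  by have := vK x i Kx; have := vK x j Kx; lia.
rewrite /inv -(cardsID (inversions v)) (finset.setIidPr sub); congr addn.
pose f (p : 'I_d * 'I_d) := (v p.1, v p.2).
have f_inj : injective f by move=> [i j] [i' j'] [/perm_inj -> /perm_inj ->].
rewrite -[LHS](card_imset _ f_inj); apply: eq_card => -[i j].
apply/imsetP/idP => [[[i' j']]|].
  rewrite !inE /= !permM => /andP[nv /andP[ij wv]] [-> ->]; rewrite wv andbT.
  move: nv; rewrite ij /= -leqNgt leq_eqVlt => /predU1P[/ord_inj/perm_inj e|//].
  by rewrite e ltnn in ij.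
rewrite !inE /= => /andP[ij wij]; exists ((v^-1)%g i, (v^-1)%g j); last by rewrite /f /= !permKV.
rewrite !inE /= !permM !permKV wij andbT [j < i]ltnNge (ltnW ij) andbF /=.
have [x /andP[ix xj] Kx] : exists2 x, i < x <= j & K x.
  apply: contrapT => nex; move: wij; rewrite ltnNge ltnW // w_incr // => x xij.
  by apply/negP => Kx; apply: nex; exists x.
by move: ix xj; rewrite ltnNge -ltnS; have := vVK x i Kx; have := vVK x j Kx; lia.
Qed.

(** Elements of W_J are known through generators only; since the permutations preserving a set of
    cuts form a group, preservation needs to be checked on simple reflections alone. *)
Lemma cut_group_set (K1 K2 : pred nat) : group_set [set v : weyl d |
  [forall x : 'I_d, K1 x ==> [forall i, (v.1 i < x) == (i < x)]] &&
  [forall x : 'I_d, K2 x ==> [forall i, (v.2 i < x) == (i < x)]]].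
Proof.
apply/group_setP; split=> [|u v].
  by rewrite inE /=; apply/andP; split; apply/forallP => x; apply/implyP => _;
    apply/forallP => i; rewrite perm1.
rewrite !inE => /andP[/forallP u1 /forallP u2] /andP[/forallP v1 /forallP v2].
apply/andP; split; apply/forallP => x; apply/implyP => Kx; apply/forallP => i /=; rewrite permM.
  have /implyP/(_ Kx)/forallP/(_ i)/eqP <- := u1 x.
  by have /implyP/(_ Kx)/forallP/(_ (u.1 i)) := v1 x.
have /implyP/(_ Kx)/forallP/(_ i)/eqP <- := u2 x.
by have /implyP/(_ Kx)/forallP/(_ (u.2 i)) := v2 x.
Qed.

Lemma simple_tperm_cut x y i : 0 < x < d -> y != x -> (simple_tperm d x i < y) = (i < y).
Proof. by move=> xd yx; rewrite simple_tpermE //; case: eqP => [->|_]; [|case: eqP => [->|//]]; lia. Qed.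

(* An element v of the parabolic subgroup permutes each interval between two
   cuts, and w is increasing there; so the inversions of v w are those of v
   and the preimages by v of those of w. *)
Lemma min_coset_rep_step (J : {set weyl d}) (w : weyl d) : J \subset simples d ->
    (forall i j, j = i.+1 :> nat -> simple1 d j \in J -> w.1 i < w.1 j) ->
    (forall i j, j = i.+1 :> nat -> simple2 d j \in J -> w.2 i < w.2 j) ->
  min_coset_rep J w.
Proof.
move=> Js w1 w2 v vJ; rewrite !weyl_lengthE /weyl_inv.
pose K1 x := (0 < x) && (simple1 d x \notin J); pose K2 x := (0 < x) && (simple2 d x \notin J).
have sJ : <<J>>%g \subset Group (cut_group_set K1 K2).
  rewrite gen_subG; apply/fintype.subsetP => g gJ; have /mem_simples[x xd gE] := fintype.subsetP Js _ gJ.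
  rewrite inE; case: gE gJ => -> gJ; apply/andP; split; apply/forallP => y; apply/implyP => Ky;
    apply/forallP => i; rewrite /= ?perm1 // simple_tperm_cut //;
    apply: contraTneq Ky => yx; by rewrite /K1 /K2 yx gJ andbF.
have := fintype.subsetP sJ _ vJ; rewrite inE => /andP[/forallP v1 /forallP v2].
have E1 : inv (v.1 * w.1)%g = inv v.1 + inv w.1.
  apply: (@inv_mul K1) => [x i Kx|i j ij].
    have [xd|dx] := ltnP x d.
      by have /implyP/(_ Kx)/forallP/(_ i)/eqP := v1 (Ordinal xd).
    by rewrite !(leq_trans (ltn_ord _) dx).
  by rewrite /K1 {1}ij /= negbK => ?; apply: w1.
have E2 : inv (v.2 * w.2)%g = inv v.2 + inv w.2.
  apply: (@inv_mul K2) => [x i Kx|i j ij].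
    have [xd|dx] := ltnP x d.
      by have /implyP/(_ Kx)/forallP/(_ i)/eqP := v2 (Ordinal xd).
    by rewrite !(leq_trans (ltn_ord _) dx).
  by rewrite /K2 {1}ij /= negbK => ?; apply: w2.
by rewrite addnACA -E1 -E2.
Qed.

Lemma pattern_perm_incr S i j : ~~ S 0 -> j = i.+1 :> nat -> (S j -> S i) ->
  pattern_perm S i < pattern_perm S j.
Proof.
move=> S0 ij SS; have [Si|nSi] := boolP (S i).
  have i0 : 0 < i by rewrite lt0n; apply: contraTneq Si => ->.
  rewrite (pattern_perm_letter Si i0).
  have [Sj|nSj] := boolP (S j); first by rewrite (pattern_perm_letter Sj) ij //=; lia.
  by have := pattern_perm_ge nSj; lia.
have nSj : ~~ S j by apply: contra nSi.
rewrite pattern_perm_fix -?ij //; have := pattern_perm_ge nSj; lia.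
Qed.

End Weyl.

(** * Index words as sets of letters *)

Section Patterns.
Variable d : nat.

Lemma simple_tperm_inj x y : 0 < x < d -> 0 < y < d ->
  simple_tperm d x = simple_tperm d y -> x = y.
Proof.
move=> xd yd E; have x1d : x.-1 < d by lia.
have := simple_tpermE (Ordinal x1d) xd; rewrite E simple_tpermE //= eqxx.
by case: eqP => [|_]; [lia | case: eqP; lia].
Qed.

Lemma simple_tperm_neq1 x : 0 < x < d -> simple_tperm d x != 1%g.
Proof.
move=> xd; have x1d : x.-1 < d by lia.
apply/eqP => E; have := simple_tpermE (Ordinal x1d) xd.
by rewrite E perm1 /= eqxx; lia.
Qed.

Section Words.
Variable ks : seq nat.
(** The letters k_i + 1; for 0 < x < d, a simple reflection lies in J exactly when its letter is not
    one of them. *)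
Definition cut (x : nat) := (0 < x) && (x.-1 \in ks).

(** The set of letters of w_1 ... w_r. Each factor is a run starting at k_i + 1, so any other letter
    brings its predecessor along. Subsets replace tuples because they are what a pair of flags
    determines. *)
Definition adm_pattern (S : pred nat) : Prop :=
  [/\ ~~ S 0, forall x, d <= x -> ~~ S x & forall x, S x -> ~~ cut x -> S x.-1].

Lemma adm_pattern_descend S j : adm_pattern S -> S j ->
  exists2 x, cut x && (x <= j) & forall i, x <= i <= j -> S i.
Proof.
move=> [S0 _ Sc]; elim: j => [|j IH] Sj; first by rewrite Sj in S0.
have [cj|ncj] := boolP (cut j.+1).
  by exists j.+1; rewrite ?cj //= => i ij; have -> : i = j.+1 by lia.
have [x /andP[cx xj] xS] := IH (Sc _ Sj ncj); exists x; first by rewrite cx ltnW.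
by move=> i ij; have [->//|ne] := eqVneq i j.+1; apply: xS; lia.
Qed.

Lemma adm_pattern_incr S (i j : 'I_d) : adm_pattern S -> j = i.+1 :> nat -> ~~ cut j ->
  pattern_perm d S i < pattern_perm d S j.
Proof.
move=> [S0 _ Sc] ij nc; apply: pattern_perm_incr => // Sj.
by have := Sc _ Sj nc; rewrite ij.
Qed.

Definition next i := nth d.-1 ks i.+1.
Definition pattern_words (S : pred nat) : seq 'S_d :=
  mkseq (fun i => range_perm d S (nth d.-1 ks i).+1 (next i).+1) (size ks).

Hypotheses (ks_sorted : sorted ltn ks) (ks_bound : all (fun k => k < d.-1) ks).

Lemma nth_ks_lt i j : i < j -> j < size ks -> nth d.-1 ks i < nth d.-1 ks j.
Proof.
by move=> ij js; apply: (sorted_ltn_nth ltn_trans) => //; rewrite inE //; apply: ltn_trans js.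
Qed.

Lemma nth_ks_bound i : i < size ks -> nth d.-1 ks i < d.-1.
Proof. by move=> si; apply: (allP ks_bound); exact: mem_nth. Qed.

Lemma nth_ks_next i : i < size ks -> nth d.-1 ks i < next i <= d.-1.
Proof.
move=> si; rewrite /next; have [i1|i1] := ltnP i.+1 (size ks).
  by rewrite nth_ks_lt //= ltnW // nth_ks_bound.
by rewrite (nth_default _ i1) nth_ks_bound // leqnn.
Qed.

Lemma cut_between i x : i < size ks -> nth d.-1 ks i < x <= next i ->
  cut x -> x = (nth d.-1 ks i).+1.
Proof.
move=> si /andP[ix xi] /andP[x0 xks]; set j := index x.-1 ks.
have js : j < size ks by rewrite index_mem.
have xE : nth d.-1 ks j = x.-1 by exact: nth_index.
have [ij|ji|ij] := ltngtP i j; last by rewrite ij xE; lia.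
  have le : next i <= nth d.-1 ks j.
    rewrite /next; move: ij; rewrite leq_eqVlt => /predU1P[<-//|ij].
    by rewrite ltnW // nth_ks_lt.
  by move: le xi; rewrite xE; lia.
by have := nth_ks_lt ji si; rewrite xE; lia.
Qed.

Lemma antitone_prefix (f : pred nat) a b : (forall x, a <= x -> x.+1 < b -> f x.+1 -> f x) ->
  exists2 t, t <= b - a & forall x, a <= x < b -> f x = (x < a + t).
Proof.
elim: b => [|b IH] fa; first by exists 0 => // x; lia.
have [|t tb tE] := IH; first by move=> x ax xb; apply: fa => //; lia.
have [ab|ba] := leqP a b; last by exists 0 => // x; lia.
have [fb|nfb] := boolP (f b); last first.
  exists t; first by lia.
  move=> x xb; have [->|ne] := eqVneq x b; last by apply: tE; lia.
  by rewrite (negPf nfb); lia.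
exists (b.+1 - a) => // x /andP[ax xb]; rewrite subnKC ?xb; last by lia.
have [e|ne] := eqVneq x b; first by rewrite e.
have all_f m : a <= b - m -> f (b - m).
  elim: m => [|m IHm] am; first by rewrite subn0.
  have [mb|mb] := ltnP m b; last by rewrite (_ : b - m.+1 = b - m) ?IHm //; lia.
  by apply: fa => //; [lia | rewrite (_ : (b - m.+1).+1 = b - m) ?IHm //; lia].
by rewrite -(subKn (ltnSE xb)) all_f //; lia.
Qed.

Lemma range_perm_prefix S a b t : 0 < a -> a + t <= b ->
  (forall x, a <= x < b -> S x = (x < a + t)) -> range_perm d S a b = simple_word d a (a + t).
Proof.
move=> a0 atb SE; rewrite (@range_perm_cat _ _ _ (a + t)) ?leq_addr // /range_perm.
rewrite [X in (_ * X)%g]big_nat_cond [X in (_ * X)%g]big1 ?mulg1 => [|x /andP[xr]]; last first.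
  by rewrite SE; lia.
rewrite /simple_word big_nat_cond [RHS]big_nat_cond; apply: eq_bigl => x.
by rewrite andbT; case: (boolP (a <= x < a + t)) => //= xr; rewrite SE; lia.
Qed.

Lemma pattern_words_adm S : adm_pattern S -> admissible ks (pattern_words S).
Proof.
move=> [S0 Sd Sc]; split=> [|i si]; first by rewrite size_mkseq.
have /andP[lt le] := nth_ks_next si; rewrite nth_mkseq //.
have [x ax xb Sx|t tb tE] := @antitone_prefix S (nth d.-1 ks i).+1 (next i).+1.
  apply: (Sc _ Sx); apply/negP => /(cut_between si); lia.
exists t; first by rewrite -/(next i); lia.
rewrite -addSn; apply: range_perm_prefix => //; lia.
Qed.

Lemma adm_pattern_words ws : admissible ks ws ->
  exists2 S, adm_pattern S & ws = pattern_words S.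
Proof.
move=> [sz wsP].
have ex i : exists t, i < size ks -> t <= next i - nth d.-1 ks i /\
    nth 1%g ws i = simple_word d (nth d.-1 ks i).+1 (nth d.-1 ks i + t).+1.
  have [si|] := boolP (i < size ks); last by exists 0.
  by have [t tb tE] := wsP i si; exists t.
have [t tP] := choice ex.
pose S x := [exists i : 'I_(size ks), nth d.-1 ks i < x <= nth d.-1 ks i + t i].
have SE i x : i < size ks -> nth d.-1 ks i < x <= next i -> S x = (x <= nth d.-1 ks i + t i).
  move=> si /andP[ix xi]; apply/existsP/idP => [[[j sj] /= /andP[jx xj]]|xt].
    have [ij|ji|ij] := ltngtP i j; last by rewrite ij.
      have le : next i <= nth d.-1 ks j.
        rewrite /next; move: ij; rewrite leq_eqVlt => /predU1P[<-//|ij].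
        by rewrite ltnW // nth_ks_lt.
      by lia.
    have [tj _] := tP j sj; have /andP[ltj _] := nth_ks_next sj.
    have le : next j <= nth d.-1 ks i.
      rewrite /next; move: ji; rewrite leq_eqVlt => /predU1P[<-//|ji].
      by rewrite ltnW // nth_ks_lt.
    by lia.
  by exists (Ordinal si); rewrite /= ix.
exists S.
  split; first by apply/existsP => -[i]; rewrite ltn0.
  - move=> x dx; apply/existsP => -[[i si] /= /andP[ix xi]].
    have [ti _] := tP i si; have := nth_ks_next si; lia.
  - move=> x /existsP[[i si] /= /andP[ix xi]] ncx; apply/existsP; exists (Ordinal si) => /=.
    have ne : x.-1 != nth d.-1 ks i.
      by apply: contra ncx => /eqP e; rewrite /cut e mem_nth // andbT; lia.
    by move: ne; rewrite neq_ltn; lia.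
apply: (@eq_from_nth _ 1%g) => [|i]; first by rewrite size_mkseq.
rewrite sz => si; rewrite nth_mkseq //; have [ti ->] := tP i si.
have := nth_ks_next si => lt; rewrite -addSn; symmetry; apply: range_perm_prefix => //; first by lia.
by move=> x xr; rewrite (SE i) //; lia.
Qed.

(** The ranges of consecutive factors glue, and no letter lies below the first cut because every
    letter descends to a cut. *)
Lemma prod_pattern_words S : adm_pattern S ->
  (\prod_(w <- pattern_words S) w)%g = pattern_perm d S.
Proof.
move=> Sadm; rewrite /pattern_words /mkseq big_map.
have empty a b : b <= d -> (forall x, a <= x < b -> ~~ S x) -> range_perm d S a b = 1%g.
  move=> bd nS; rewrite /range_perm big_nat_cond big1 // => x /andP[/nS/negPf ->//].
have main m : m <= size ks -> (\prod_(i <- iota (size ks - m) m)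
    range_perm d S (nth d.-1 ks i).+1 (next i).+1)%g = range_perm d S (nth d.-1 ks (size ks - m)).+1 d.
  elim: m => [|m IH] ms.
    rewrite big_nil subn0 nth_default // empty //; move=> x; lia.
  have Em : (size ks - m.+1).+1 = size ks - m by lia.
  rewrite (_ : iota _ _ = (size ks - m.+1) :: iota (size ks - m) m) ?big_cons; last by rewrite -Em.
  rewrite (IH (ltnW ms)) /next Em.
  have := @nth_ks_next (size ks - m.+1) ltac:(lia); rewrite /next Em => lt.
  by rewrite -range_perm_cat //; lia.
have := main _ (leqnn _); rewrite subnn => ->; rewrite /pattern_perm.
have noS x : 0 < x <= nth d.-1 ks 0 -> ~~ S x.
  move=> x0; apply/negP => /(adm_pattern_descend Sadm)[y /andP[/andP[y0 yks] yx] _].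
  have s0 : 0 < size ks by case: (ks) yks.
  set j := index y.-1 ks; have js : j < size ks by rewrite index_mem.
  have : nth d.-1 ks 0 <= nth d.-1 ks j.
    by case: (posnP j) => [->//|j0]; rewrite ltnW // nth_ks_lt.
  by rewrite nth_index //; lia.
have [s0|s0] := posnP (size ks).
  rewrite nth_default ?s0 // in noS *; rewrite !empty // => x xd; by apply: noS; lia.
have := nth_ks_bound s0 => lt; rewrite (@range_perm_cat _ S 1 (nth d.-1 ks 0).+1) //; last by lia.
have -> : range_perm d S 1 (nth d.-1 ks 0).+1 = 1%g; last by rewrite mul1g.
by apply: empty => [|x xn]; [lia | apply: noS; lia].
Qed.

Lemma eq_pattern_words S S' : S =1 S' -> pattern_words S = pattern_words S'.
Proof. by move=> SS; apply: eq_mkseq => i; apply: eq_bigl. Qed.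


End Words.
End Patterns.

(** * Points and cuts attached to h, l0 and l1 *)

Section IndexData.
Variables (N : nat) (h : nat -> nat) (l0 l1 d : nat).

Definition pts (x : nat) : bool := x \in [seq l1 + (h i - h 1)./2 | i <- iota 1 N].

Lemma k_seq_sorted : sorted ltn (k_seq N h l1 d).
Proof. by apply: sorted_filter; [exact: ltn_trans | exact: iota_ltn_sorted]. Qed.

Lemma k'_seq_sorted : sorted ltn (k'_seq N h l0 d).
Proof. by apply: sorted_filter; [exact: ltn_trans | exact: iota_ltn_sorted]. Qed.

Lemma k_seq_bound : all (fun k => k < d.-1) (k_seq N h l1 d).
Proof. by apply/allP => k; rewrite mem_filter mem_iota => /andP[_]; lia. Qed.

Lemma k'_seq_bound : all (fun k => k < d.-1) (k'_seq N h l0 d).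
Proof. by apply/allP => k; rewrite mem_filter mem_iota => /andP[_]; lia. Qed.

Lemma cut_k_seq x : cut (k_seq N h l1 d) x = (0 < x < d) && pts x.
Proof.
rewrite /cut mem_filter mem_iota; case: x => [|x] //=; rewrite add0n.
by rewrite -/(pts _) andbC; congr (_ && _); lia.
Qed.

Lemma simple1_J x : 0 < x < d -> (simple1 d x \in Jh N h l0 l1 d) = ~~ cut (k_seq N h l1 d) x.
Proof.
move=> xd; rewrite /Jh /J1 /J2 !inE.
have -> : (simple1 d x \in [seq simple2 d y | y <- iota 1 d.-1]) = false.
  apply/negbTE/mapP => -[y _ [E _]].
  by move/eqP: E; rewrite (negPf (simple_tperm_neq1 xd)).
have -> : simple1 d x \in [seq simple1 d y | y <- iota 1 d.-1].
  by apply: map_f; rewrite mem_iota; lia.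
rewrite andbF orbF andbT; congr (~~ _); apply/mapP/idP => [[y yk [E]]|].
  have yd := allP k_seq_bound _ yk.
  by rewrite (simple_tperm_inj xd _ E) ?/cut //=; lia.
by case/andP => x0 xk; exists x.-1; rewrite // prednK.
Qed.

Lemma simple2_J x : 0 < x < d -> (simple2 d x \in Jh N h l0 l1 d) = ~~ cut (k'_seq N h l0 d) x.
Proof.
move=> xd; rewrite /Jh /J1 /J2 !inE.
have -> : (simple2 d x \in [seq simple1 d y | y <- iota 1 d.-1]) = false.
  apply/negbTE/mapP => -[y _ [_ E]].
  by move/eqP: E; rewrite (negPf (simple_tperm_neq1 xd)).
have -> : simple2 d x \in [seq simple2 d y | y <- iota 1 d.-1].
  by apply: map_f; rewrite mem_iota; lia.
rewrite andbF /= andbT; congr (~~ _); apply/mapP/idP => [[y yk [E]]|].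
  have yd := allP k'_seq_bound _ yk.
  by rewrite (simple_tperm_inj xd _ E) ?/cut //=; lia.
by case/andP => x0 xk; exists x.-1; rewrite // prednK.
Qed.

Lemma Jh_simples : Jh N h l0 l1 d \subset simples d.
Proof.
apply/fintype.subsetP => w; rewrite /Jh /J1 /J2 !inE mem_cat => /orP[] /andP[_ ->] //.
by rewrite orbT.
Qed.

Definition top_pattern (l x : nat) := l <= x < d.

Lemma top_pattern_perm l : 0 < l -> pattern_perm d (top_pattern l) = simple_word d l d.
Proof.
move=> l_gt0; have [ld|dl] := leqP l d; last first.
  rewrite /simple_word big_geq ?(ltnW dl) // /pattern_perm /range_perm big_nat_cond big1 // => x.
  by rewrite /top_pattern; lia.
rewrite /pattern_perm (@range_perm_cat _ _ 1 l) // /range_perm big_nat_cond big1 ?mul1g; last first.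
  by move=> x; rewrite /top_pattern; lia.
rewrite /simple_word big_nat_cond [RHS]big_nat_cond; apply: eq_bigl => x.
by rewrite /top_pattern; lia.
Qed.

Lemma adm_pattern_top (ks : seq nat) l S x : (forall y, cut ks y -> l <= y) ->
  adm_pattern d ks S -> S x -> top_pattern l x.
Proof.
move=> cl Sadm Sx; have [_ Sd _] := Sadm.
have [y /andP[/cl ly yx] _] := adm_pattern_descend Sadm Sx.
rewrite /top_pattern (leq_trans ly yx) ltnNge; apply: contraTN Sx; exact: Sd.
Qed.

Lemma top_pattern_adm (ks : seq nat) l : 0 < l -> (l < d -> cut ks l) ->
  adm_pattern d ks (top_pattern l).
Proof.
move=> l_gt0 cl; split; rewrite /top_pattern; [lia | lia |].
move=> x /andP[lx xd] ncx; have [e|ne] := eqVneq x l; last by lia.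
by move: ncx; rewrite e cl //; lia.
Qed.

Definition word_pair (S S' : pred nat) : seq 'S_d * seq 'S_d :=
  (pattern_words d (k_seq N h l1 d) S, pattern_words d (k'_seq N h l0 d) S').

Definition adm_pair (S S' : pred nat) :=
  adm_pattern d (k_seq N h l1 d) S /\ adm_pattern d (k'_seq N h l0 d) S'.

Lemma index_setE ww : index_set N h l0 l1 d ww <->
  exists S S', adm_pair S S' /\ ww = word_pair S S'.
Proof.
case: ww => ws ws'; split=> [[/= a a']|[S [S' [[a a']] [-> ->]]]].
  have [S Sa ->] := adm_pattern_words k_seq_sorted k_seq_bound a.
  have [S' Sa' ->] := adm_pattern_words k'_seq_sorted k'_seq_bound a'.
  by exists S, S'.
split; apply: pattern_words_adm => //;
  [exact: k_seq_sorted | exact: k_seq_bound | exact: k'_seq_sorted | exact: k'_seq_bound].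
Qed.

Lemma index_prod_words S S' : adm_pair S S' ->
  index_prod (word_pair S S') = (pattern_perm d S, pattern_perm d S').
Proof.
move=> [a a']; rewrite /index_prod /word_pair /=.
rewrite (prod_pattern_words k_seq_sorted k_seq_bound a).
by rewrite (prod_pattern_words k'_seq_sorted k'_seq_bound a').
Qed.

Lemma adm_pair_min S S' : adm_pair S S' ->
  min_coset_rep (Jh N h l0 l1 d) (pattern_perm d S, pattern_perm d S').
Proof.
move=> [a a']; apply: min_coset_rep_step; first exact: Jh_simples.
  move=> i j ij /=; rewrite simple1_J; last by rewrite ltn_ord ij.
  exact: adm_pattern_incr.
move=> i j ij /=; rewrite simple2_J; last by rewrite ltn_ord ij.
exact: adm_pattern_incr.
Qed.

Hypotheses (N_gt0 : 1 <= N)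
  (h_incr : forall i j, 1 <= i -> i < j -> j <= N -> h i < h j)
  (h_parity : forall i, 1 <= i <= N -> odd (h i) = odd (h 1))
  (l0_gt0 : 1 <= l0) (l1_gt0 : 1 <= l1)
  (d_def : d = (l0 + l1 - 1) + (h N - h 1)./2).

(** Equal parity makes all the differences even, so the halves are exact and add up. *)
Let half_split i : 1 <= i <= N -> (h N - h 1)./2 = (h N - h i)./2 + (h i - h 1)./2.
Proof.
move=> iN; have h1i : h 1 <= h i.
  by have [->//|ne] := eqVneq i 1; apply/ltnW/h_incr; lia.
have hiN : h i <= h N.
  by have [->//|ne] := eqVneq i N; apply/ltnW/h_incr; lia.
have := h_parity iN; have := @h_parity N ltac:(lia); lia.
Qed.

Lemma pts_bounds x : pts x -> l1 <= x /\ x + l0 <= d.+1.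
Proof.
case/mapP => i; rewrite mem_iota => iN ->; have := @half_split i ltac:(lia).
by rewrite d_def; lia.
Qed.

Lemma pts_l1 : pts l1.
Proof. by apply/mapP; exists 1; rewrite ?mem_iota ?subnn ?addn0 //; lia. Qed.

Lemma pts_l0 : pts (d.+1 - l0).
Proof. by apply/mapP; exists N; rewrite ?mem_iota ?d_def; lia. Qed.

(** As d + 1 = l0 + l1 + (h_N - h_1)/2, the reflection y -> d + 1 - y exchanges the two families of
    points. *)
Lemma pts_rev y : y <= d -> (y \in [seq l0 + (h N - h i)./2 | i <- iota 1 N]) = pts (d.+1 - y).
Proof.
move=> yd; apply/mapP/mapP => -[i]; rewrite mem_iota => iN E; exists i; rewrite ?mem_iota //;
  by have := @half_split i ltac:(lia); move: E; rewrite d_def in yd *; lia.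
Qed.

Lemma cut_k'_seq x : cut (k'_seq N h l0 d) x = (0 < x < d) && pts (d.+1 - x).
Proof.
rewrite /cut mem_filter mem_iota; case: x => [|x] //=; rewrite add0n.
have [xd|dx] := ltnP x.+1 d; last by rewrite [x < _]ltnNge (_ : _ <= x) ?andbF //; lia.
by rewrite pts_rev ?(ltnW xd) // (_ : x < d.-1) ?andbT //; lia.
Qed.

Lemma adm_pair_top : adm_pair (top_pattern l1) (top_pattern l0).
Proof.
split; apply: top_pattern_adm => // ld.
  by rewrite cut_k_seq l1_gt0 ld pts_l1.
by rewrite cut_k'_seq l0_gt0 ld pts_l0.
Qed.

Lemma adm_pair_sub_top S S' : adm_pair S S' ->
  (forall x, S x -> top_pattern l1 x) /\ (forall x, S' x -> top_pattern l0 x).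
Proof.
move=> [a a']; split=> x; apply: adm_pattern_top (_) => //; try eassumption.
- by move=> y; rewrite cut_k_seq => /andP[_ /pts_bounds[]].
- by move=> y; rewrite cut_k'_seq => /andP[yd /pts_bounds[]]; lia.
Qed.

End IndexData.

(** * Flags and Hessenberg matrices *)

Section FlagMatrices.
Local Open Scope ring_scope.
Variables (k : closedFieldType) (d : nat).
Implicit Types (u v a b c : 'M[k]_d) (x y : nat) (S : pred nat).

(** The span of the first x columns of u, transposed because subspaces are row spaces; square for
    every x, so that all members of a flag have one type. *)
Definition flag u x : 'M[k]_d := pid_mx x *m u^T.

Definition block_zero x y u : Prop := forall i j : 'I_d, (j < x)%N -> (y <= i)%N -> u i j = 0.

Lemma stabilizesE x u : stabilizes x u <-> block_zero x x u.
Proof.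
by split=> s i j => [jx xi|/andP[]]; apply: s; rewrite ?jx.
Qed.

Lemma mul_pid_mxE (A : 'M[k]_d) x i j : (A *m (pid_mx x : 'M_d)) i j = A i j *+ (j < x)%N.
Proof.
rewrite mxE (bigD1 j) //= big1 => [|l lj]; rewrite !mxE val_eqE ?(negPf lj) ?mulr0 //.
by rewrite eqxx addr0 /= mulr_natr.
Qed.

Lemma pid_mx_mulE (A : 'M[k]_d) x i j : ((pid_mx x : 'M_d) *m A) i j = A i j *+ (i < x)%N.
Proof.
rewrite mxE (bigD1 i) //= big1 => [|l li]; rewrite !mxE val_eqE.
  by rewrite eqxx addr0 /= mulr_natl.
by rewrite [i == l]eq_sym (negPf li) mul0r.
Qed.

Lemma sub_pid_mx (A : 'M[k]_d) x :
  (A <= (pid_mx x : 'M_d))%MS <-> forall i j : 'I_d, (x <= j)%N -> A i j = 0.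
Proof.
split=> [/submxP[D AE] i j xj|A0].
  by rewrite AE mul_pid_mxE ltnNge xj mulr0n.
suff -> : A = A *m (pid_mx x : 'M_d) by rewrite submxMl.
by apply/matrixP => i j; rewrite mul_pid_mxE; case: ltnP => // xj; rewrite A0.
Qed.

Lemma flagM u v x : flag (u *m v) x = flag v x *m u^T.
Proof. by rewrite /flag trmx_mul mulmxA. Qed.

Lemma flag_sub_pid u x y : (flag u x <= (pid_mx y : 'M_d))%MS <-> block_zero x y u.
Proof.
have flagE i j : flag u x i j = u j i *+ (i < x)%N.
  by rewrite pid_mx_mulE mxE.
split=> [/sub_pid_mx A0 i j jx yi|A0].
  by have := A0 j i yi; rewrite flagE jx.
by apply/sub_pid_mx => i j yj; rewrite flagE; case: ltnP => // ix; rewrite A0.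
Qed.

Lemma flag_sub a c x y : a \in unitmx ->
  (flag c x <= flag a y)%MS <-> block_zero x y (invmx a *m c).
Proof.
move=> a_unit; rewrite -flag_sub_pid -{1}(mulKVmx a_unit c) flagM /flag -/(flag _ _).
by rewrite submxMfree // row_free_unit unitmx_tr.
Qed.

Lemma rank_flag a x : a \in unitmx -> (x <= d)%N -> \rank (flag a x) = x.
Proof.
move=> a_unit xd; rewrite /flag mxrankMfree ?row_free_unit ?unitmx_tr //.
by rewrite rank_pid_mx.
Qed.

Lemma flag_mono a x y : (x <= y)%N -> (flag a x <= flag a y)%MS.
Proof.
move=> xy; apply: submxMr; apply/sub_pid_mx => i j yj; rewrite !mxE.
by case: eqP => //= ->; rewrite ltnNge (leq_trans xy).
Qed.

Lemma stabilizes_flag x u : stabilizes x u <-> (flag u x <= flag 1%:M x)%MS.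
Proof. by rewrite stabilizesE flag_sub ?unitmx1 // invmx1 mul1mx. Qed.

Lemma stabilizesV x u : u \in unitmx -> (x <= d)%N -> stabilizes x u -> stabilizes x (invmx u).
Proof.
move=> u_unit xd /stabilizes_flag le; apply/stabilizesE.
rewrite -[invmx u]mulmx1; apply/flag_sub => //.
by apply: submx_rank le _; rewrite !rank_flag ?unitmx1.
Qed.

Lemma stabilizesM x u v : stabilizes x u -> stabilizes x v -> stabilizes x (u *m v).
Proof.
move=> /stabilizes_flag ux /stabilizes_flag vx; apply/stabilizes_flag.
rewrite flagM; apply: submx_trans (submxMr u^T vx) _.
by rewrite -flagM mulmx1.
Qed.

Lemma stabilizes1 x : stabilizes x (1%:M : 'M[k]_d).
Proof. by apply/stabilizes_flag. Qed.

Definition upper u : Prop := forall i j : 'I_d, (j < i)%N -> u i j = 0.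

Lemma upper_stabilizes u : upper u <-> forall x, (0 < x < d)%N -> stabilizes x u.
Proof.
split=> [uu x _ i j|us i j ji]; first by move=> /andP[jx xi]; apply: uu; apply: leq_trans xi.
by apply: (us i); rewrite ?ji ?leqnn // (leq_ltn_trans _ ji) //=.
Qed.

Lemma upper_diag u (i : 'I_d) : upper u -> u \in unitmx -> u i i != 0.
Proof.
move=> uu; rewrite unitmxE -det_tr det_trig ?unitfE; last first.
  by apply/is_trig_mxP => m j mj; rewrite mxE uu.
by rewrite prodf_seq_neq0 => /allP/(_ i); rewrite mem_index_enum mxE => /(_ isT).
Qed.

Lemma upper_unit u : upper u -> (forall i, u i i != 0) -> u \in unitmx.
Proof.
move=> uu ud; rewrite unitmxE -det_tr det_trig ?unitfE; last first.
  by apply/is_trig_mxP => m j mj; rewrite mxE uu.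
by rewrite prodf_seq_neq0; apply/allP => i _; rewrite mxE ud.
Qed.

Lemma upperV u : u \in unitmx -> upper u -> upper (invmx u).
Proof.
by move=> u_unit /upper_stabilizes us; apply/upper_stabilizes => x xd; apply: stabilizesV (us _ xd); lia.
Qed.

(* The letter x of S corresponds to the entry in row x and column x - 1, when
   rows and columns are numbered from 0. *)
Definition hess S u : Prop :=
  (forall i j : 'I_d, (j.+1 < i)%N -> u i j = 0) /\
  (forall i j : 'I_d, i = j.+1 :> nat -> (u i j != 0) = S i).

(** In a Hessenberg matrix the block to be annihilated has a single entry that may be nonzero, its
    corner in row x and column x - 1. *)
Lemma hess_stabilizes S u x : hess S u -> (0 < x < d)%N -> stabilizes x u <-> ~~ S x.
Proof.
move=> [u0 uS] xd; have xd' : (x < d)%N by lia. have x1d : (x.-1 < d)%N by lia.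
have /= <- := uS (Ordinal xd') (Ordinal x1d); last by rewrite /= prednK //; lia.
rewrite negbK; split=> [s|/eqP ux i j /andP[jx xi]]; first by rewrite s //=; lia.
have [ij|ij] := ltnP j.+1 i; first exact: u0.
by rewrite -ux; congr (u _ _); apply: ord_inj => /=; lia.
Qed.

Lemma hess_flag S a c : a \in unitmx ->
  hess S (invmx a *m c) <->
  (forall x, (x < d)%N -> (flag c x <= flag a x.+1)%MS) /\
  (forall x, (0 < x < d)%N -> (flag c x <= flag a x)%MS <-> ~~ S x).
Proof.
move=> a_unit; split=> [hs|[sub eq]].
  split=> x xd.
    by apply/flag_sub => // i j jx xi; apply: hs.1; apply: leq_ltn_trans xi; exact: jx.
  by rewrite flag_sub // -stabilizesE; apply: hess_stabilizes.
split=> [i j ji|i j ij].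
  have jd : (j.+1 < d)%N := ltn_trans ji (ltn_ord i).
  by have /flag_sub := sub j.+1 jd; apply => //.
have xd : (0 < i < d)%N by rewrite ltn_ord ij.
have Ei := eq i xd; rewrite flag_sub // -stabilizesE in Ei.
apply/idP/idP => [ne|Si].
  by apply: contraNT ne => /Ei s; apply/eqP; apply: s; rewrite ij ltnSn.
apply: contraL Si => /eqP u0; apply/Ei => i' j' /andP[ji ii].
have jd : (j < d)%N by [].
have [lt|ge] := ltnP j'.+1 i'.
  have j1d : (j'.+1 < d)%N := ltn_trans lt (ltn_ord i').
  by have /flag_sub := sub j'.+1 j1d; apply => //.
by rewrite -[RHS]u0; congr (_ _ _); apply: ord_inj; lia.
Qed.

Lemma hess_upperM S b u : b \in unitmx -> upper b -> hess S u -> hess S (b *m u).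
Proof.
move=> b_unit bu [u0 uS]; split=> i j ij.
  rewrite mxE big1 // => l _; have [li|il] := ltnP l i; first by rewrite bu ?mul0r.
  by rewrite u0 ?mulr0 // (leq_trans ij).
rewrite mxE (bigD1 i) //= big1 ?addr0 => [|l li].
  by rewrite mulf_eq0 negb_or upper_diag // uS.
have [lti|il] := ltnP l i; first by rewrite bu ?mul0r.
by rewrite u0 ?mulr0 // -ij ltn_neqAle il eq_sym andbT.
Qed.

Lemma hess_Mupper S b u : b \in unitmx -> upper b -> hess S u -> hess S (u *m b).
Proof.
move=> b_unit bu [u0 uS]; split=> i j ij.
  rewrite mxE big1 // => l _; have [jl|lj] := ltnP j l; first by rewrite bu ?mulr0.
  by rewrite u0 ?mul0r // (leq_ltn_trans _ ij).
rewrite mxE (bigD1 j) //= big1 ?addr0 => [|l lj].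
  by rewrite mulf_eq0 negb_or upper_diag // andbT uS.
have [jl|lej] := ltnP j l; first by rewrite bu ?mulr0.
by rewrite u0 ?mul0r // ij ltnS ltn_neqAle lej andbT.
Qed.

Lemma hess_pattern S : ~~ S 0%N -> hess S (perm_mx (pattern_perm d S) : 'M[k]_d).
Proof.
move=> S0; have ge (i : 'I_d) : (i <= (pattern_perm d S i).+1)%N.
  have [Si|nSi] := boolP (S i); last by rewrite leqW // pattern_perm_ge.
  by rewrite pattern_perm_letter ?leqSpred // lt0n; apply: contraTneq Si => ->.
split=> i j ij; rewrite !mxE.
  by rewrite (_ : (_ == _) = false) //; apply/eqP => E; have := ge i; rewrite E; lia.
have i0 : (0 < i)%N by rewrite ij.
have -> : S i = (pattern_perm d S i == j).
  have [Si|nSi] := boolP (S i).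
    by apply/esym/eqP/ord_inj; rewrite pattern_perm_letter // ij.
  apply/esym/negbTE/eqP => E.
  by have := pattern_perm_ge nSi; rewrite E; lia.
by case: (_ == j); rewrite ?oner_neq0 ?eqxx.
Qed.

(* The columns of b are e_j, or column j - 1 of u when j is a letter of S. *)
Lemma hess_bruhat S u : ~~ S 0%N -> u \in unitmx -> hess S u ->
  exists b b', [/\ b \in unitmx /\ upper b, b' \in unitmx /\ upper b' &
    u = b *m perm_mx (pattern_perm d S) *m b'].
Proof.
move=> S0 u_unit uh; have [u0 uS] := uh.
pose pr (j : 'I_d) : 'I_d := Ordinal (leq_ltn_trans (leq_pred j) (ltn_ord j)).
have S_gt0 (j : 'I_d) : S j -> (0 < j)%N by move=> Sj; rewrite lt0n; apply: contraTneq Sj => ->.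
pose b : 'M[k]_d := \matrix_(i, j) if S j then u i (pr j) else (i == j)%:R.
have b_upper : upper b.
  move=> i j ji; rewrite mxE; case: ifP => [Sj|_]; last by rewrite -val_eqE gtn_eqF.
  by rewrite u0 //= prednK // S_gt0.
have b_unit : b \in unitmx.
  apply: upper_unit => // i; rewrite mxE; case: ifP => [Si|_]; last by rewrite eqxx oner_neq0.
  by rewrite uS //= prednK // S_gt0.
pose w := pattern_perm d S; pose B' := invmx u *m b *m perm_mx w.
have B'_unit : B' \in unitmx by rewrite !unitmx_mul unitmx_inv u_unit b_unit unitmx_perm.
have B'_upper : upper B'.
  move=> i j ji; have -> : B' i j = (invmx u *m b) i ((w^-1)%g j).
    rewrite mxE (bigD1 ((w^-1)%g j)) //= big1 => [|l ne]; rewrite !mxE.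
      by rewrite permKV eqxx mulr1 addr0.
    by rewrite (_ : (w l == j) = false) ?mulr0 //; apply: contraNF ne => /eqP <-; rewrite permK.
  set l := (w^-1)%g j; have wl : w l = j by rewrite permKV.
  have [Sl|nSl] := boolP (S l).
    have lj : l = j.+1 :> nat.
      by rewrite -wl pattern_perm_letter // ?prednK ?S_gt0.
    have -> : (invmx u *m b) i l = (invmx u *m u) i j.
      rewrite !mxE; apply: eq_bigr => m _; rewrite mxE Sl; congr (_ * u _ _).
      by apply: ord_inj; rewrite /= lj.
    by rewrite mulVmx // mxE -val_eqE gtn_eqF.
  have lj : (l <= j)%N by rewrite -wl pattern_perm_ge.
  have -> : (invmx u *m b) i l = invmx u i l.
    rewrite mxE (bigD1 l) //= big1 => [|m ne]; rewrite mxE (negPf nSl) ?(negPf ne) ?mulr0 //.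
    by rewrite eqxx mulr1 addr0.
  (* j + 1 is not a letter: otherwise w would send both j + 1 and l to j, and l = j + 1 would be a
     letter. Hence u, and with it its inverse, stabilizes the span of the first j + 1 basis vectors,
     which contains e_l. *)
  have jd : (0 < j.+1 < d)%N by rewrite (leq_ltn_trans ji).
  have nSj : ~~ S j.+1.
    apply/negP => Sj; have [_ j1d] := andP jd; pose j1 := Ordinal j1d.
    have := pattern_perm_letter (S := S) (i := j1) Sj isT => /= w1.
    have : w j1 = w l by apply: ord_inj; rewrite wl.
    by move/perm_inj => E; move: nSl; rewrite -E Sj.
  have /hess_stabilizes := uh => /(_ _ jd)[_ /(_ nSj)] /stabilizesV.
  by move/(_ u_unit (ltnW (andP jd).2)); apply; rewrite ltnS lj.
exists b, (invmx B'); split; [by [] | by rewrite unitmx_inv; split; last exact: upperV |].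
by rewrite -[LHS](mulmxK B'_unit) /B' !mulmxA mulmxV // mul1mx.
Qed.

Lemma flag_of_chain (As : nat -> 'M[k]_d) :
    (forall i, (i <= d)%N -> \rank (As i) = i) ->
    (forall i, (i < d)%N -> (As i <= As i.+1)%MS) ->
  exists2 a, a \in unitmx & forall i, (i <= d)%N -> (flag a i :=: As i)%MS.
Proof.
move=> rA mA.
have mono i j : (i <= j)%N -> (j <= d)%N -> (As i <= As j)%MS.
  elim: j => [|j IH]; first by rewrite leqn0 => /eqP ->.
  rewrite leq_eqVlt => /predU1P[->//|ij] jd.
  by apply: submx_trans (IH ij (ltnW jd)) (mA _ jd).
have ex (i : 'I_d) : exists v : 'rV[k]_d, (v <= As i.+1)%MS && ~~ (v <= As i)%MS.
  have : ~~ (As i.+1 <= As i)%MS.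
    by apply/negP => /mxrankS; rewrite !rA ?(ltnW (ltn_ord i)) // ltnn.
  by case/row_subPn => r nr; exists (row r (As i.+1)); rewrite nr row_sub.
have [v vP] := choice ex.
pose a : 'M[k]_d := (\matrix_i v i)^T.
have flagE i x : row i (flag a x) = if (i < x)%N then v i else 0.
  apply/rowP => j; rewrite mxE pid_mx_mulE trmxK mxE.
  by case: ifP; rewrite ?mulr1n // mulr0n mxE.
have le x : (x <= d)%N -> (flag a x <= As x)%MS.
  move=> xd; apply/row_subP => i; rewrite flagE; case: ltnP => [ix|_]; last exact: sub0mx.
  by have /andP[vi _] := vP i; apply: submx_trans vi (mono _ _ ix xd).
have ge x : (x <= d)%N -> (As x <= flag a x)%MS.
  elim: x => [|x IH] xd.
    by have /eqP := rA 0%N xd; rewrite mxrank_eq0 => /eqP ->; exact: sub0mx.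
  have /andP[v1 v2] := vP (Ordinal xd).
  have sum : (As x.+1 <= As x + v (Ordinal xd))%MS.
    apply: submx_rank; first by rewrite addsmx_sub mA.
    by rewrite rank_add_line // (rA x.+1 xd) (rA x (ltnW xd)).
  apply: submx_trans sum _; rewrite addsmx_sub; apply/andP; split.
    by apply: submx_trans (IH (ltnW xd)) (flag_mono _ (leqnSn x)).
  by have := flagE (Ordinal xd) x.+1; rewrite /= ltnSn => <-; exact: row_sub.
exists a => [|i id]; last by apply/eqmxP; rewrite le ?ge.
rewrite -unitmx_tr -row_free_unit /row_free eqn_leq rank_leq_row /=.
rewrite -[X in (X <= _)%N](rA d (leqnn d)); apply: leq_trans (mxrankS (ge d (leqnn d))) _.
exact: mxrankM_maxr.
Qed.

End FlagMatrices.

(** * The Gram matrix of the pairing *)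

Section Gram.
Local Open Scope ring_scope.
Variables (F : fieldType) (k : closedFieldType) (iota : {rmorphism F -> k}) (q d : nat).
Variables (V1 V2 : vectType F) (B : V1 -> V2 -> F) (e1 : d.-tuple V1) (e2 : d.-tuple V2).
Hypotheses (B_perfect : perfect_pairing q B)
  (e1_basis : basis_of {:V1} e1) (e2_basis : basis_of {:V2} e2).

Local Notation G := (gram iota B e1 e2).

Lemma pairing_sumr (I : Type) (s : seq I) (c : I -> F) (v : I -> V2) x :
  B x (\sum_(j <- s) c j *: v j) = \sum_(j <- s) c j ^+ q * B x (v j).
Proof.
elim: s => [|j s IH]; last by rewrite !big_cons (pairing_semilinear_r B_perfect) IH.
have := pairing_semilinear_r B_perfect x 1 0 0; rewrite scale1r addr0 expr1n mul1r !big_nil.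
by move/eqP; rewrite -subr_eq0 opprD addNKr oppr_eq0 => /eqP.
Qed.

Lemma gram_unit : G \in unitmx.
Proof.
pose GF : 'M[F]_d := \matrix_(i, j) B (tnth e1 i) (tnth e2 j).
have -> : G = map_mx iota GF by apply/matrixP => i j; rewrite !mxE.
rewrite map_unitmx.
have dual (i : 'I_d) : exists y, forall x, coord e1 i x = B x y.
  have sc : scalar (coord e1 i) by move=> a u v; rewrite linearP.
  by have [y [yP _]] := pairing_perfect_r B_perfect sc; exists y.
have [y yP] := choice dual.
(* The inverse of the Gram matrix, from the dual basis y_i; the coordinates enter as q-th powers
   because [B] is q-semilinear in its second argument. *)
pose C : 'M[F]_d := \matrix_(j, i) coord e2 j (y i) ^+ q.
suff /mulmx1_unit[] : GF *m C = 1%:M by [].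
apply/matrixP => l i; rewrite !mxE.
have := yP i (tnth e1 l); rewrite (coord_basis e2_basis (memvf (y i))) pairing_sumr.
rewrite (tnth_nth 0) coord_free ?(basis_free e1_basis) // => ->.
by apply: eq_bigr => j _; rewrite !mxE mulrC !(tnth_nth 0).
Qed.

Lemma gram_triangular : orthogonal_flags B e1 e2 ->
  forall i j : 'I_d, (i + j + 2 <= d)%N -> G i j = 0.
Proof.
move=> flags i j ijd; rewrite mxE (_ : B _ _ = 0) ?rmorph0 //.
have [perp _] := flags j.+1 (ltn_ord j) (tnth e2 j).
have mem_take (T : eqType) (x0 : T) (s : seq T) m n : (m < n)%N -> (m < size s)%N ->
    nth x0 s m \in take n s.
  move=> mn ms; rewrite -(nth_take x0 mn); apply: mem_nth.
  by rewrite size_take; case: ifP.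
apply: perp; first by apply: memv_span; rewrite (tnth_nth 0) mem_take ?size_tuple.
by apply: memv_span; rewrite (tnth_nth 0) mem_take ?size_tuple //; lia.
Qed.

(** With D equal to c at i and 1 elsewhere, M E = D M with E diagonal makes the entries of D agree
    at all rows where column j of M is nonzero; taking c different from 0 and 1 leaves one such
    row. *)
Lemma diag_conj_inj (M : 'M[k]_d) : M \in unitmx ->
    (forall D : 'M[k]_d, D \in unitmx -> is_diag_mx D -> is_diag_mx (invmx M *m D *m M)) ->
  forall i i' j, M i j != 0 -> M i' j != 0 -> i = i'.
Proof.
move=> M_unit Mdiag i i' j Mi Mi'; apply/eqP; apply: contraT => ii'.
have /closed_nonrootP[c] : 'X * ('X - 1%:P) != 0 :> {poly k}.
  by rewrite mulf_neq0 // -?size_poly_eq0 ?size_polyX ?size_XsubC.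
rewrite rootE !hornerE mulf_eq0 negb_or subr_eq0 => /andP[c0 c1].
pose r : 'rV[k]_d := \row_l if l == i then c else 1.
have D_unit : diag_mx r \in unitmx.
  rewrite unitmxE det_diag unitfE prodf_seq_neq0; apply/allP => l _ /=; rewrite mxE.
  by case: ifP; rewrite ?oner_neq0.
have := Mdiag _ D_unit (diag_mx_is_diag r); set E := _ *m M => /is_diag_mxP Ediag.
have ME : M *m E = diag_mx r *m M by rewrite /E !mulmxA mulmxV // mul1mx.
have Er l : M l j != 0 -> E j j = r 0 l.
  move=> Ml; have := congr1 (fun A : 'M_d => A l j) ME; rewrite mul_diag_mx [LHS]mxE [RHS]mxE.
  rewrite (bigD1 j) //= big1 => [|m mj]; last by rewrite Ediag ?mulr0.
  by rewrite addr0 mulrC => /(mulIf Ml).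
have := Er _ Mi; rewrite (Er _ Mi') !mxE eqxx eq_sym (negPf ii') => c1'.
by rewrite -c1' eqxx in c1.
Qed.

(** Torus stability leaves one nonzero entry f(j) in each column j, and orthogonality of the flags
    gives f(j) + j >= d - 1. As f is onto, descending induction from j = d - 1 shows that it is the
    reversal. *)
Lemma gram_antidiag : (0 < q)%N -> orthogonal_flags B e1 e2 -> torus_stable iota q B e1 e2 ->
  forall i j : 'I_d, (G i j != 0) = (i == rev_ord j).
Proof.
move=> q0 flags Tst.
have col_inj : forall i i' j, G i j != 0 -> G i' j != 0 -> i = i'.
  apply: diag_conj_inj gram_unit _ => D D_unit Ddiag.
  have Dt : D^T = D.
    apply/matrixP => i j; rewrite mxE; have [->//|ne] := eqVneq i j.
    by rewrite !(is_diag_mxP Ddiag) // eq_sym.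
  have iD_diag : is_diag_mx (invmx D).
    have /is_diag_mxP D0 := Ddiag; apply/is_diag_mxP => i j ij.
    have Di0 : D i i != 0.
      apply/eqP => Di; move: (D_unit); rewrite -row_free_unit => /row_free_inj.
      move/(_ _ (delta_mx 0 i) 0) => E; have : (delta_mx 0 i : 'rV[k]_d) = 0.
        apply: E; rewrite mul0mx -rowE; apply/rowP => l; rewrite !mxE.
        by have [<-//|ne] := eqVneq i l; rewrite D0.
      by move/rowP/(_ i); rewrite !mxE !eqxx => /eqP; rewrite oner_eq0.
    have := congr1 (fun A : 'M_d => A i j) (mulmxV D_unit).
    rewrite !mxE (bigD1 i) //= big1 => [|l li]; last by rewrite D0 ?mul0r // eq_sym.
    have ne : i != j by rewrite -val_eqE.
    by rewrite addr0 (negPf ne) => /eqP; rewrite mulf_eq0 (negPf Di0) => /eqP.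
  (* The second component of the image of (D^-1, 1) is the q-th power of the conjugate G^-1 D G, and
     a q-th power vanishes only at 0. *)
  have [|_ [_]] := Tst (invmx D, 1%:M).
    by split; [split; rewrite /= ?unitmx_inv ?unitmx1 | split=> //; apply: scalar_mx_is_diag].
  rewrite /= invmxK /adjoint1 Dt => /is_diag_mxP Hd; apply/is_diag_mxP => i j ij.
  by have := Hd i j ij; rewrite mxE => /eqP; rewrite expf_eq0 q0 /= => /eqP.
have col_nz j : exists i, G i j != 0.
  apply: contrapT => nex; have := gram_unit; rewrite -unitmx_tr -row_free_unit => /row_free_inj.
  move/(_ _ (delta_mx 0 j) 0) => E; have : (delta_mx 0 j : 'rV[k]_d) = 0.
    apply: E; rewrite mul0mx -rowE; apply/rowP => l; rewrite [LHS]mxE [LHS]mxE [RHS]mxE.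
    by apply/eqP; apply: contraT => ne; case: nex; exists l.
  by move/rowP/(_ j); rewrite !mxE !eqxx => /eqP; rewrite oner_eq0.
have [f fP] := choice col_nz.
have f_ge j : (f j + j + 1 >= d)%N.
  rewrite leqNgt; apply: contra (fP j) => lt; apply/eqP; apply: gram_triangular => //; lia.
have f_surj i : exists j, f j = i.
  apply: contrapT => nex; have := gram_unit; rewrite -row_free_unit => /row_free_inj.
  move/(_ _ (delta_mx 0 i) 0) => E; have : (delta_mx 0 i : 'rV[k]_d) = 0.
    apply: E; rewrite mul0mx -rowE; apply/rowP => l; rewrite [LHS]mxE [RHS]mxE.
    apply/eqP; apply: contraT => ne; case: nex; exists l; exact: col_inj (fP l) ne.
  by move/rowP/(_ i); rewrite !mxE !eqxx => /eqP; rewrite oner_eq0.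
have fE n : forall j : 'I_d, (d - j <= n)%N -> f j = rev_ord j.
  elim: n => [|n IH] j jn; first by have := ltn_ord j; lia.
  have [j' fj'] := f_surj (rev_ord j).
  have jd := ltn_ord j; have j'd := ltn_ord j'.
  have jj' : (j <= j')%N by have := f_ge j'; rewrite fj' /=; lia.
  have [lt|] := ltnP j j'; last by move=> j'j; rewrite -fj'; congr f; apply: ord_inj; lia.
  have : f j' = rev_ord j' by apply: IH; lia.
  by rewrite fj' => /rev_ord_inj e; rewrite e ltnn in lt.
move=> i j; apply/idP/eqP => [Gij|->]; first by rewrite -(fE _ j (leqnn _)); exact: col_inj Gij (fP j).
by rewrite -(fE _ j (leqnn _)).
Qed.
End Gram.

(** * Fine Deligne-Lusztig varieties *)

Section GroupPairs.
Local Open Scope ring_scope.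
Variables (k : closedFieldType) (d : nat).
Implicit Types (g p : mxpair k d) (J : {set weyl d}).

Lemma invmx_mul (A B : 'M[k]_d) : A \in unitmx -> B \in unitmx ->
  invmx (A *m B) = invmx B *m invmx A.
Proof.
move=> A_unit B_unit; have AB_unit : A *m B \in unitmx by rewrite unitmx_mul A_unit.
by rewrite -[RHS](mulmxK AB_unit) !mulmxA mulmxKV // mulVmx // mul1mx.
Qed.

Lemma mulGA g1 g2 g3 : mulG g1 (mulG g2 g3) = mulG (mulG g1 g2) g3.
Proof. by rewrite /mulG /= !mulmxA. Qed.

Lemma GG_mul g p : GG g -> GG p -> GG (mulG g p).
Proof. by move=> [g1 g2] [p1 p2]; split; rewrite /= unitmx_mul ?g1 ?g2. Qed.

Lemma GG_inv g : GG g -> GG (invG g).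
Proof. by move=> [g1 g2]; split; rewrite /= unitmx_inv. Qed.

Lemma mulGK g p : GG p -> mulG (mulG g p) (invG p) = g.
Proof. by case: g => g1 g2 [p1 p2]; rewrite /mulG /= !mulmxK. Qed.

Lemma mulGKV g p : GG p -> mulG (mulG g (invG p)) p = g.
Proof. by case: g => g1 g2 [p1 p2]; rewrite /mulG /= !mulmxKV. Qed.

Lemma mulKG g p : GG g -> mulG (invG g) (mulG g p) = p.
Proof. by case: p => p1 p2 [g1 g2]; rewrite /mulG /= !mulKmx. Qed.

Lemma mulKVG g p : GG g -> mulG g (mulG (invG g) p) = p.
Proof. by case: p => p1 p2 [g1 g2]; rewrite /mulG /= !mulKVmx. Qed.

Lemma invG_mul g p : GG g -> GG p -> invG (mulG g p) = mulG (invG p) (invG g).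
Proof. by move=> [g1 g2] [p1 p2]; rewrite /invG /mulG /= !invmx_mul. Qed.

Lemma parabolic_GG J p : parabolic J p -> GG p.
Proof. by case. Qed.

Lemma parabolic_mul J g p : parabolic J g -> parabolic J p -> parabolic J (mulG g p).
Proof.
move=> [gG gs] [pG ps]; split; first exact: GG_mul.
by move=> x xd; have [g1 g2] := gs x xd; have [p1 p2] := ps x xd; split=> nJ; apply: stabilizesM; auto.
Qed.

Lemma parabolic_inv J p : parabolic J p -> parabolic J (invG p).
Proof.
move=> [[p1 p2] ps]; split; first exact: GG_inv.
move=> x xd; have [s1 s2] := ps x xd; have xd' : (x <= d)%N by lia.
by split=> nJ; apply: stabilizesV => //; auto.
Qed.

Lemma parabolic1 J : parabolic J ((1%:M, 1%:M) : mxpair k d).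
Proof. by split; [split; exact: unitmx1 | split=> _; exact: stabilizes1]. Qed.

Lemma coset_eq J g g' : GG g -> GG g' -> Defs.coset J g = Defs.coset J g' ->
  exists2 p, parabolic J p & g' = mulG g p.
Proof.
move=> gG g'G E; have : Defs.coset J g' g'.
  exists (1%:M, 1%:M); first exact: parabolic1.
  by case: g' {g'G E} => a b; rewrite /mulG /= !mulmx1.
by rewrite -E => -[p pJ <-]; exists p.
Qed.

Lemma coset_mul J g p : parabolic J p -> Defs.coset J (mulG g p) = Defs.coset J g.
Proof.
move=> pJ; apply/seteqP; split=> x [p' p'J <-].
  by exists (mulG p p'); [exact: parabolic_mul | rewrite mulGA].
exists (mulG (invG p) p'); first exact: parabolic_mul (parabolic_inv pJ) p'J.
by rewrite mulGA mulGK //; exact: parabolic_GG pJ.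
Qed.

Lemma flag_cosetP J (c : flag_variety k J) : exists2 g, GG g & flag_coset c = Defs.coset J g.
Proof. by case: c => A AP /=; have := set_mem AP => -[g gG <-]; exists g. Qed.

Definition to_flag J g (gG : GG g) : flag_variety k J :=
  exist _ (Defs.coset J g) (mem_set (imageP (Defs.coset J) gG)).

Lemma borelE g : borel g <-> GG g /\ upper g.1 /\ upper g.2.
Proof.
split=> [[gG gs]|[gG [/upper_stabilizes u1 /upper_stabilizes u2]]].
  by split=> //; split; apply/upper_stabilizes => x xd; have [s1 s2] := gs x xd;
    [apply: s1 | apply: s2]; rewrite finset.in_set0.
by split=> // x xd; split=> _; [exact: u1 | exact: u2].
Qed.

Lemma bruhat_cell_hess (S S' : pred nat) g : ~~ S 0%N -> ~~ S' 0%N ->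
  bruhat_cell (pattern_perm d S, pattern_perm d S') g <->
  [/\ GG g, hess S g.1 & hess S' g.2].
Proof.
move=> S0 S'0; split=> [[b [b' [/borelE[bG [b1 b2]] [/borelE[b'G [b'1 b'2]] ->]]]]|].
  have [b1u b2u] := bG; have [b'1u b'2u] := b'G; split.
  - by apply: GG_mul => //; apply: GG_mul => //; split; exact: unitmx_perm.
  - by apply: hess_Mupper => //; apply: hess_upperM => //; exact: hess_pattern.
  - by apply: hess_Mupper => //; apply: hess_upperM => //; exact: hess_pattern.
case: g => u v [[/= uG vG] hu hv].
have [b1 [b1' [[b1G b1u] [b1'G b1'u] uE]]] := hess_bruhat S0 uG hu.
have [b2 [b2' [[b2G b2u] [b2'G b2'u] vE]]] := hess_bruhat S'0 vG hv.
exists (b1, b2), (b1', b2'); split; first by apply/borelE.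
by split; [apply/borelE | rewrite {1}uE {1}vE].
Qed.

End GroupPairs.

Section Frobenius.
Local Open Scope ring_scope.
Variables (F : fieldType) (k : closedFieldType) (iota : {rmorphism F -> k}) (q d : nat).
Variables (V1 V2 : vectType F) (B : V1 -> V2 -> F) (e1 : d.-tuple V1) (e2 : d.-tuple V2).
Variable sq : {rmorphism k -> k}.
Hypothesis sqE : forall x, sq x = x ^+ q.

Local Notation G := (gram iota B e1 e2).
Local Notation Phi := (Phi iota q B e1 e2).

Hypotheses (G_unit : G \in unitmx) (G_anti : forall i j : 'I_d, (G i j != 0) = (i == rev_ord j))
  (G_rational : map_mx sq (map_mx sq G) = G).

Lemma frob_mxE m n (A : 'M[k]_(m, n)) : frob_mx q A = map_mx sq A.
Proof. by apply/matrixP => i j; rewrite !mxE sqE. Qed.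

(* Phi g = (twist g.2^-1, _): an element of the second factor becomes an
   endomorphism of V1, and a flag of V2 becomes its orthogonal in V1. *)
Definition twist (v : 'M[k]_d) : 'M[k]_d := adjoint2 iota B e1 e2 (map_mx sq v).

Lemma twistM u v : twist (u *m v) = twist v *m twist u.
Proof.
rewrite /twist /adjoint2 map_mxM -trmx_mul; congr (_^T).
by rewrite !mulmxA mulmxKV.
Qed.

Lemma twist1 : twist 1%:M = 1%:M.
Proof. by rewrite /twist map_mx1 /adjoint2 mulmx1 mulmxV // trmx1. Qed.

Lemma twist_unit v : (twist v \in unitmx) = (v \in unitmx).
Proof.
by rewrite /twist /adjoint2 unitmx_tr !unitmx_mul G_unit unitmx_inv G_unit map_unitmx andbT.
Qed.

Lemma twistV v : v \in unitmx -> twist (invmx v) = invmx (twist v).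
Proof.
move=> v_unit; have tv_unit : twist v \in unitmx by rewrite twist_unit.
by rewrite -[LHS](mulmxK tv_unit) -twistM mulmxV // twist1 mul1mx.
Qed.

Lemma twist_surj M : (1 < q)%N -> exists v, twist v = M.
Proof.
move=> q_gt1; have [v vE] := map_power_surj q_gt1 sqE (invmx G *m M^T *m G).
by exists v; rewrite /twist vE /adjoint2 !mulmxA mulmxV // mul1mx mulmxK // trmxK.
Qed.

(** Conjugation by an antidiagonal matrix followed by transposition reflects the entries in the
    antidiagonal, up to nonzero factors and q-th powers. *)
Lemma twist_eq0 v i j : (twist v i j == 0) = (v (rev_ord j) (rev_ord i) == 0).
Proof.
have G0 a b : b != rev_ord a -> G a b = 0.
  move=> ne; apply/eqP; apply: contraTT isT; rewrite G_anti => /eqP ab; move: ne.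
  by rewrite ab rev_ordK eqxx.
pose c a := G a (rev_ord a).
have c0 a : c a != 0 by rewrite G_anti rev_ordK.
pose M : 'M[k]_d := \matrix_(a, b) (c a * sq (v (rev_ord a) (rev_ord b)) / c b).
have MG : M *m G = G *m map_mx sq v.
  apply/matrixP => a b; rewrite mxE [RHS]mxE.
  rewrite (bigD1 (rev_ord b)) //= [X in _ + X]big1 => [|l lb]; last first.
    by rewrite [G l b]G0 ?mulr0 //; apply: contra lb => /eqP ->; rewrite rev_ordK.
  rewrite [RHS](bigD1 (rev_ord a)) //= [X in _ = _ + X]big1 => [|l la]; last first.
    by rewrite [G a l]G0 ?mul0r.
  rewrite !addr0 !mxE rev_ordK.
  have -> : iota (B (tnth e1 (rev_ord b)) (tnth e2 b)) = c (rev_ord b) by rewrite /c rev_ordK mxE.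
  have -> : iota (B (tnth e1 a) (tnth e2 (rev_ord a))) = c a by rewrite /c mxE.
  by rewrite divfK.
have -> : twist v i j = M j i.
  by rewrite /twist /adjoint2 -MG mulmxK // mxE.
by rewrite mxE !mulf_eq0 invr_eq0 !(negPf (c0 _)) orbF fmorph_eq0.
Qed.

Lemma block_zero_twist x y v : (x <= d)%N -> (y <= d)%N ->
  block_zero x y (twist v) <-> block_zero (d - y) (d - x) v.
Proof.
move=> xd yd; split=> b i j ji ij; have id := ltn_ord i; have jd := ltn_ord j.
  apply/eqP; rewrite -[i]rev_ordK -[j]rev_ordK -twist_eq0; apply/eqP.
  by apply: b => /=; lia.
by apply/eqP; rewrite twist_eq0; apply/eqP; apply: b => /=; lia.
Qed.

(** The reflection in the antidiagonal moves the subdiagonal entry (x, x - 1) to (d - x, d - x -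
    1). *)
Lemma hess_twist (S : pred nat) v : hess (fun x => S (d - x)%N) v <-> hess S (twist v).
Proof.
split=> -[v0 vS]; split=> i j ij; have id := ltn_ord i; have jd := ltn_ord j.
- by apply/eqP; rewrite twist_eq0; apply/eqP; apply: v0 => /=; lia.
- by rewrite twist_eq0 vS /=; [congr S; lia | lia].
- apply/eqP; rewrite -[i]rev_ordK -[j]rev_ordK -twist_eq0; apply/eqP.
  by apply: v0 => /=; lia.
rewrite -[i in LHS]rev_ordK -[j in LHS]rev_ordK -twist_eq0 vS /=; last by lia.
by congr S; lia.
Qed.

Local Notation sg := (sq \o sq).

Definition flag2 (g : mxpair k d) := twist (invmx g.2).

Lemma Phi1E g : (Phi g).1 = flag2 g.
Proof. by rewrite /= frob_mxE. Qed.

(** The two adjoints cancel because the Gram matrix is fixed by the q^2-Frobenius; two successive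
    q-th powers remain. *)
Lemma twist_Phi2 g : twist (Phi g).2 = map_mx sg (invmx g.1).
Proof.
rewrite /= frob_mxE /twist /adjoint2 /adjoint1 !map_mxM !map_invmx !G_rational -!map_trmx.
rewrite !mulmxA mulmxV // mul1mx mulmxK //.
by rewrite trmxK !map_invmx -map_mx_comp.
Qed.

Definition lang g := mulG (invG g) (Phi g).

Lemma lang1 g : (lang g).1 = invmx g.1 *m flag2 g.
Proof. by rewrite -Phi1E. Qed.

Lemma twist_lang2 g : twist (lang g).2 = invmx (map_mx sg g.1) *m flag2 g.
Proof. by rewrite twistM twist_Phi2 map_invmx. Qed.

Lemma Phi_GG g : GG g -> GG (Phi g).
Proof.
move=> [g1 g2]; split; first by rewrite Phi1E /flag2 twist_unit unitmx_inv.
by rewrite -twist_unit twist_Phi2 map_unitmx unitmx_inv.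
Qed.

Lemma Phi_mul g p : GG g -> GG p -> Phi (mulG g p) = mulG (Phi g) (Phi p).
Proof.
move=> [g1 g2] [p1 p2]; rewrite [LHS]surjective_pairing [RHS]surjective_pairing.
congr pair.
  by rewrite -[RHS]/((Phi g).1 *m (Phi p).1) !Phi1E /flag2 -twistM -invmx_mul.
rewrite /= !frob_mxE -map_mxM /adjoint1 invmx_mul // trmx_mul; congr map_mx.
by rewrite !mulmxA mulmxK.
Qed.

Lemma lang_GG g : GG g -> GG (lang g).
Proof. by move=> gG; apply: GG_mul; [exact: GG_inv | exact: Phi_GG]. Qed.

Lemma lang_mul g p : GG g -> GG p ->
  lang (mulG g p) = mulG (mulG (invG p) (lang g)) (Phi p).
Proof. by move=> gG pG; rewrite /lang Phi_mul // invG_mul // !mulGA. Qed.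

(* As x .Phi y = x y Phi(x)^-1 and g^-1 Phi(g) turns into p^-1 g^-1 Phi(g) Phi(p)
   when g is replaced by g p, one may take p = 1. *)
Lemma fine_DL_hess (J : {set weyl d}) (S S' : pred nat) (c : flag_variety k J) :
    ~~ S 0%N -> ~~ S' 0%N ->
  fine_DL iota q B e1 e2 J (pattern_perm d S, pattern_perm d S') c <->
  exists2 g, GG g & flag_coset c = Defs.coset J g /\
    hess S (lang g).1 /\ hess S' (lang g).2.
Proof.
move=> S0 S'0; split=> [[g gG [cE [p [y [pJ [yw yE]]]]]]|[g gG [cE [h1 h2]]]].
  have pG := parabolic_GG pJ; have [yG y1 y2] := (bruhat_cell_hess y S0 S'0).1 yw.
  exists (mulG g p); first exact: GG_mul.
  rewrite coset_mul //; split=> //.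
  suff -> : lang (mulG g p) = y by [].
  rewrite lang_mul // /lang yE -!mulGA mulKG // mulGA mulGKV //; last exact: Phi_GG.
exists g => //; split=> //; exists (1%:M, 1%:M), (lang g); split; first exact: parabolic1.
split; first by apply/bruhat_cell_hess => //; split=> //; exact: lang_GG.
have P1 : Phi (1%:M, 1%:M) = (1%:M, 1%:M).
  by rewrite /Defs.Phi /= !frob_mxE !invmx1 /adjoint1 trmx1 mulmx1 mulVmx // -/(twist _) twist1 map_mx1.
rewrite P1 -/(lang g); case: (lang g) => u v.
by rewrite /mulG /invG /= invmx1 !mul1mx !mulmx1.
Qed.

End Frobenius.

(** * Deforming a point along its Lang image *)

Section Density.
Local Open Scope ring_scope.
Variables (F : fieldType) (k : closedFieldType) (iota : {rmorphism F -> k}) (q d : nat).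
Variables (V1 V2 : vectType F) (B : V1 -> V2 -> F) (e1 : d.-tuple V1) (e2 : d.-tuple V2).
Variable sq : {rmorphism k -> k}.
Hypotheses (q_gt1 : (1 < q)%N) (sqE : forall x, sq x = x ^+ q) (q0 : q%:R = 0 :> k).

Local Notation G := (gram iota B e1 e2).
Local Notation Phi := (Phi iota q B e1 e2).
Local Notation lang := (lang iota q B e1 e2).
Local Notation fl2 := (flag2 iota B e1 e2 sq).
Local Notation sg := (sq \o sq).

Hypotheses (G_unit : G \in unitmx) (G_anti : forall i j : 'I_d, (G i j != 0) = (i == rev_ord j))
  (G_rational : map_mx sq (map_mx sq G) = G).

Let GT_unit : G^T \in unitmx. Proof. by rewrite unitmx_tr. Qed.

Lemma flag2E g : fl2 g = invmx G^T *m (map_mx sq (invmx g.2))^T *m G^T.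
Proof. by rewrite /flag2 /twist /adjoint2 !trmx_mul trmx_inv mulmxA. Qed.

(* Coordinates in which g |-> Phi(g) = g m becomes the semilinear system
   X^(q) = X L. *)
Definition lang_coord (g : mxpair k d) : 'M[k]_(d, d + d) :=
  row_mx (G^T *m g.1) (invmx g.2)^T.

(** The equations cross over: the q-th powers of the coordinates of g.1 are linear in those of
    g.2^-1 and conversely, so the matrix of the system has zero diagonal blocks. *)
Lemma lang_coordP g m1 m2 : GG g -> m2 \in unitmx ->
  lang g = (m1, m2) <-> map_mx sq (lang_coord g) = lang_coord g *m
    block_mx 0 (m1 *m invmx G^T) ((invmx m2)^T *m (map_mx sq G)^T) 0.
Proof.
move=> gG m2_unit; have [g1 g2] := gG.
rewrite /lang_coord map_row_mx mul_row_block !mulmx0 add0r addr0.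
have Y_unit : map_mx sq G \in unitmx by rewrite map_unitmx.
have E1 : (lang g).1 = m1 <->
    map_mx sq (invmx g.2)^T = G^T *m g.1 *m (m1 *m invmx G^T).
  rewrite (lang1 iota B e1 e2 sqE) flag2E map_trmx; split=> [<-|->].
    by rewrite !mulmxA mulmxK // -[_ *m g.1 *m _]mulmxA mulmxV // mulmx1 mulmxV // mul1mx.
  by rewrite !mulmxA !mulmxKV // mulVmx // mul1mx.
have E2 : (lang g).2 = m2 <->
    map_mx sq (G^T *m g.1) = (invmx g.2)^T *m ((invmx m2)^T *m (map_mx sq G)^T).
  have -> : (lang g).2 = invmx g.2 *m (invmx (map_mx sq G) *m (invmx (map_mx sq g.1))^T *m map_mx sq G).
    by rewrite /= (frob_mxE sqE) /adjoint1 !map_mxM !map_invmx -map_trmx map_invmx.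
  have -> : map_mx sq (G^T *m g.1) = ((map_mx sq g.1)^T *m map_mx sq G)^T.
    by rewrite map_mxM trmx_mul trmxK map_trmx.
  rewrite -!trmx_mul; have A_unit : map_mx sq g.1 \in unitmx by rewrite map_unitmx.
  move: (map_mx sq G) (map_mx sq g.1) Y_unit A_unit => Y A Y_unit A_unit.
  have AT_unit : A^T \in unitmx by rewrite unitmx_tr.
  rewrite trmx_inv; split=> [<-|/trmx_inj E].
    rewrite !invmx_mul ?invmxK ?unitmx_mul ?unitmx_inv ?Y_unit ?AT_unit //; congr (_^T).
    by rewrite !mulmxA mulmxV // mul1mx mulmxK.
  have -> : m2 = invmx (invmx Y *m (A^T *m Y) *m g.2).
    by rewrite E !mulmxA mulVmx // mul1mx mulmxKV // invmxK.
  by rewrite !invmx_mul ?invmxK ?unitmx_mul ?unitmx_inv ?Y_unit ?AT_unit // !mulmxA.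
split=> [E|/eq_row_mx[e2' e1']].
  by have [e1' _] := E1; have [e2' _] := E2; rewrite e1' ?e2' // E.
by rewrite [lang g]surjective_pairing (E1.2 e1') (E2.2 e2').
Qed.

Definition of_lang_coord (X : 'M[k]_(d, d + d)) : mxpair k d :=
  (invmx G^T *m lsubmx X, invmx (rsubmx X)^T).

Lemma lang_coordK g : GG g -> of_lang_coord (lang_coord g) = g.
Proof.
case: g => u v [/= u_unit v_unit].
by rewrite /of_lang_coord /lang_coord row_mxKl row_mxKr mulKmx // trmxK invmxK.
Qed.

Lemma of_lang_coordK X : rsubmx X \in unitmx -> lang_coord (of_lang_coord X) = X.
Proof. by move=> X2; rewrite /lang_coord /= mulKVmx // invmxK trmxK hsubmxK. Qed.

Lemma polymx_sub : polymx (fun (X : 'M[k]_(d, d + d)) i => mxvec X 0 i) lsubmx /\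
  polymx (fun (X : 'M[k]_(d, d + d)) i => mxvec X 0 i) rsubmx.
Proof.
have pid := @polymx_id k d (d + d).
split=> i j; [have := pid i (lshift d j) | have := pid i (rshift d j)];
  by apply: eq_polyfun => X; rewrite mxE.
Qed.

(* Clearing the powers of det(g.2^-1) in the denominators. *)
Lemma meval_lang_coord (f : mpoly.mpoly (d * d + d * d) k) :
  exists M (P : 'M[k]_(d, d + d) -> k), mxpolyfun P /\ forall X, rsubmx X \in unitmx ->
    P X = \det (rsubmx X) ^+ M * mpoly.meval (coordinates (of_lang_coord X)) f.
Proof.
have [pl pr] := polymx_sub; have pdet := polyfun_det pr.
apply: (@meval_closed k _ _ (fun X => coordinates (of_lang_coord X)) (fun phi => exists M
    (P : 'M[k]_(d, d + d) -> k), mxpolyfun P /\ forall X, rsubmx X \in unitmx ->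
    P X = \det (rsubmx X) ^+ M * phi X)).
- by move=> u v uv [M [P [pP PE]]]; exists M, P; split=> // X X2; rewrite PE // uv.
- move=> c; exists 0%N, (fun=> c); split; first exact: polyfun_const.
  by move=> X _; rewrite mul1r.
- move=> u v [M [P [pP PE]]] [M' [P' [pP' PE']]]; exists (M + M')%N.
  exists (fun X => \det (rsubmx X) ^+ M' * P X + \det (rsubmx X) ^+ M * P' X); split.
    by apply: polyfunD; apply: polyfunM => //; apply: polyfunX.
  move=> X X2; rewrite PE // PE' // mulrDr !mulrA exprD; congr (_ * _ + _).
  by rewrite mulrC.
- move=> u v [M [P [pP PE]]] [M' [P' [pP' PE']]]; exists (M + M')%N.
  exists (fun X => P X * P' X); split; first exact: polyfunM.
  by move=> X X2; rewrite PE // PE' // exprD mulrACA.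
move=> i; rewrite /coordinates; case: (splitP i) => j /= ij.
  have -> : i = lshift (d * d) j by apply: ord_inj.
  case/mxvec_indexP: j {i ij} => a b; exists 0%N, (fun X => (invmx G^T *m lsubmx X) a b).
  split; first exact: (polymxM (polymx_const _ _) pl).
  by move=> X _; rewrite mul1r row_mxEl mxvecE.
have -> : i = rshift (d * d) j by apply: ord_inj.
case/mxvec_indexP: j {i ij} => a b; exists 1%N, (fun X => (\adj (rsubmx X)^T) a b).
split; first exact: (polymx_adj (polymx_tr pr)).
move=> X X2; rewrite row_mxEr mxvecE /invmx unitmx_tr X2 [X in _ = _ * X]mxE det_tr expr1 mulVKf //.
by move: X2; rewrite unitmxE unitfE.
Qed.

Lemma lang_density g0 (U1 U2 : 'M[k]_d) (f : mpoly.mpoly (d * d + d * d) k) :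
    GG g0 -> mpoly.meval (coordinates g0) f != 0 ->
  exists2 t, t != 0 & exists2 g, GG g & mpoly.meval (coordinates g) f != 0 /\
    lang g = ((lang g0).1 + t *: U1, (lang g0).2 + t *: U2).
Proof.
move=> g0G f0; have [M [P [pP PE]]] := meval_lang_coord f.
have [m1_unit m2_unit] := lang_GG sqE G_unit G_rational g0G.
have [pl pr] := polymx_sub.
set m1 := (lang g0).1 in m1_unit *; set m2 := (lang g0).2 in m2_unit *.
pose path (m U : 'M[k]_d) : 'M[{poly k}]_d := map_mx polyC m + 'X *: map_mx polyC U.
have pathE m U t : map_mx (horner_eval t) (path m U) = m + t *: U.
  by apply/matrixP => i j; rewrite !mxE /horner_eval !hornerE.
pose delta := \det (path m2 U2).
have deltaE t : delta.[t] = \det (m2 + t *: U2).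
  by rewrite -(pathE m2 U2) det_map_mx.
(* delta times the matrix of [lang_coordP] along the path: delta is the determinant of m2 + t U2,
   and the adjugate stands for delta times its inverse. *)
pose N : 'M[{poly k}]_(d + d) := block_mx 0 (delta *: (path m1 U1 *m map_mx polyC (invmx G^T)))
  ((\adj (path m2 U2))^T *m map_mx polyC (map_mx sq G)^T) 0.
have evC (A : 'M[k]_d) t : map_mx (horner_eval t) (map_mx polyC A) = A.
  by apply/matrixP => i j; rewrite !mxE /horner_eval hornerC.
have NE t : delta.[t] != 0 -> map_mx (horner_eval t) N = delta.[t] *:
    block_mx 0 ((m1 + t *: U1) *m invmx G^T) ((invmx (m2 + t *: U2))^T *m (map_mx sq G)^T) 0.
  move=> dt; rewrite map_block_mx !map_mx0 map_mxZ !map_mxM -map_trmx map_mx_adj !pathE !evC.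
  rewrite scale_block_mx !scaler0; congr block_mx.
  have m2t_unit : m2 + t *: U2 \in unitmx by rewrite unitmxE unitfE -deltaE.
  by rewrite /invmx m2t_unit scalemxAl linearZ /= scalerA -deltaE divff // scale1r.
have d0 : delta.[0] != 0 by rewrite deltaE scale0r addr0 -unitfE -unitmxE.
have N0_unit : map_mx (horner_eval 0) N \in unitmx.
  rewrite NE // unitmxZ ?unitfE // !scale0r !addr0.
  have Y_unit : map_mx sq G \in unitmx by rewrite map_unitmx.
  set C1 := m1 *m _; set C2 := _ *m (map_mx sq G)^T.
  have C1_unit : C1 \in unitmx by rewrite unitmx_mul m1_unit unitmx_inv.
  have C2_unit : C2 \in unitmx by rewrite unitmx_mul !unitmx_tr unitmx_inv m2_unit.
  suff /mulmx1_unit[] : block_mx 0 C1 C2 0 *m block_mx 0 (invmx C2) (invmx C1) 0 = 1%:M by [].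
  rewrite mulmx_block !mul0mx !mulmx0 !addr0 !add0r !mulmxV //.
  by rewrite [RHS]scalar_mx_block.
have fib0 : fiber sq delta N 0 (lang_coord g0).
  rewrite /fiber NE // !scale0r !addr0 -scalemxAr; congr (_ *: _).
  by apply/lang_coordP => //; rewrite [LHS]surjective_pairing.
(* The two determinants ensure that a solution X with [h X != 0] comes from an element of the
   group. *)
pose h X := \det (lsubmx X) * \det (rsubmx X) * P X.
have ph : mxpolyfun h by apply: polyfunM pP; apply: polyfunM; apply: polyfun_det.
have h0 : h (lang_coord g0) != 0.
  have [g01 g02] := g0G.
  have r0 : rsubmx (lang_coord g0) \in unitmx by rewrite row_mxKr unitmx_tr unitmx_inv.
  have l0 : lsubmx (lang_coord g0) \in unitmx by rewrite row_mxKl unitmx_mul GT_unit.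
  rewrite /h PE // lang_coordK //.
  by move: r0 l0; rewrite !unitmxE !unitfE => r0 l0; rewrite !mulf_neq0 // expf_neq0.
have [e e0 eP] := fiber_density q_gt1 sqE q0 d0 N0_unit fib0 ph h0.
have /closed_nonrootP[t] : e * delta * 'X != 0.
  rewrite !mulf_neq0 ?polyX_eq0 //; apply: contraNneq d0 => ->; by rewrite horner0.
rewrite rootE !hornerE !mulf_eq0 !negb_or => /andP[/andP[et dt] t0].
have [X fX hX] := eP t et; exists t => //.
move: hX; rewrite /h !mulf_eq0 !negb_or => /andP[/andP[X1 X2] PX].
have X1_unit : lsubmx X \in unitmx by rewrite unitmxE unitfE.
have X2_unit : rsubmx X \in unitmx by rewrite unitmxE unitfE.
have gG : GG (of_lang_coord X).
  by split; rewrite /= ?unitmx_mul ?unitmx_inv ?unitmx_tr ?G_unit ?X1_unit ?X2_unit.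
exists (of_lang_coord X) => //; split.
  by move: PX; rewrite PE // mulf_eq0 negb_or => /andP[].
apply/lang_coordP => //; first by rewrite unitmxE unitfE -deltaE.
rewrite of_lang_coordK //; move: fX; rewrite /fiber NE // -scalemxAr.
by apply: scalerI.
Qed.

End Density.

(** * A closed incidence locus *)

Section Locus.
Local Open Scope ring_scope.
Variables (F : fieldType) (k : closedFieldType) (iota : {rmorphism F -> k}) (q d : nat).
Variables (V1 V2 : vectType F) (B : V1 -> V2 -> F) (e1 : d.-tuple V1) (e2 : d.-tuple V2).
Variable sq : {rmorphism k -> k}.
Hypotheses (q_gt1 : (1 < q)%N) (sqE : forall x, sq x = x ^+ q).

Local Notation G := (gram iota B e1 e2).
Local Notation lang := (lang iota q B e1 e2).
Local Notation tw := (twist iota B e1 e2 sq).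
Local Notation fl2 := (flag2 iota B e1 e2 sq).
Local Notation sg := (sq \o sq).

Hypotheses (G_unit : G \in unitmx) (G_anti : forall i j : 'I_d, (G i j != 0) = (i == rev_ord j))
  (G_rational : map_mx sq (map_mx sq G) = G).

Lemma adjE (A : 'M[k]_d) : A \in unitmx -> \adj A = \det A *: invmx A.
Proof.
move=> A_unit; rewrite /invmx A_unit scalerA divff ?scale1r //.
by rewrite -unitfE -unitmxE.
Qed.

Lemma polymx_coordinates :
  polymx (@coordinates k d) (fun g => g.1) /\ polymx (@coordinates k d) (fun g => g.2).
Proof.
split=> i j.
  apply: eq_polyfun (polyfun_coord _ (lshift (d * d) (mxvec_index i j))) => g.
  by rewrite /coordinates row_mxEl mxvecE.
apply: eq_polyfun (polyfun_coord _ (rshift (d * d) (mxvec_index i j))) => g.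
by rewrite /coordinates row_mxEr mxvecE.
Qed.

(** The adjugate replaces the inverse of g.2: the result is polynomial in g and differs from [flag2]
    by a nonzero scalar on the group. *)
Let fl2_cleared (g : mxpair k d) := invmx G^T *m (map_mx sq (\adj g.2))^T *m G^T.

Lemma fl2_clearedE g : g.2 \in unitmx -> fl2_cleared g = sq (\det g.2) *: fl2 g.
Proof.
move=> g2; rewrite /fl2_cleared flag2E adjE // map_mxZ linearZ /=.
by rewrite -scalemxAr -scalemxAl.
Qed.

Lemma polymx_fl2 : polymx (@coordinates k d) fl2_cleared.
Proof.
have [_ p2] := polymx_coordinates.
apply: polymxM (polymx_const _ _); apply: polymxM (polymx_const _ _) _; apply: polymx_tr.
move=> i j; apply: eq_polyfun (polymx_map q (polymx_adj p2) i j) => g.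
by rewrite -[map_mx _ _]/(frob_mx q _) (frob_mxE sqE).
Qed.

Variable z : rel 'I_d.

(** The second component enters twisted, so that both conditions concern the same flag C, compared
    with A and with s(A). *)
Definition locus (g : mxpair k d) : Prop := forall i j, z i j ->
  (lang g).1 i j = 0 /\ tw (lang g).2 i j = 0.

Lemma locus_open g : GG g -> ~ locus g -> exists f : mpoly.mpoly (d * d + d * d) k,
  mpoly.meval (coordinates g) f != 0 /\
  forall h, GG h -> mpoly.meval (coordinates h) f != 0 -> ~ locus h.
Proof.
move=> gG nl; have [p1 p2] := polymx_coordinates.
have det0 (A : 'M[k]_d) : A \in unitmx -> \det A != 0 by rewrite unitmxE unitfE.
have sq0 x : x != 0 -> sq x != 0 by rewrite fmorph_eq0.
have [i [j [zij nz]]] : exists i j, z i j /\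
    ((lang g).1 i j != 0 \/ tw (lang g).2 i j != 0).
  apply: contrapT => nex; apply: nl => i j zij; apply: contrapT => nz; apply: nex; exists i, j.
  split=> //; have [E1|] := eqVneq ((lang g).1 i j) 0; last by left.
  by have [E2|] := eqVneq (tw (lang g).2 i j) 0; [case: nz | right].
case: nz => nz.
  have E h : GG h -> (\adj h.1 *m fl2_cleared h) i j =
      \det h.1 * sq (\det h.2) * (lang h).1 i j.
    move=> [h1 h2]; rewrite adjE // fl2_clearedE // -scalemxAr -scalemxAl scalerA.
    by rewrite mxE (lang1 iota B e1 e2 sqE) [X in X * _]mulrC.
  have [f fE] : polyfun (@coordinates k d) (fun h => (\adj h.1 *m fl2_cleared h) i j).
    exact: (polymxM (polymx_adj p1) polymx_fl2).
  exists f; split=> [|h hG]; rewrite -fE E //.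
    by have [g1 g2] := gG; rewrite !mulf_neq0 // ?sq0 ?det0.
  by rewrite mulf_eq0 negb_or => /andP[_ /eqP hz] /(_ i j zij)[].
have E h : GG h -> (\adj (map_mx sg h.1) *m fl2_cleared h) i j =
    sg (\det h.1) * sq (\det h.2) * tw (lang h).2 i j.
  move=> [h1 h2]; rewrite adjE ?map_unitmx // fl2_clearedE // -scalemxAr -scalemxAl scalerA.
  by rewrite mxE (twist_lang2 sqE G_unit G_rational) [X in X * _]mulrC det_map_mx.
have [f fE] : polyfun (@coordinates k d) (fun h => (\adj (map_mx sg h.1) *m fl2_cleared h) i j).
  apply: polymxM polymx_fl2 _ _; apply: polymx_adj.
  move=> a b; apply: eq_polyfun (polymx_map q (polymx_map q p1) a b) => h.
  by rewrite map_mx_comp -!(frob_mxE sqE).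
exists f; split=> [|h hG].
  rewrite -(fE g) (E g gG); have [/det0 g1 /det0 g2] := gG.
  by rewrite mulf_neq0 // mulf_neq0 ?sq0 //= !sq0.
by rewrite -(fE h) (E h hG) mulf_eq0 negb_or => /andP[_ /eqP hz] /(_ i j zij)[].
Qed.

Variable J : {set weyl d}.
Hypothesis locus_stable : forall g p, GG g -> parabolic J p -> locus g -> locus (mulG g p).

(** Stability under the parabolic makes the complement of the locus a union of cosets; being open in
    the group, it descends to an open set of the flag variety that misses A. *)
Lemma locus_closure (A : set (flag_variety k J)) :
    (forall c, A c -> exists2 g, GG g & flag_coset c = Defs.coset J g /\ locus g) ->
  forall c, closure A c -> exists2 g, GG g & flag_coset c = Defs.coset J g /\ locus g.
Proof.
move=> Al c Ac; have [g gG cE] := flag_cosetP c; exists g => //; split=> //.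
apply: contrapT => nl.
pose U : set (flag_variety k J) := fun c' =>
  exists2 g', GG g' & flag_coset c' = Defs.coset J g' /\ ~ locus g'.
have U_open : open U.
  split=> [h []//|h [hG [c' [h' h'G [c'E h'l]] hE]]].
  have hl : ~ locus h.
    have [p pJ hp] := coset_eq h'G hG (etrans (esym c'E) hE).
    move=> hl; apply: h'l; have -> : h' = mulG h (invG p).
      by rewrite hp (mulGK h' (parabolic_GG pJ)).
    exact: (locus_stable hG (parabolic_inv pJ) hl).
  have [f [f0 fP]] := locus_open hG hl; exists f; split=> // h1 h1G f1; split=> //.
  exists (to_flag J h1G); last by [].
  by exists h1; last split; [exact: h1G | by [] | exact: (fP h1 h1G f1)].
have [|c' [Ac' [g' g'G [c'E g'l]]]] := Ac U.
  by apply: open_nbhs_nbhs; split; [exact: U_open | exists g].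
have [h hG [hE hl]] := Al c' Ac'; have [p pJ hp] := coset_eq hG g'G (etrans (esym hE) c'E).
by apply: g'l; rewrite hp; exact: (locus_stable hG pJ hl).
Qed.

End Locus.

(** * Relative positions of flags of type J *)

Section Gaps.
Variables (pts : pred nat) (d : nat).

(** 0 and d + 1 are sentinels: with them every index from 0 to d lies in exactly one gap. *)
Definition break x := [|| x == 0, pts x | x == d.+1].

Definition gap_interval x e :=
  [/\ break x, x <= e, e <= d, break e.+1 & forall j, x < j <= e -> ~~ break j].

Lemma gap_interval_uniq x e x' e' i : gap_interval x e -> gap_interval x' e' ->
  x <= i <= e -> x' <= i <= e' -> x = x' /\ e = e'.
Proof.
move=> [bx xe ed be nb] [bx' xe' ed' be' nb'] xi xi'; split.
  have [lt|lt|//] := ltngtP x x'.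
    by have := nb x' ltac:(lia); rewrite bx'.
  by have := nb' x ltac:(lia); rewrite bx.
have [lt|lt|//] := ltngtP e e'.
  by have := nb' e.+1 ltac:(lia); rewrite be.
by have := nb e'.+1 ltac:(lia); rewrite be'.
Qed.

Lemma gap_interval_exists i : i <= d -> exists xe, gap_interval xe.1 xe.2 /\ xe.1 <= i <= xe.2.
Proof.
move=> id; have lower : exists2 x, break x && (x <= i) & forall j, x < j <= i -> ~~ break j.
  elim: i {id} => [|i [x /andP[bx xi] nb]]; first by exists 0 => // j; lia.
  have [bi|nbi] := boolP (break i.+1); first by exists i.+1; [rewrite bi /= | move=> j; lia].
  exists x; first by rewrite bx ltnW.
  by move=> j ji; have [->//|ne] := eqVneq j i.+1; apply: nb; lia.
have upper m : m <= d.+1 - i.+1 -> exists2 e, break e.+1 && (d - m <= e <= d) & forall j, d - m < j <= e -> ~~ break j.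
  elim: m => [|m IH] md.
    by exists d; [rewrite /break eqxx !orbT subn0 leqnn | move=> j; lia].
  have [|e /andP[be me] nb] := IH; first by lia.
  have [bm|nbm] := boolP (break (d - m)).
    exists (d - m.+1); last by move=> j; lia.
    by rewrite (_ : (d - m.+1).+1 = d - m) ?bm /=; lia.
  exists e; first by rewrite be; lia.
  by move=> j jm; have [->//|ne] := eqVneq j (d - m); apply: nb; lia.
have [x /andP[bx xi] nbx] := lower; have [e /andP[be ie] nbe] := upper (d - i) ltac:(lia).
exists (x, e); split; last by rewrite /=; lia.
split=> //=; try lia.
by move=> j j_; have [ji|ij] := leqP j i; [apply: nbx | apply: nbe]; lia.
Qed.

Lemma gap_interval_step i x e : i < d -> gap_interval x e -> x <= i <= e ->
  (~~ break i.+1 /\ x <= i.+1 <= e) \/ (i = e /\ pts i.+1).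
Proof.
move=> id [bx xe ed be nb] xi; have [ie|ei] := ltnP i e.
  by left; split; [apply: nb; lia | lia].
right; have E : i = e by lia.
split=> //; move: be; rewrite -E /break /=; case/orP => // /eqP; lia.
Qed.

Lemma gap_interval_start x e i : gap_interval x e -> x <= i <= e -> break i -> x = i.
Proof.
move=> [_ _ _ _ nb] xi bi; have [->//|ne] := eqVneq x i.
by have := nb i ltac:(lia); rewrite bi.
Qed.

(* In each gap between two points, the letters form an initial segment for
   low_pattern and a final segment for high_pattern. *)
Definition low_pattern (S : pred nat) :=
  forall x, 0 < x < d -> S x -> ~~ pts x -> (0 < x.-1) && S x.-1.
Definition high_pattern (S : pred nat) :=
  forall x, 0 < x < d -> S x -> ~~ pts x.+1 -> (x.+1 < d) && S x.+1.

End Gaps.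

Section Classification.
Local Open Scope ring_scope.
Variables (k : closedFieldType) (sg : {rmorphism k -> k}) (q : nat).
Hypotheses (q_gt1 : (1 < q)%N) (sgE : forall x, sg x = x ^+ q).
Variables (pts : pred nat) (d : nat).
Hypothesis pts_range : forall x, pts x -> (0 < x <= d)%N.

Local Notation Fr A := (map_mx sg A).
Implicit Types a c : 'M[k]_d.

Lemma map_flag a x : Fr (flag a x) = flag (Fr a) x.
Proof. by rewrite /flag map_mxM map_trmx map_pid_mx. Qed.

Lemma flag_full a x (A : 'M[k]_d) : a \in unitmx -> (d <= x)%N -> (A <= flag a x)%MS.
Proof.
move=> a_unit dx; apply: submx_trans (flag_mono a dx); apply: submx_full.
by rewrite /row_full rank_flag.
Qed.

Lemma flag0 a (A : 'M[k]_d) : (flag a 0 <= A)%MS.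
Proof. by rewrite /flag pid_mx_0 mul0mx sub0mx. Qed.

Lemma rank_flag_le a x : (\rank (flag a x) <= x)%N.
Proof.
have [xd|dx] := leqP x d; last by apply: leq_trans (rank_leq_col _) (ltnW dx).
by apply: leq_trans (mxrankM_maxl _ _) _; rewrite rank_pid_mx.
Qed.

Definition incident a c := forall x, pts x ->
  (flag c x.-1 <= flag a x)%MS /\ (flag c x.-1 <= Fr (flag a x))%MS.

Lemma gap_of_incident a c x e : a \in unitmx -> c \in unitmx -> incident a c ->
  gap_interval pts d x e -> gap sg x e (flag c x.-1) (flag a x) (flag c e) (flag a e.+1).
Proof.
move=> a_unit c_unit inc [bx xe ed be nb].
have fa_unit : Fr a \in unitmx by rewrite map_unitmx.
split.
- have xd := leq_trans xe ed; split; [|exact: rank_flag|exact: rank_flag|exact: rank_flag_le].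
  by apply: rank_flag => //; exact: leq_trans (leq_pred x) xd.
- split; [|by apply: flag_mono; lia|].
    by case/or3P: bx => [/eqP->|/inc[]//|/eqP E]; [exact: flag0 | lia].
  by case/or3P: bx => [/eqP->|/inc[]//|/eqP E]; [exact: flag0 | lia].
split; first by apply: flag_mono; lia.
  case/or3P: be => [//|/inc[]//|/eqP->]; exact: flag_full.
case/or3P: be => [//|/inc[]//|/eqP->]; rewrite map_flag; exact: flag_full.
Qed.

(** Each gap is refined on its own. At a point, where two gaps meet, A_e <= A' and P <= C_x make the
    glued spaces increasing, and incidence gives the inclusions of C in A and s(A). *)
Lemma refine_incident a c : a \in unitmx -> c \in unitmx -> incident a c ->
  exists a' c', [/\ a' \in unitmx, c' \in unitmx,
    forall x, pts x -> (flag a' x <= flag a x)%MS,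
    forall x, pts x -> (flag c' x.-1 <= flag c x.-1)%MS &
    [/\ forall x, (x < d)%N -> (flag c' x <= flag a' x.+1)%MS /\ (flag c' x <= Fr (flag a' x.+1))%MS,
     low_pattern pts d (fun x => ~~ (flag c' x <= flag a' x)%MS) &
     high_pattern pts d (fun x => ~~ (flag c' x <= Fr (flag a' x))%MS)]].
Proof.
move=> a_unit c_unit inc.
have /choice[AC ACP] : forall xe : nat * nat, exists AC : (nat -> 'M[k]_d) * (nat -> 'M[k]_d),
    gap_interval pts d xe.1 xe.2 ->
    [/\ chain sg xe.1 xe.2 AC.1 AC.2, (AC.1 xe.1 :=: flag a xe.1)%MS,
        (AC.2 xe.2 :=: flag c xe.2)%MS, (flag c xe.1.-1 <= AC.2 xe.1)%MS
      & (AC.1 xe.2 <= flag a xe.2.+1)%MS].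
  move=> [x e].
  have [xeP|] := pselect (gap_interval pts d x e); last by exists (fun=> 0, fun=> 0).
  have := gap_of_incident a_unit c_unit inc xeP; have [_ xe _ _ _] := xeP.
  rewrite -(subnKC xe) => /(gap_refine q_gt1 sgE)[As [Cs AsCs]].
  by exists (As, Cs).
have /choice[xe xeP] : forall i, exists xe : nat * nat, (i <= d)%N ->
    gap_interval pts d xe.1 xe.2 /\ (xe.1 <= i <= xe.2)%N.
  move=> i.
  have [id|nid] := boolP (i <= d)%N; last by exists (0%N, 0%N).
  by have [xe xeP] := gap_interval_exists pts id; exists xe.
pose As i := (AC (xe i)).1 i; pose Cs i := (AC (xe i)).2 i.
have rAC i : (i <= d)%N -> \rank (As i) = i /\ \rank (Cs i) = i.
  move=> id; have [gi xi] := xeP i id; have [ch _ _ _ _] := ACP _ gi.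
  exact: (chain_rank ch xi).
have As_pts x : pts x -> (As x :=: flag a x)%MS.
  move=> px; have /andP[_ xd] := pts_range px; have [gx xx] := xeP x xd.
  have E : (xe x).1 = x by apply: gap_interval_start gx xx _; rewrite /break px orbT.
  by have [_ + _ _ _] := ACP _ gx; rewrite /As E.
have same i : (i < d)%N -> ~~ pts i.+1 ->
    xe i.+1 = xe i /\ ((xe i).1 <= i < (xe i).2)%N.
  move=> id np; have [gi xi] := xeP i (ltnW id); have [gi1 xi1] := xeP i.+1 id.
  case: (gap_interval_step id gi xi) => [[_ xi1']|[_ pi]]; last by rewrite pi in np.
  have [E1 E2] := gap_interval_uniq gi1 gi xi1 xi1'; split.
    by rewrite [LHS]surjective_pairing E1 E2 -surjective_pairing.
  by have /andP[-> _] := xi; have /andP[_ ->] := xi1'.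
have Cs_pts x : pts x -> (Cs x.-1 :=: flag c x.-1)%MS.
  move=> px; have /andP[x0 xd] := pts_range px; have id : (x.-1 < d)%N by rewrite prednK.
  have [gi xi] := xeP x.-1 (ltnW id); have [_ _ Ce _ _] := ACP _ gi.
  case: (gap_interval_step id gi xi) => [[]|[E _]]; first by rewrite prednK // /break px orbT.
  by move: Ce; rewrite -E.
have stepAC i : (i < d)%N -> [/\ As i <= As i.+1, Cs i <= Cs i.+1, Cs i <= As i.+1 &
    Cs i <= Fr (As i.+1)]%MS.
  move=> id; have [pi|npi] := boolP (pts i.+1); last first.
    have [E xi] := same i id npi; rewrite /As /Cs E.
    have [gi _] := xeP i (ltnW id); have [ch _ _ _ _] := ACP _ gi.
    exact: (chain_sub ch xi).
  have [inc1 inc2] := inc _ pi; rewrite /= in inc1 inc2.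
  have Ei := Cs_pts _ pi; rewrite /= in Ei.
  have Ai := As_pts _ pi; have FAi := eqmx_map sg Ai.
  have [gi1 xi1] := xeP i.+1 id.
  have E1 : (xe i.+1).1 = i.+1 by apply: gap_interval_start gi1 xi1 _; rewrite /break pi orbT.
  have [gi xi] := xeP i (ltnW id).
  have E2 : (xe i).2 = i.
    by case: (gap_interval_step id gi xi) => [[]|[<-]//]; rewrite /break pi orbT.
  split.
  - have [_ _ _ _] := ACP _ gi; by rewrite Ai /As E2.
  - have [_ _ _ + _] := ACP _ gi1; by rewrite Ei /Cs E1.
  - by rewrite Ei Ai.
  by rewrite Ei FAi.
have [a' a'_unit a'E] : exists2 a', a' \in unitmx & forall i, (i <= d)%N -> (flag a' i :=: As i)%MS.
  by apply: flag_of_chain => i id; [have [] := rAC i id | have [] := stepAC i id].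
have [c' c'_unit c'E] : exists2 c', c' \in unitmx & forall i, (i <= d)%N -> (flag c' i :=: Cs i)%MS.
  by apply: flag_of_chain => i id; [have [] := rAC i id | have [] := stepAC i id].
have Fa'E i : (i <= d)%N -> (Fr (flag a' i) :=: Fr (As i))%MS.
  by move=> id; apply: eqmx_map; exact: a'E.
exists a', c'; split=> // [x px|x px|].
- by have /andP[_ xd] := pts_range px; rewrite a'E // As_pts.
- have /andP[x0 xd] := pts_range px.
  by rewrite (c'E x.-1 (leq_trans (leq_pred x) xd)) Cs_pts.
split.
- move=> x xd; have [_ _ h1 h2] := stepAC x xd.
  by split; rewrite (c'E x (ltnW xd)); [rewrite (a'E x.+1 xd) | rewrite (Fa'E x.+1 xd)].
- move=> x /andP[x0 xd]; rewrite (c'E x (ltnW xd)) (a'E x (ltnW xd)) => nP np.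
  have id : (x.-1 < d)%N by rewrite prednK // ltnW.
  have np1 : ~~ pts x.-1.+1 by rewrite prednK.
  have [E xi] := same _ id np1; rewrite prednK // in E.
  have [gi _] := xeP _ (ltnW id); have [ch _ _ _ _] := ACP _ gi.
  have nP1 : ~~ (Cs x.-1 <= As x.-1)%MS.
    apply: contra nP; rewrite /Cs /As E => le.
    by have := chain_low ch xi le; rewrite prednK.
  rewrite (c'E _ (ltnW id)) (a'E _ (ltnW id)) nP1 andbT lt0n.
  (* x - 1 = 0 is excluded because C_0 is the zero space; for the high pattern below, x + 1 = d is
     excluded because A_d is the whole space. *)
  apply: contra nP1 => /eqP x1; have [_] := rAC _ (ltnW id); rewrite x1 => /eqP.
  by rewrite mxrank_eq0 => /eqP ->; exact: sub0mx.
move=> x /andP[x0 xd]; rewrite (c'E x (ltnW xd)) (Fa'E x (ltnW xd)) => nQ np.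
have [E xi] := same _ xd np.
have [gi _] := xeP _ (ltnW xd); have [ch _ _ _ _] := ACP _ gi.
have nQ1 : ~~ (Cs x.+1 <= Fr (As x.+1))%MS.
  by apply: contra nQ; rewrite /Cs /As E; exact: (chain_high ch xi).
rewrite (c'E _ xd) (Fa'E _ xd) nQ1 andbT ltn_neqAle xd andbT.
apply: contra nQ1 => /eqP x1; apply: submx_full; rewrite /row_full mxrank_map.
by have [-> _] := rAC _ xd; rewrite x1.
Qed.

(** On each gap both pairs of flags are chains, and their ends agree by the hypotheses at the points
    or because they are zero or the whole space; [chain_unique] then compares the patterns. *)
Lemma refinement_pattern_unique a c a' c' (S S2 T T2 : pred nat) :
    a \in unitmx -> c \in unitmx -> a' \in unitmx -> c' \in unitmx ->
    (forall x, (x < d)%N -> (flag c x <= flag a x.+1)%MS /\ (flag c x <= Fr (flag a x.+1))%MS) ->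
    (forall x, (x < d)%N -> (flag c' x <= flag a' x.+1)%MS /\ (flag c' x <= Fr (flag a' x.+1))%MS) ->
    (forall x, (0 < x < d)%N -> (flag c x <= flag a x)%MS = ~~ S x /\
                               (flag c x <= Fr (flag a x))%MS = ~~ S2 x) ->
    (forall x, (0 < x < d)%N -> (flag c' x <= flag a' x)%MS = ~~ T x /\
                               (flag c' x <= Fr (flag a' x))%MS = ~~ T2 x) ->
    low_pattern pts d S -> low_pattern pts d T ->
    high_pattern pts d S2 -> high_pattern pts d T2 ->
    (forall x, pts x -> (flag a x :=: flag a' x)%MS) ->
    (forall x, pts x -> (flag c x.-1 :=: flag c' x.-1)%MS) ->
  forall x, (0 < x < d)%N -> S x = T x /\ S2 x = T2 x.
Proof.
move=> a_unit c_unit a'_unit c'_unit h h' eS eT lS lT hS hT ea ec.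
have chainP (b e : 'M[k]_d) (U U2 : pred nat) x y : b \in unitmx -> e \in unitmx ->
    (forall x, (x < d)%N -> (flag e x <= flag b x.+1)%MS /\ (flag e x <= Fr (flag b x.+1))%MS) ->
    (forall x, (0 < x < d)%N -> (flag e x <= flag b x)%MS = ~~ U x /\
                               (flag e x <= Fr (flag b x))%MS = ~~ U2 x) ->
    low_pattern pts d U -> high_pattern pts d U2 -> gap_interval pts d x y ->
    chain sg x y (flag b) (flag e).
  move=> b_unit e_unit hb eU lU hU [bx xy yd by_ nb].
  have Fb_unit : Fr b \in unitmx by rewrite map_unitmx.
  have nbS i : (x <= i < y)%N -> ~~ pts i.+1.
    by move=> /andP[xi iy]; have := nb i.+1; rewrite ltnS xi iy /break => /(_ isT); rewrite !negb_or => /and3P[].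
  split=> i /andP[xi iy].
  - by rewrite !rank_flag // (leq_trans iy).
  - have id := leq_trans iy yd; have [h1 h2] := hb i id.
    by split=> //; apply: flag_mono.
  - have id := leq_trans iy yd; move=> le; move: (id); rewrite leq_eqVlt => /predU1P[E|i1d].
      by apply: flag_full; rewrite // E.
    have [-> _] := eU i.+1 i1d; apply/negP => Ui1.
    have /andP[i0 Ui] := lU i.+1 i1d Ui1 (nbS i (introT andP (conj xi iy))); rewrite /= in i0 Ui.
    by have [] := eU i (introT andP (conj i0 id)); rewrite le Ui.
  have id := leq_trans iy yd; move=> le; have [i0|i0] := posnP i.
    by rewrite i0; exact: flag0.
  have id' : (0 < i < d)%N by rewrite i0.
  have [_ ->] := eU i id'; apply/negP => Ui.
  have /andP[i1d Ui1] := hU i id' Ui (nbS i (introT andP (conj xi iy))).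
  by have [_] := eU i.+1 i1d; rewrite le Ui1.
move=> x x0d; have /andP[x0 xd] := x0d.
have [[y e] /= [g xi]] := gap_interval_exists pts (ltnW xd).
have [by_ ye ed be nb] := g.
have ch := chainP a c S S2 _ _ a_unit c_unit h eS lS hS g.
have ch' := chainP a' c' T T2 _ _ a'_unit c'_unit h' eT lT hT g.
have eA : (flag a y :=: flag a' y)%MS.
  case/or3P: by_ => [/eqP->|/ea//|/eqP E].
    by apply/eqmxP; rewrite !flag0.
  by apply/eqmxP; rewrite !flag_full // E.
have eC : (flag c e :=: flag c' e)%MS.
  case/or3P: be => [//|/ec//|/eqP[->]].
  by apply/eqmxP; rewrite !flag_full.
move: ch ch' eC xi; rewrite -(subnKC ye) => ch ch' eC xi.
have [E1 E2] := chain_unique ch ch' eA eC xi.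
have [Sx S2x] := eS x x0d; have [Tx T2x] := eT x x0d.
by move: E1 E2; rewrite Sx S2x Tx T2x => /negb_inj -> /negb_inj ->.
Qed.

End Classification.

Lemma frobenius_rmorphism (R : comNzRingType) (p a : nat) : p \in [pchar R]%R ->
  exists f : {rmorphism R -> R}, forall x, f x = (x ^+ (p ^ a))%R.
Proof.
move=> pR; elim: a => [|a [f fE]]; first by exists idfun => x; rewrite expn0 expr1.
by exists (pFrobenius_aut pR \o f) => x; rewrite /= fE pFrobenius_autE -exprM expnSr.
Qed.

(** * From pairs of flags to the strata *)

Section Assembly.
Local Open Scope ring_scope.
Variables (F : fieldType) (k : closedFieldType) (iota : {rmorphism F -> k}) (q d : nat).
Variables (V1 V2 : vectType F) (B : V1 -> V2 -> F) (e1 : d.-tuple V1) (e2 : d.-tuple V2).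
Variable sq : {rmorphism k -> k}.
Hypotheses (q_gt1 : (1 < q)%N) (sqE : forall x, sq x = x ^+ q) (q0 : q%:R = 0 :> k).

Local Notation G := (gram iota B e1 e2).
Local Notation lang := (lang iota q B e1 e2).
Local Notation tw := (twist iota B e1 e2 sq).
Local Notation fl2 := (flag2 iota B e1 e2 sq).
Local Notation sg := (sq \o sq).

Hypotheses (G_unit : G \in unitmx) (G_anti : forall i j : 'I_d, (G i j != 0) = (i == rev_ord j))
  (G_rational : map_mx sq (map_mx sq G) = G).

Variables (pts : pred nat) (J : {set weyl d}).
Hypothesis pts_range : forall x, pts x -> (0 < x <= d)%N.
Hypothesis J1E : forall x, (0 < x < d)%N -> (simple1 d x \notin J) = pts x.
Hypothesis J2E : forall x, (0 < x < d)%N -> (simple2 d x \notin J) = pts (d.+1 - x)%N.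

Let sgE x : sg x = x ^+ (q * q).
Proof. by rewrite /= !sqE exprM. Qed.

Let qq_gt1 : (1 < q * q)%N.
Proof. by rewrite (leq_trans q_gt1) // leq_pmull // ltnW. Qed.

Lemma fl2_unit g : GG g -> fl2 g \in unitmx.
Proof. by move=> [g1 g2]; rewrite /flag2 twist_unit // unitmx_inv. Qed.

Lemma eq_hess (S T : pred nat) (u : 'M[k]_d) : (forall i, (0 < i < d)%N -> S i = T i) -> hess S u -> hess T u.
Proof. by move=> ST [u0 uS]; split=> // i j ij; rewrite uS // ST // ltn_ord ij. Qed.

Lemma hess_lang2 (S : pred nat) g :
  hess S (lang g).2 <-> hess (fun x => S (d - x)%N) (invmx (map_mx sg g.1) *m fl2 g).
Proof.
rewrite -(twist_lang2 sqE G_unit G_rational) -(hess_twist sq G_unit G_anti).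
by split; apply: eq_hess => i /andP[_ id]; rewrite subKn // ltnW.
Qed.

Lemma hess_langP (S S' : pred nat) g : GG g ->
  hess S (lang g).1 /\ hess S' (lang g).2 <->
  (forall x, (x < d)%N -> (flag (fl2 g) x <= flag g.1 x.+1)%MS /\
      (flag (fl2 g) x <= map_mx sg (flag g.1 x.+1))%MS) /\
  (forall x, (0 < x < d)%N -> (flag (fl2 g) x <= flag g.1 x)%MS = ~~ S x /\
      (flag (fl2 g) x <= map_mx sg (flag g.1 x))%MS = ~~ S' (d - x)%N).
Proof.
move=> [g1 g2]; have Fg1 : map_mx sg g.1 \in unitmx by rewrite map_unitmx.
rewrite hess_lang2 (lang1 iota B e1 e2 sqE) !hess_flag //; split.
  move=> [[s1 t1] [s2 t2]]; split=> x xd; rewrite !map_flag.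
    by split; [exact: s1 | exact: s2].
  by split; apply/idP/idP; first [by move/(t1 x xd) | by move/(t2 x xd)].
move=> [s t]; split; split=> x xd.
- by have [] := s x xd.
- by have [-> _] := t x xd.
- by have [_] := s x xd; rewrite map_flag.
- by have [_] := t x xd; rewrite map_flag => ->.
Qed.

(* The entries that vanish in Hessenberg form and that the parabolic subgroup
   of type J does not mix with the others. *)
Definition far (i j : 'I_d) : bool := [exists x : 'I_d.+1, [&& pts x, j < x.-1 & x <= i]%N].

Lemma locus_incident g : GG g ->
  locus iota q B e1 e2 sq far g <-> incident sg pts g.1 (fl2 g).
Proof.
move=> [g1 g2]; have Fg1 : map_mx sg g.1 \in unitmx by rewrite map_unitmx.
split=> [loc x px|inc i j /existsP[x /and3P[px jx xi]]].
  have /andP[x0 xd] := pts_range px.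
  have farP (i j : 'I_d) : (j < x.-1)%N -> (x <= i)%N -> far i j.
    by move=> jx xi; apply/existsP; exists (Ordinal (xd : (x < d.+1)%N)); rewrite /= px jx xi.
  rewrite map_flag; split; apply/flag_sub => // i j jx xi; have [l1 l2] := loc i j (farP i j jx xi).
    by rewrite -(lang1 iota B e1 e2 sqE).
  by rewrite -(twist_lang2 sqE G_unit G_rational).
have [] := inc x px; rewrite map_flag => /flag_sub s1 /flag_sub s2; split.
  by rewrite (lang1 iota B e1 e2 sqE); apply: s1.
by rewrite (twist_lang2 sqE G_unit G_rational); apply: s2.
Qed.

Lemma parabolic_flags p : parabolic J p -> forall x, pts x ->
  stabilizes x p.1 /\ stabilizes x.-1 (tw p.2).
Proof.
move=> [pG ps] x px; have /andP[x0 xd] := pts_range px; split.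
  have [xd'|dx] := ltnP x d.
    by have [+ _] := ps x (introT andP (conj x0 xd')); rewrite J1E ?x0 // => /(_ px).
  by move=> i j /andP[_ xi]; have := leq_trans dx xi; rewrite leqNgt ltn_ord.
have [x1|x1] := posnP x.-1; first by rewrite x1 => i j.
apply/stabilizesE; apply/(block_zero_twist sq G_unit G_anti) => //.
- exact: leq_trans (leq_pred x) xd.
- exact: leq_trans (leq_pred x) xd.
(* C_(x-1) is orthogonal to a member of dimension d - (x - 1) of the second flag, and [J2E] tests
   that letter at the point d + 1 - (d - (x - 1)) = x. *)
have yd : (0 < d - x.-1 < d)%N by lia.
apply/stabilizesE; have [_] := ps _ yd; rewrite J2E //; apply.
by rewrite (_ : (d.+1 - (d - x.-1) = x)%N) //; lia.
Qed.

Lemma parabolicP p : GG p -> (forall x, pts x -> stabilizes x p.1 /\ stabilizes x.-1 (tw p.2)) ->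
  parabolic J p.
Proof.
move=> pG ps; split=> // x xd; have /andP[x0 xd'] := xd; rewrite J1E // J2E //; split=> px.
  by have [] := ps _ px.
have [_ /stabilizesE] := ps _ px.
rewrite (_ : (d.+1 - x).-1 = d - x)%N; last by lia.
move/(block_zero_twist sq G_unit G_anti _ (leq_subr x d) (leq_subr x d)).
by rewrite subKn ?(ltnW xd') // => /stabilizesE.
Qed.

Lemma incident_mul g p : GG g -> parabolic J p ->
  forall x, pts x -> (flag (mulG g p).1 x :=: flag g.1 x)%MS /\
    (flag (fl2 (mulG g p)) x.-1 :=: flag (fl2 g) x.-1)%MS.
Proof.
move=> gG pJ x px; have [g1 g2] := gG; have [[p1 p2] _] := pJ.
have /andP[x0 xd] := pts_range px; have x1d := leq_trans (leq_pred x) xd.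
have [s1 s2] := parabolic_flags pJ px.
have gpG : GG (mulG g p) by apply: GG_mul => //; exact: parabolic_GG pJ.
have c_unit := fl2_unit gG; have c'_unit := fl2_unit gpG; have [gp1 gp2] := gpG.
split; apply: eqmx_rank_sub; rewrite ?rank_flag //.
  by apply/flag_sub => //; rewrite mulKmx //; apply/stabilizesE.
apply/flag_sub => //; rewrite {2}/flag2 /= invmx_mul // twistM // -/(fl2 g) mulKmx //.
rewrite twistV //; apply/stabilizesE; apply: stabilizesV => //.
by rewrite twist_unit.
Qed.

Lemma locus_stable g p : GG g -> parabolic J p ->
  locus iota q B e1 e2 sq far g -> locus iota q B e1 e2 sq far (mulG g p).
Proof.
move=> gG pJ; have gpG : GG (mulG g p) by apply: GG_mul => //; exact: parabolic_GG pJ.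
rewrite !locus_incident // => inc x px; have [i1 i2] := inc x px.
have [ea ec] := incident_mul gG pJ px; have eFa := eqmx_map sg ea.
by split; rewrite ec ?ea ?eFa.
Qed.

Lemma hess_locus (S S' : pred nat) g : GG g -> hess S (lang g).1 -> hess S' (lang g).2 ->
  locus iota q B e1 e2 sq far g.
Proof.
move=> gG h1 /hess_lang2 h2 i j /existsP[x /and3P[_ jx xi]].
have ji : (j.+1 < i)%N by lia.
split; first exact: h1.1.
by rewrite (twist_lang2 sqE G_unit G_rational); apply: h2.1.
Qed.

Lemma locus_refine g : GG g -> locus iota q B e1 e2 sq far g -> exists p S S2,
  [/\ parabolic J p, low_pattern pts d S, high_pattern pts d S2 &
    hess S (lang (mulG g p)).1 /\ hess (fun x => S2 (d - x)%N) (lang (mulG g p)).2].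
Proof.
move=> gG /(locus_incident gG) inc; have [g1 g2] := gG.
have [a [c [a_unit c_unit aE cE [h low high]]]] :=
  refine_incident qq_gt1 sgE pts_range g1 (fl2_unit gG) inc.
(* The flag c has to come from the second factor; the inverse of v is used below because [flag2]
   twists the inverse of that component. *)
have [v vE] := twist_surj sqE G_unit c q_gt1.
have v_unit : v \in unitmx by rewrite -(twist_unit sq G_unit) vE.
pose g' : mxpair k d := (a, invmx v).
have g'G : GG g' by split; rewrite //= unitmx_inv.
have g'E : mulG g (mulG (invG g) g') = g' by rewrite (mulKVG _ gG).
have fl2g' : fl2 g' = c by rewrite /flag2 /= invmxK.
exists (mulG (invG g) g').
exists (fun x => ~~ (flag c x <= flag a x)%MS), (fun x => ~~ (flag c x <= map_mx sg (flag a x))%MS).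
rewrite g'E; split=> //.
  have pG : GG (mulG (invG g) g') by apply: GG_mul => //; exact: GG_inv.
  apply: parabolicP => // x px; have /andP[x0 xd] := pts_range px; split.
    by apply/stabilizesE; apply/flag_sub => //; exact: aE.
  have -> : tw (mulG (invG g) g').2 = invmx (invmx (fl2 g) *m c).
    by rewrite /= twistM // twistV // vE invmx_mul ?unitmx_inv ?fl2_unit // invmxK.
  apply: stabilizesV.
  - by rewrite unitmx_mul unitmx_inv fl2_unit.
  - exact: leq_trans (leq_pred x) xd.
  by apply/stabilizesE; apply/flag_sub; [exact: fl2_unit | exact: cE].
apply/hess_langP => //; rewrite fl2g' /=; split=> x xd; first exact: h.
rewrite !negbK; split=> //; by rewrite subKn //; have /andP[_ /ltnW] := xd.
Qed.

Lemma pattern_unique (c : flag_variety k J) (S S' T T' : pred nat) :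
    ~~ S 0%N -> ~~ S' 0%N -> ~~ T 0%N -> ~~ T' 0%N ->
    low_pattern pts d S -> high_pattern pts d (fun x => S' (d - x)%N) ->
    low_pattern pts d T -> high_pattern pts d (fun x => T' (d - x)%N) ->
    fine_DL iota q B e1 e2 J (pattern_perm d S, pattern_perm d S') c ->
    fine_DL iota q B e1 e2 J (pattern_perm d T, pattern_perm d T') c ->
  forall x, (0 < x < d)%N -> S x = T x /\ S' x = T' x.
Proof.
move=> S0 S'0 T0 T'0 lS hS lT hT.
move/(fine_DL_hess sqE G_unit G_rational _ S0 S'0) => [g gG [cE /(hess_langP _ _ gG)[s1 s2]]].
move/(fine_DL_hess sqE G_unit G_rational _ T0 T'0) => [g' g'G [c'E /(hess_langP _ _ g'G)[t1 t2]]].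
have [p pJ g'E] := coset_eq gG g'G (etrans (esym cE) c'E).
have [g1 _] := gG; have [g'1 _] := g'G.
have ea x : pts x -> (flag g.1 x :=: flag g'.1 x)%MS.
  by move=> px; apply: eqmx_sym; rewrite g'E; have [] := incident_mul gG pJ px.
have ec x : pts x -> (flag (fl2 g) x.-1 :=: flag (fl2 g') x.-1)%MS.
  by move=> px; apply: eqmx_sym; rewrite g'E; have [] := incident_mul gG pJ px.
have main := refinement_pattern_unique g1 (fl2_unit gG) g'1 (fl2_unit g'G) s1 t1 s2 t2
  lS lT hS hT ea ec.
move=> x xd; split; first by have [] := main x xd.
have xd' : (0 < d - x < d)%N by lia.
by have [_] := main _ xd'; rewrite subKn //; lia.
Qed.

Lemma fine_DL_closure (S S' T T' : pred nat) (c : flag_variety k J) :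
    ~~ S 0%N -> ~~ S' 0%N -> ~~ T 0%N -> ~~ T' 0%N ->
    (forall x, S x -> T x) -> (forall x, S' x -> T' x) ->
    fine_DL iota q B e1 e2 J (pattern_perm d S, pattern_perm d S') c ->
  closure (fine_DL iota q B e1 e2 J (pattern_perm d T, pattern_perm d T')) c.
Proof.
move=> S0 S'0 T0 T'0 ST ST'.
move/(fine_DL_hess sqE G_unit G_rational _ S0 S'0) => [g gG [cE [h1 h2]]] A.
rewrite nbhsE => -[U [Uo Uc] UA].
have [_ /(_ g)[|f [f0 fP]]] : flag_open U := Uo; first by split=> //; exists c.
(* Ones on the subdiagonal at the letters of Q missing from P: adding t times this matrix turns
   exactly these zero entries into t, hence P into Q. *)
pose corner (P Q : pred nat) : 'M[k]_d :=
  \matrix_(i, j) ((i == j.+1 :> nat) && Q i && ~~ P i)%:R.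
have [t t0 [g' g'G [f' langE]]] :=
  lang_density q_gt1 sqE q0 G_unit G_rational (corner S T) (corner S' T') gG f0.
have [_ [c' Uc' c'E]] := fP g' g'G f'.
exists c'; split; last exact: UA.
have hessD (P Q : pred nat) (u : 'M[k]_d) : (forall x, P x -> Q x) -> hess P u ->
    hess Q (u + t *: corner P Q).
  move=> PQ [u0 uP]; split=> i j ij.
    by rewrite !mxE u0 // (_ : (i == j.+1 :> nat) = false) ?mulr0 ?addr0 // gtn_eqF.
  rewrite !mxE ij eqxx /= -ij; have := uP i j ij.
  have [Pi|nPi] := boolP (P i); first by rewrite (PQ _ Pi) /= mulr0 addr0.
  by move/negbFE/eqP => ->; rewrite add0r andbT; case: (Q i); rewrite ?mulr1 ?mulr0 ?t0 ?eqxx.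
apply/(fine_DL_hess sqE G_unit G_rational) => //; exists g' => //; split=> //.
by rewrite langE; split; apply: hessD.
Qed.

End Assembly.

Lemma rev_letter d x : 0 < x < d ->
  [/\ 0 < d - x < d, d.+1 - (d - x) = x.+1 & (d - x).-1 = d - x.+1].
Proof. by split; lia. Qed.

Lemma pred_letter d x : 0 < x < d ->
  [/\ 0 < x.-1 -> 0 < x.-1 < d, d.+1 - x = (d - x).+1 &
      (d - x).+1 < d -> 0 < x.-1 < d /\ d - x.-1 = (d - x).+1].
Proof. by split; lia. Qed.

Local Open Scope classical_set_scope.

Theorem proposition3p26
  (p a q : nat) (F : finFieldType) (k : closedFieldType)
  (iota : {rmorphism F -> k})
  (p_prime : prime p) (p_odd : odd p) (a_gt0 : (0 < a)%N)
  (q_def : q = (p ^ a)%N) (card_F : #|F| = (q ^ 2)%N)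
  (k_algebraic : integralRange iota)
  (N : nat) (h : nat -> nat) (l0 l1 d : nat)
  (N_gt0 : (1 <= N)%N)
  (h_incr : forall i j, (1 <= i)%N -> (i < j)%N -> (j <= N)%N -> (h i < h j)%N)
  (h_parity : forall i, (1 <= i <= N)%N -> odd (h i) = odd (h 1%N))
  (l0_gt0 : (1 <= l0)%N) (l1_gt0 : (1 <= l1)%N)
  (d_def : d = ((l0 + l1 - 1) + (h N - h 1%N)./2)%N)
  (V1 V2 : vectType F) (B : V1 -> V2 -> F)
  (dim_V1 : \dim {:V1} = d) (dim_V2 : \dim {:V2} = d)
  (B_perfect : perfect_pairing q B)
  (e1 : d.-tuple V1) (e2 : d.-tuple V2)
  (e1_basis : basis_of {:V1} e1) (e2_basis : basis_of {:V2} e2)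
  (e12_flags : orthogonal_flags B e1 e2)
  (T_stable : torus_stable iota q B e1 e2) :
  let J := Jh N h l0 l1 d in
  let XJ := fine_DL iota q B e1 e2 J in
  let D := index_set N h l0 l1 d in
  (forall ww, D ww -> min_coset_rep J (index_prod ww)) /\
  X_Lambda N h l0 l1 iota q B e1 e2 = \bigcup_(ww in D) XJ (index_prod ww) /\
  trivIset D (fun ww => XJ (index_prod ww)).
Proof.
move=> J XJ D; have p_gt1 := prime_gt1 p_prime.
have q_gt1 : (1 < q)%N by rewrite q_def -(exp1n a) ltn_exp2r.
have pF : (p \in [pchar F])%R.
  by apply: (@card_finPcharP _ p (a * 2)) => //; rewrite card_F q_def expnM.
have pk : (p \in [pchar k])%R by rewrite (fmorph_pchar iota).
have q0 : (q%:R = 0 :> k)%R.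
  by rewrite q_def natrX (pcharf0 pk) expr0n; case: (a) a_gt0.
have [sq sqE'] := frobenius_rmorphism a pk.
have sqE (x : k) : sq x = (x ^+ q)%R by rewrite sqE' -q_def.
have G_unit := gram_unit iota B_perfect e1_basis e2_basis.
have G_anti := gram_antidiag B_perfect e1_basis e2_basis (ltnW q_gt1) e12_flags T_stable.
(* The entries come from [F], whose q^2 elements are fixed by the q^2-Frobenius. *)
have G_rational : map_mx sq (map_mx sq (gram iota B e1 e2)) = gram iota B e1 e2.
  apply/matrixP => i j; rewrite !mxE !sqE -exprM -rmorphXn /=.
  by rewrite -[(q * q)%N]/(q ^ 2)%N -card_F expf_card.
pose P := pts N h l1.
have P_range x : P x -> (0 < x <= d)%N.
  by move=> /(pts_bounds N_gt0 h_incr h_parity l0_gt0 l1_gt0 d_def)[]; lia.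
have cutE x : (0 < x < d)%N -> cut (k_seq N h l1 d) x = P x by rewrite cut_k_seq => ->.
have cutE' x : (0 < x < d)%N -> cut (k'_seq N h l0 d) x = P (d.+1 - x)%N.
  by rewrite (cut_k'_seq N_gt0 h_incr h_parity l0_gt0 l1_gt0 d_def) => ->.
have J1E x : (0 < x < d)%N -> (simple1 d x \notin J) = P x.
  by move=> xd; rewrite simple1_J // negbK cutE.
have J2E x : (0 < x < d)%N -> (simple2 d x \notin J) = P (d.+1 - x)%N.
  by move=> xd; rewrite simple2_J // negbK cutE'.
have admP S S' : adm_pair N h l0 l1 d S S' ->
    [/\ ~~ S 0%N, ~~ S' 0%N, low_pattern P d S & high_pattern P d (fun x => S' (d - x)%N)].
  move=> [[S0 Sd Sc] [S'0 S'd S'c]]; split=> // x xd Sx nP.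
    have S1 : S x.-1 by apply: Sc; rewrite ?cutE.
    by rewrite S1 andbT lt0n; apply: contraNneq S0 => <-.
  have [yd E1 E2] := rev_letter xd.
  have S1 : S' (d - x.+1)%N by rewrite -E2; apply: S'c; rewrite ?cutE' ?E1.
  rewrite S1 andbT ltn_neqAle; apply/andP; split; last by case/andP: xd.
  by apply: contraNneq S'0 => E; move: S1; rewrite E subnn.
have [Ta Ta'] := (adm_pair_top N_gt0 h_incr h_parity l0_gt0 l1_gt0 d_def).
have [T0 T'0 _ _] := admP _ _ (conj Ta Ta').
split; [|split].
- move=> ww /index_setE[S [S' [Sa ->]]].
  by rewrite index_prod_words //; apply: adm_pair_min.
- rewrite /X_Lambda -(top_pattern_perm d l1_gt0) -(top_pattern_perm d l0_gt0).
  apply/seteqP; split=> c.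
    move/(locus_closure sqE G_unit G_rational
      (locus_stable (J := J) q_gt1 sqE G_unit G_anti G_rational P_range J1E J2E)) => [|g gG [cE loc]].
      move=> c' /(fine_DL_hess sqE G_unit G_rational _ T0 T'0) [g gG [cE [h1 h2]]].
      exists g => //; split=> //.
      exact: (hess_locus q_gt1 sqE G_unit G_anti G_rational gG h1 h2).
    have [r [S [S2 [rJ lS hS [h1 h2]]]]] :=
      locus_refine q_gt1 sqE G_unit G_anti G_rational P_range J1E J2E gG loc.
    (* The refinement controls letters between 1 and d - 1 only, so the rest is cut off; the second
       pattern is read backwards, which turns its final segments into initial ones. *)
    pose S1 x := (0 < x < d)%N && S x; pose S1' y := (0 < y < d)%N && S2 (d - y)%N.
    have Sa : adm_pair N h l0 l1 d S1 S1'.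
      split; split; rewrite /S1 /S1' ?ltnn //; try by move=> x dx; rewrite (ltnNge x d) dx andbF.
        move=> x /andP[xd Sx]; rewrite cutE // => nP.
        by have /andP[x1 ->] := lS x xd Sx nP; have [/(_ x1) -> _ _] := pred_letter xd.
      move=> y /andP[yd Sy]; rewrite cutE' // => nP.
      have [yd' _ _] := rev_letter yd; have [_ yE y1E] := pred_letter yd.
      have /andP[/y1E[-> ->] ->] : ((d - y).+1 < d)%N && S2 (d - y).+1 by apply: hS; rewrite // -yE.
      by [].
    exists (word_pair N h l0 l1 d S1 S1'); first by apply/index_setE; exists S1, S1'.
    have [S10 S1'0 _ _] := admP _ _ Sa; rewrite index_prod_words //.
    have rG := parabolic_GG rJ.
    apply/(fine_DL_hess sqE G_unit G_rational _ S10 S1'0).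
    exists (mulG g r); first exact: GG_mul gG rG.
    rewrite coset_mul //; split=> //; split.
      by apply: eq_hess h1 => x xd; rewrite /S1 xd.
    by apply: eq_hess h2 => x xd; rewrite /S1' xd.
  move=> [ww /index_setE[S [S' [Sa ->]]]]; rewrite index_prod_words // => cS.
  have [S0 S'0 _ _] := admP _ _ Sa.
  have [ST ST'] := adm_pair_sub_top N_gt0 h_incr h_parity l0_gt0 l1_gt0 d_def Sa.
  exact: (fine_DL_closure q_gt1 sqE q0 G_unit G_rational S0 S'0 T0 T'0 ST ST' cS).
move=> ww ww' /index_setE[S [S' [Sa ->]]] /index_setE[T [T' [Ta1 ->]]] [c [cS cT]].
have [S0 S'0 lS hS] := admP _ _ Sa; have [T0' T'0' lT hT] := admP _ _ Ta1.
rewrite /XJ index_prod_words // in cS; rewrite /XJ index_prod_words // in cT.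
have ST := pattern_unique q_gt1 sqE G_unit G_anti G_rational P_range J1E J2E
  S0 S'0 T0' T'0' lS hS lT hT cS cT.
have [[_ Sd _] [_ S'd _]] := Sa; have [[_ Td _] [_ T'd _]] := Ta1.
(* Disjointness is asserted for distinct tuples, so the patterns must agree everywhere: outside 1,
   ..., d - 1 admissible patterns are empty. *)
rewrite /word_pair; congr pair; apply: eq_pattern_words => x;
  (have [->|x0] := posnP x; first by [rewrite (negPf S0) (negPf T0') | rewrite (negPf S'0) (negPf T'0')]);
  (have [xd|dx] := ltnP x d; first by have [] := ST x (introT andP (conj x0 xd))).
  by rewrite (negPf (Sd x dx)) (negPf (Td x dx)).
by rewrite (negPf (S'd x dx)) (negPf (T'd x dx)).
Qed.
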